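(* Let $T\in\mathfrak{E}_1(H)$, and let $(\mathbb{C},\Gamma_+,\Gamma_-)$ be a boundary triplet such that the strictly accumulative extension $T_\infty$ is complete and has only simple eigenvalues $\{\lambda_j\}_{j=1}^\infty$ (in the lower half-plane). Let $$B_l(\lambda)=\frac{\lambda_l}{\overline{\lambda_l}}\prod_{j\neq l}\frac{\lambda_j}{\overline{\lambda_j}}\,\frac{\lambda-\overline{\lambda_j}}{\lambda-\lambda_j}.$$ Then $T_\infty$ is Riesz complete if and only if $\inf_{j\ge1}|B_j(\overline{\lambda_j})|>0$.
   Context: Entire operators. $H$ denotes a separable infinite-dimensional complex Hilbert space (inner products are linear in the first variable). A symmetric operator $T$ in $H$ is a linear operator on a subspace $D(T)\subset H$, not necessarily dense, with $(Tx,y)=(x,Ty)$ for all $x,y\in D(T)$; it is always assumed closed. $T$ is simple if it has no nontrivial self-adjoint part as an orthogonal direct summand. On $\mathbb{H}=H\oplus H$ put $[x,y]_c=(x_2,y_1)_H-(x_1,y_2)_H$ for $x=(x_1,x_2)$, $y=(y_1,y_2)$. Let $A_T\subset\mathbb{H}$ be the graph of $T$, $A_T^{\bot_s}=\{x\in\mathbb{H}: [x,y]_c=0\ \forall y\in A_T\}\supset A_T$, and $\mathcal{B}_T=A_T^{\bot_s}/A_T$ with the induced form $[\cdot,\cdot]_q$. The signature of $-\mathrm{i}[\cdot,\cdot]_q$ is the pair of deficiency indices of $T$, assumed to be $(1,1)$. $T$ is called regular (equivalently: entire) if for every $\lambda\in\mathbb{C}$ there is $c_\lambda>0$ with $\|(T-\lambda)x\|\ge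 c_\lambda\|x\|$ for all $x\in D(T)$. $\mathfrak{E}_1(H)$ is the set of closed simple symmetric entire operators in $H$ with deficiency indices $(1,1)$. Boundary triplets. A boundary triplet $(\mathbb{C},\Gamma_+,\Gamma_-)$ for $T$ consists of linear maps $\Gamma_\pm:A_T^{\bot_s}\to\mathbb{C}$ vanishing on $A_T$, inducing an isomorphism $\mathcal{B}_T\to\mathbb{C}^2$, with $[x,y]_c=\mathrm{i}\,\Gamma_+x\,\overline{\Gamma_+y}-\mathrm{i}\,\Gamma_-x\,\overline{\Gamma_-y}$. Put $T_\infty=\{a\in A_T^{\bot_s}:\Gamma_+a=0\}$, a strictly accumulative extension of $T$; it is the graph of an operator whose spectrum consists of eigenvalues in the open lower half-plane. With $W_\lambda=\{(x,\lambda x):x\in H\}\cap A_T^{\bot_s}$ (one-dimensional), the contractive Weyl function $B$ is defined for $\Im\lambda>0$ by $\Gamma_-a=B(\lambda)\Gamma_+a$, $a\in W_\lambda$; it extends to a meromorphic function on $\mathbb{C}$ with $|B|<1$ on the upper half-plane $\mathbb{C}_+$ and $|B|=1$ on $\mathbb{R}$, and its poles, with multiplicity, are the eigenvalues of $T_\infty$. $T_\infty$ is complete if the span of its generalized eigenspaces is dense in $H$. Model and Riesz completeness. Let $H^2(\mathbb{C}_+)$ be the Hardy space with $(f,g)=\int_{\mathbb{R}}f^*(t)\overline{g^*(t)}\frac{dt}{2\pi}$ ($f^*,g^*$ boundary values) and $\mathcal{H}_B=(BH^2(\mathbb{C}_+))^\bot\subset H^2(\mathbb{C}_+)$ the de Branges–Rovnyak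 space. $T$ is unitarily equivalent to multiplication by the independent variable $\lambda$ in $\mathcal{H}_B$, and under this equivalence the normalized eigenvectors of $T_\infty$ become (up to unimodular constants) $\mathfrak{f}_j(\lambda)=\frac{\sqrt{-2\Im\lambda_j}}{\lambda-\lambda_j}$. $T_\infty$ is called Riesz complete if $\{\mathfrak{f}_j\}_{j=1}^\infty$ is a Riesz basis of $\mathcal{H}_B$, i.e. the image of an orthonormal basis under a bounded invertible operator. *)

(* Defs.v *)
From HB Require Import structures.
From mathcomp Require Import all_boot all_order all_algebra.
From mathcomp Require Import all_classical all_reals all_analysis.
From mathcomp Require Import complex sesquilinear.

Set Implicit Arguments.
Unset Strict Implicit.
Unset Printing Implicit Defensive.

Import Order.TTheory GRing.Theory Num.Theory.
Import numFieldNormedType.Exports.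
Import ComplexField.Normc.

Local Open Scope classical_set_scope.
Local Open Scope ring_scope.
Local Open Scope complex_scope.

Section Linear.
Variables (R : realType) (V W : lmodType R[i]).

Definition subspace (S : set V) : Prop :=
  S 0 /\ forall (c : R[i]) x y, S x -> S y -> S (c *: x + y).

Definition lspan (S : set V) : set V :=
  [set x | exists n (c : 'I_n -> R[i]) (v : 'I_n -> V),
     (forall i, S (v i)) /\ x = \sum_i c i *: v i].

Definition linear_on (S : set V) (f : V -> W) : Prop :=
  forall (c : R[i]) x y, S x -> S y -> f (c *: x + y) = c *: f x + f y.

End Linear.

(* Partial operators; the values of [pop] outside the subspace [pdom] are
   meaningless and never used. *)
Record partial_op (R : realType) (H : lmodType R[i]) := PartialOp {
  pdom : set H;
  pop : H -> H;
  pdom_subspace : subspace pdom;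
  pop_linear : linear_on pdom pop }.

Definition graph (R : realType) (H : lmodType R[i]) (T : partial_op H)
  : set (H * H) := [set a | pdom T a.1 /\ a.2 = pop T a.1].

Section Hilbert.
Variables (R : realType) (H : completeNormedModType R[i]).
Variable ip : {dot H for Num.conj}.

(* [ip] is linear in its first argument, conjugate-linear in the second. *)
Definition norm_from_dot : Prop := forall x : H, `|x| ^+ 2 = ip x x.

Definition separable : Prop := exists2 D : set H, countable D & dense D.

Definition infinite_dimensional : Prop :=
  ~ exists n (v : 'I_n -> H),
      forall x, exists c : 'I_n -> R[i], x = \sum_i c i *: v i.

Definition cform (x y : H * H) : R[i] := ip x.2 y.1 - ip x.1 y.2.

Definition symp_orth (A : set (H * H)) : set (H * H) :=
  [set x | forall y, A y -> cform x y = 0].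

Definition orth (L : set H) : set H := [set x | forall y, L y -> ip x y = 0].

Definition symmetric_op (T : partial_op H) : Prop :=
  forall x y, pdom T x -> pdom T y -> ip (pop T x) y = ip x (pop T y).

Definition closed_op (T : partial_op H) : Prop := closed (graph T).

Definition part_in (A : set (H * H)) (L : set H) : set (H * H) :=
  [set a | [/\ A a, L a.1 & L a.2]].

(* A = A^* inside L (+) L.  When A is the graph of an operator this forces its
   domain to be dense in L: if y in L is orthogonal to the domain, then (0, y)
   belongs to the right-hand side, hence to A, so that y = 0. *)
Definition self_adjoint_in (L : set H) (A : set (H * H)) : Prop :=
  A = [set x | [/\ L x.1, L x.2 & symp_orth A x]].

Definition reduces (L : set H) (A : set (H * H)) : Prop :=
  forall a, A a ->
    exists b c, [/\ part_in A L b, part_in A (orth L) c & a = b + c].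

Definition simple_op (T : partial_op H) : Prop :=
  ~ exists L : set H,
      [/\ subspace L, closed L, exists2 x, L x & x != 0,
          reduces L (graph T) & self_adjoint_in L (part_in (graph T) L)].

Definition regular_op (T : partial_op H) : Prop :=
  forall z : R[i], exists2 c : R[i], 0 < c &
    forall x, pdom T x -> c * `|x| <= `|pop T x - z *: x|.

(* The form -i[.,.]_q on the quotient A_T^{\bot_s} / A_T has signature (p, q):
   it is diagonal with p entries 1 and q entries -1 in the basis formed by the
   classes of the u i and v j.  These classes are automatically independent. *)
Definition deficiency_indices (T : partial_op H) (p q : nat) : Prop :=
  exists (u : 'I_p -> H * H) (v : 'I_q -> H * H),
    [/\ (forall i, symp_orth (graph T) (u i)) /\
        (forall j, symp_orth (graph T) (v j)),
        forall i j, - 'i * cform (u i) (u j) = (i == j)%:R,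
        forall i j, - 'i * cform (v i) (v j) = - (i == j)%:R,
        forall i j, cform (u i) (v j) = 0 &
        forall x, symp_orth (graph T) x ->
          exists (c : 'I_p -> R[i]) (d : 'I_q -> R[i]) (a : H * H),
            graph T a /\ x = \sum_i c i *: u i + \sum_j d j *: v j + a].

Definition entire_class1 (T : partial_op H) : Prop :=
  [/\ closed_op T, symmetric_op T, simple_op T, regular_op T
    & deficiency_indices T 1 1].

(* Only the restrictions of Gp and Gm to A_T^{\bot_s} matter. *)
Definition boundary_triplet (T : partial_op H) (Gp Gm : H * H -> R[i]^o)
  : Prop :=
  [/\ linear_on (symp_orth (graph T)) Gp /\ linear_on (symp_orth (graph T)) Gm,
      forall a, graph T a -> Gp a = 0 /\ Gm a = 0,
      forall a, symp_orth (graph T) a -> Gp a = 0 -> Gm a = 0 -> graph T a,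
      forall p m : R[i],
        exists a, [/\ symp_orth (graph T) a, Gp a = p & Gm a = m] &
      forall x y, symp_orth (graph T) x -> symp_orth (graph T) y ->
        cform x y = 'i * Gp x * Num.conj (Gp y) - 'i * Gm x * Num.conj (Gm y)].

Definition T_infty (T : partial_op H) (Gp : H * H -> R[i]^o) : set (H * H) :=
  [set a | symp_orth (graph T) a /\ Gp a = 0].

Definition eigenvalue_of (S : set (H * H)) (z : R[i]) : Prop :=
  exists2 x, x != 0 & S (x, z *: x).

(* Generalized eigenspace: c_0 = x, c_(k+1) = (S - z) c_k, c_n = 0. *)
Definition gen_eigenspace (S : set (H * H)) (z : R[i]) : set H :=
  [set x | exists n (c : nat -> H),
     [/\ c 0%N = x, c n = 0 &
         forall k, (k < n)%N -> S (c k, z *: c k + c k.+1)]].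

Definition simple_eigenvalue (S : set (H * H)) (z : R[i]) : Prop :=
  exists2 x, x != 0 & gen_eigenspace S z = [set c *: x | c in [set: R[i]]].

Definition complete_rel (S : set (H * H)) : Prop :=
  dense (lspan (\bigcup_z gen_eigenspace S z)).

Definition W_space (T : partial_op H) (z : R[i]) : set (H * H) :=
  [set a | symp_orth (graph T) a /\ a.2 = z *: a.1].

(* The unique b with Gm a = b * Gp a on W_z when Im z > 0; the value at other z
   is never used. *)
Definition weyl (T : partial_op H) (Gp Gm : H * H -> R[i]^o) (z : R[i])
  : R[i] :=
  xget 0 [set b : R[i] | forall a, W_space T z a -> Gm a = b * Gp a].

End Hilbert.

Section Hardy.
Variable R : realType.

Definition upper (z : R[i]) : Prop := 0 < complex.Im z.

(* Exists for almost every t when f is in H^2(C_+); the junk value of [lim] on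
   the exceptional null set does not affect integrals. *)
Definition boundary_value (f : R[i] -> R[i]^o) (t : R) : R[i] :=
  lim (f (t +i* y) @[y --> (0 : R)^'+]).

Definition cintegral (f : R -> R[i]) : R[i] :=
  (\int[lebesgue_measure]_t complex.Re (f t)) +i*
  (\int[lebesgue_measure]_t complex.Im (f t)).

Definition hardy_dot (f g : R[i] -> R[i]^o) : R[i] :=
  cintegral (fun t => boundary_value f t * Num.conj (boundary_value g t))
  / (2 * pi)%:C.

(* H^2(C_+): an element is represented by its extension by 0 to C, so that
   two elements are equal iff the representing functions are. *)
Definition hardy2 : set (R[i] -> R[i]^o) :=
  [set f | [/\ forall z, ~ upper z -> f z = 0,
               forall z, upper z -> derivable (f : R[i]^o -> R[i]^o) z 1 &
               exists M : R, forall y : R, 0 < y ->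
                 (\int[lebesgue_measure]_x ((normc (f (x +i* y)) ^+ 2)%:E)
                    <= M%:E)%E]].

Definition model_space (B : R[i] -> R[i]) : set (R[i] -> R[i]^o) :=
  [set f | hardy2 f /\
     forall g, hardy2 g -> hardy_dot f (fun z => B z * g z) = 0].

Definition model_eigenvector (l : R[i]) : R[i] -> R[i]^o :=
  fun z => if 0 < complex.Im z
           then (Num.sqrt (- 2 * complex.Im l))%:C / (z - l) else 0.

End Hardy.

Section RieszBasis.
Variables (R : realType) (V : lmodType R[i]).
Variables (S : set V) (dot : V -> V -> R[i]).

Definition orthonormal_basis (e : nat -> V) : Prop :=
  [/\ forall j, S (e j),
      forall j k, dot (e j) (e k) = (j == k)%:R &
      forall f, S f -> forall eps : R, 0 < eps ->
        exists2 g, lspan (range e) g & dot (f - g) (f - g) < eps%:C].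

Definition bounded_op (A : V -> V) : Prop :=
  [/\ forall f, S f -> S (A f), linear_on S A &
      exists M : R, forall f, S f -> dot (A f) (A f) <= M%:C * dot f f].

Definition riesz_basis (b : nat -> V) : Prop :=
  exists (e : nat -> V) (A A' : V -> V),
    [/\ orthonormal_basis e, bounded_op A, bounded_op A',
        forall f, S f -> A' (A f) = f /\ A (A' f) = f &
        forall j, b j = A (e j)].

End RieszBasis.

Section Criterion.
Variables (R : realType) (lam : nat -> R[i]).

Definition riesz_complete (H : completeNormedModType R[i])
    (ip : {dot H for Num.conj}) (T : partial_op H) (Gp Gm : H * H -> R[i]^o)
  : Prop :=
  riesz_basis (model_space (weyl ip T Gp Gm)) (@hardy_dot R)
    (fun j => model_eigenvector (lam j)).

Definition B_prod (l : nat) (z : R[i]) : R[i] :=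
  lam l / Num.conj (lam l) *
  lim ((\prod_(0 <= j < n | j != l)
          (lam j / Num.conj (lam j) * ((z - Num.conj (lam j)) / (z - lam j)))
        : R[i]^o) @[n --> \oo]).

End Criterion.

(* Main.v *)
(** Let [w_j] be the conjugate of [lam_j].  In H^2(C_+) evaluation at [w] is the
    inner product with [k_w(z) = i / (z - conj w)], so that the eigenvectors
    [f_j] are multiples of the kernels [k_(w_j)].  If [v_z] spans the defect
    space of T at [z] in the lower half-plane, normalized by [Gm v_z = 1], then
    Green's identity computes the Gram matrix of the [v_z]: it is that of the
    reproducing kernels of the model space, and [x |-> (z |-> (x, v_(conj z)))]
    is a unitary map onto the model space which sends [v_(lam_j)] to [k_(w_j)].

    Necessity: the product of [f_j] with the finite Blaschke product of the
    other nodes has norm at most 1, and by partial fractions it is a combination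
    of the [f_k] in which the coefficient of [f_j] has modulus [1 / |B_j(w_j)|]
    (for the finite product); the inverse of the Riesz map bounds it.

    Sufficiency: Jones' explicit interpolating functions produce analytic
    functions [phi] with [phi(w_j) = 1] or [-1] prescribed and a uniform bound
    on C_+.  The adjoint of multiplication by [phi] multiplies [k_(w_j)] by
    [conj (phi(w_j))], so all sign changes in [sum_j c_j f_j] are uniformly
    bounded; averaging the signs with the parallelogram identity compares
    [|sum_j c_j f_j|^2] with [sum_j |c_j|^2]. *)
Require Import Defs.
From HB Require Import structures.
From mathcomp Require Import all_boot all_order all_algebra.
From mathcomp Require Import all_classical all_reals all_analysis.
From mathcomp Require Import measurable_realfun.
From mathcomp Require Import complex sesquilinear.
From mathcomp Require Import ring lra.

Import Order.TTheory GRing.Theory Num.Theory.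
Import numFieldNormedType.Exports.
Import ComplexField.Normc.

Local Open Scope classical_set_scope.
Local Open Scope ring_scope.
Local Open Scope complex_scope.

Set Implicit Arguments.
Unset Strict Implicit.
Unset Printing Implicit Defensive.

(** The inner product of H^2 is an integral of boundary values, so evaluation by kernels rests on
    Fatou's theorem. It is reached from Goursat's theorem by moving horizontal lines: the squared
    L^2 norms on the lines are midpoint convex in the height and bounded, hence decreasing, which
    makes the lines converge in L^2; Poisson averages at Lebesgue points give the vertical limits
    almost everywhere. All estimates are made for finite sums and products, with constants free of
    their length. [B_prod] is a limit that takes a default value when the product diverges. In the
    necessity the lower bound is therefore proved for finite products; together with regularity at
    0, which keeps the eigenvalues away from 0, it forces convergence. Completeness of [T_infty]
    makes the vectors v_(lam_j) span a dense subspace, from which the isometry extends to H. In the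
    interpolation the rational factors 1 + i Im a / (z - conj a) play the part of Jones'
    exponentials; their inverses dominate a telescoping sum, and the bound obtained is 6 /
    delta^3. *)

Notation re := (@complex.Re _).
Notation im := (@complex.Im _).

(** * Complex numbers and complex derivatives *)

Section ComplexBasics.
Variable R : realType.
Implicit Types z w : R[i].

Lemma normc_ge0 z : 0 <= normc z.
Proof. by case: z => a b; exact: sqrtr_ge0. Qed.

Lemma normc2 z : normc z ^+ 2 = re z ^+ 2 + im z ^+ 2.
Proof. by case: z => a b /=; rewrite sqr_sqrtr// addr_ge0 ?sqr_ge0. Qed.

Lemma normc_re z : `|re z| <= normc z.
Proof.
rewrite -(@ler_pXn2r _ 2) ?nnegrE ?normc_ge0// normc2 real_normK ?num_real//.
by rewrite lerDl sqr_ge0.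
Qed.

Lemma normc_im z : `|im z| <= normc z.
Proof.
rewrite -(@ler_pXn2r _ 2) ?nnegrE ?normc_ge0// normc2 real_normK ?num_real//.
by rewrite lerDr sqr_ge0.
Qed.

Lemma normc_le_reim z : normc z <= `|re z| + `|im z|.
Proof.
rewrite -(@ler_pXn2r _ 2) ?nnegrE ?normc_ge0// normc2.
rewrite sqrrD !real_normK ?num_real// lerD2r lerDl.
by rewrite mulrn_wge0// mulr_ge0.
Qed.

Lemma normc_conj z : normc (Num.conj z) = normc z.
Proof. by case: z => a b /=; rewrite sqrrN. Qed.

Lemma normc_eq0 z : (normc z == 0) = (z == 0).
Proof.
by apply/eqP/eqP => [/eq0_normc//|->]; rewrite [LHS]normc0.
Qed.

Lemma normc_gt0 z : (0 < normc z) = (z != 0).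
Proof. by rewrite lt0r normc_eq0 normc_ge0 andbT. Qed.

Lemma normc_real (x : R) : normc x%:C = `|x|.
Proof. by rewrite /= expr0n/= addr0 sqrtr_sqr. Qed.

Lemma normc_opp z : normc (- z) = normc z.
Proof. exact: normcN. Qed.

Lemma normc_distC z w : normc (z - w) = normc (w - z).
Proof. by rewrite -normc_opp opprB. Qed.

Lemma normcD_le z w : normc (z + w) <= normc z + normc w.
Proof. exact: le_normcD. Qed.

Lemma normcB_le z w : normc (z - w) <= normc z + normc w.
Proof. by apply: le_trans (normcD_le _ _) _; rewrite normc_opp. Qed.

Lemma normcM_eq z w : normc (z * w) = normc z * normc w.
Proof. exact: normcM. Qed.

Lemma normcV_eq z : normc z^-1 = (normc z)^-1.
Proof. exact: normcV. Qed.

Lemma normcX_eq z n : normc (z ^+ n) = normc z ^+ n.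
Proof. by elim: n => [|n ih]; [rewrite !expr0 [LHS]normc1|rewrite !exprS normcM_eq ih]. Qed.

Lemma normc_1 : normc (1 : R[i]) = 1.
Proof. exact: normc1. Qed.

Lemma normc_0 : normc (0 : R[i]) = 0.
Proof. exact: normc0. Qed.

Lemma normc_i : normc ('i : R[i]) = 1.
Proof. by rewrite /= expr0n expr1n add0r sqrtr1. Qed.

Lemma normc_prod (I : Type) (r : seq I) (P : pred I) (F : I -> R[i]) :
  normc (\prod_(i <- r | P i) F i) = \prod_(i <- r | P i) normc (F i).
Proof. by apply: (big_morph (@normc R) normcM_eq); exact: normc_1. Qed.

Lemma normE z : `|z| = (normc z)%:C. Proof. by []. Qed.

Lemma mul_conj z : z * Num.conj z = (normc z ^+ 2)%:C.
Proof.
rewrite normc2; case: z => a b; apply/eqP; rewrite eq_complex/=.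
by apply/andP; split; apply/eqP; ring.
Qed.

Lemma reD z w : re (z + w) = re z + re w. Proof. by case: z w => [a b] []. Qed.
Lemma imD z w : im (z + w) = im z + im w. Proof. by case: z w => [a b] []. Qed.
Lemma reN z : re (- z) = - re z. Proof. by case: z. Qed.
Lemma imN z : im (- z) = - im z. Proof. by case: z. Qed.
Lemma reB z w : re (z - w) = re z - re w. Proof. by rewrite reD reN. Qed.
Lemma imB z w : im (z - w) = im z - im w. Proof. by rewrite imD imN. Qed.
Lemma reM z w : re (z * w) = re z * re w - im z * im w.
Proof. by case: z w => [a b] []. Qed.
Lemma imM z w : im (z * w) = re z * im w + im z * re w.
Proof. by case: z w => [a b] []. Qed.
Lemma reJ z : re (Num.conj z) = re z. Proof. by case: z. Qed.
Lemma imJ z : im (Num.conj z) = - im z. Proof. by case: z. Qed.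

Lemma complex_ext z w : re z = re w -> im z = im w -> z = w.
Proof. by case: z w => [a b] [c d] /= -> ->. Qed.

Lemma reV z : re z^-1 = re z / normc z ^+ 2.
Proof. by rewrite normc2; case: z. Qed.
Lemma imV z : im z^-1 = - im z / normc z ^+ 2.
Proof. by rewrite normc2; case: z => a b /=; rewrite mulNr. Qed.

Lemma pos_complexP (e : R[i]) : 0 < e -> exists2 r : R, 0 < r & e = r%:C.
Proof.
by case: e => a b; rewrite ltcE/= => /andP[/eqP -> a0]; exists a.
Qed.

Lemma pos_realc (e : R) : (0 < e%:C) = (0 < e).
Proof. by rewrite ltcR. Qed.

Lemma conjK z : Num.conj (Num.conj z) = z.
Proof. by case: z => a b; apply: complex_ext => //=; rewrite opprK. Qed.

Lemma cjD z w : Num.conj (z + w) = Num.conj z + Num.conj w :> R[i].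
Proof. exact: rmorphD. Qed.
Lemma cjN z : Num.conj (- z) = - Num.conj z :> R[i].
Proof. exact: rmorphN. Qed.
Lemma cjB z w : Num.conj (z - w) = Num.conj z - Num.conj w :> R[i].
Proof. exact: rmorphB. Qed.
Lemma cjM z w : Num.conj (z * w) = Num.conj z * Num.conj w :> R[i].
Proof. exact: rmorphM. Qed.
Lemma cjV z : Num.conj z^-1 = (Num.conj z)^-1 :> R[i].
Proof. exact: fmorphV. Qed.
Lemma cj0 : Num.conj (0 : R[i]) = 0 :> R[i].
Proof. exact: rmorph0. Qed.
Lemma cj1 : Num.conj (1 : R[i]) = 1 :> R[i].
Proof. exact: rmorph1. Qed.

Lemma conjc_i : Num.conj ('i : R[i]) = - 'i :> R[i].
Proof. by apply: complex_ext; rewrite /= ?oppr0. Qed.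

Lemma conjc_realc (x : R) : Num.conj (x%:C) = x%:C :> R[i].
Proof. by apply: complex_ext; rewrite /= ?oppr0. Qed.

Lemma sqr_ic : 'i * 'i = -1 :> R[i].
Proof. by rewrite -expr2 sqr_i. Qed.

Lemma ic_neq0 : 'i != 0 :> R[i].
Proof. by rewrite -normc_eq0 normc_i oner_eq0. Qed.

End ComplexBasics.

Section ComplexDiff.
Variable R : realType.
Implicit Types (f g : R[i] -> R[i]) (z l w : R[i]).

(** Stated with real epsilon and delta and closed inequalities; h = 0 satisfies it trivially, so no
    punctured neighbourhood appears. *)
Definition cdiff f z l := forall e : R, 0 < e -> exists2 d : R, 0 < d &
  forall h, normc h <= d -> normc (f (z + h) - f z - l * h) <= e * normc h.

Lemma cvgcP {T : Type} (F : set_system T) {FF : Filter F} (f : T -> R[i]^o) l :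
  f @ F --> (l : R[i]^o) <->
  forall e : R, 0 < e -> \forall x \near F, normc (f x - l) <= e.
Proof.
split => [/cvgrPdist_le h e e0|h].
  have := h e%:C; rewrite pos_realc => /(_ e0); apply: filterS => x.
  by rewrite normE lecR -normc_distC.
apply/cvgrPdist_le => e /pos_complexP[r r0 ->].
by apply: filterS (h r r0) => x; rewrite normE lecR normc_distC.
Qed.

Lemma nbhscP z (P : set R[i]) : nbhs (z : R[i]^o) P <->
  exists2 d : R, 0 < d & forall h, normc h <= d -> P (z + h).
Proof.
split.
  move=> [d /= /pos_complexP[r r0 ->] h].
  exists (r / 2); first by rewrite divr_gt0.
  move=> k kr; apply: h => /=; rewrite opprD addrA subrr sub0r normrN normE ltcR.
  by apply: le_lt_trans kr _; rewrite ltr_pdivrMr// ltr_pMr// ltr1n.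
move=> [d d0 h]; exists d%:C; first by rewrite /= pos_realc.
move=> k /=; rewrite normE ltcR => kd.
have -> : k = z + (k - z) by rewrite addrC subrK.
by apply: h; rewrite normc_distC ltW.
Qed.

Lemma derivable_cdiff f z :
  derivable (f : R[i]^o -> R[i]^o) z 1 <-> exists l, cdiff f z l.
Proof.
split.
  move=> /cvg_ex[/= l hl]; exists l => e e0.
  move: hl => /cvgcP /(_ e e0); rewrite /dnbhs.
  move=> /nbhscP[d d0 H]; exists d => // h hd.
  have [->|h0] := eqVneq h 0.
    by rewrite addr0 subrr mulr0 subr0 normc_0 mulr0.
  have := H h hd; rewrite add0r => /(_ h0) {}H.
  have -> : f (z + h) - f z - l * h =
    (h^-1 *: (f (h *: (1 : R[i]^o) + z) - f z) - l) * h.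
    rewrite mulrBl /GRing.scale/= mulr1 [h + z]addrC.
    by rewrite [X in _ = X - _]mulrC mulrA mulfV// mul1r.
  by rewrite normcM_eq ler_wpM2r// normc_ge0.
move=> [l hl]; apply/cvg_ex; exists (l : R[i]^o); apply/cvgcP => e e0.
have [d d0 H] := hl e e0.
rewrite /dnbhs; apply/nbhscP; exists d => // h hd.
rewrite add0r => h0 /=.
have -> : h^-1 *: (f (h *: (1 : R[i]^o) + z) - f z) - l =
    (f (z + h) - f z - l * h) * h^-1.
  rewrite mulrBl mulfK// /GRing.scale/= mulr1 [h + z]addrC.
  by rewrite [X in X - _]mulrC.
rewrite normcM_eq normcV_eq ler_pdivrMr ?normc_gt0//.
exact: H.
Qed.

Lemma cdiff_cont f z l : cdiff f z l -> forall e : R, 0 < e ->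
  exists2 d : R, 0 < d & forall h, normc h <= d -> normc (f (z + h) - f z) <= e.
Proof.
move=> H e e0; have [d d0 {}H] := H 1 ltr01.
have k0 : 0 < 1 + normc l by rewrite ltr_wpDr// normc_ge0.
exists (Num.min d (e / (1 + normc l))).
  by rewrite lt_min d0 divr_gt0.
move=> h; rewrite le_min => /andP[hd he].
have -> : f (z + h) - f z = (f (z + h) - f z - l * h) + l * h by rewrite subrK.
apply: le_trans (normcD_le _ _) _.
apply: (@le_trans _ _ ((1 + normc l) * normc h)).
  by rewrite mulrDl lerD ?H// normcM_eq.
by rewrite mulrC -ler_pdivlMr.
Qed.

(** Schwarz reflection: the two conjugations cancel in the difference quotient. For purely imaginary
    [c], the map w -> conj w + c is the reflection in a horizontal line. *)
Lemma cdiff_conj f z l c :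
  cdiff f (Num.conj z + c) l ->
  cdiff (fun w => Num.conj (f (Num.conj w + c))) z (Num.conj l).
Proof.
move=> H e e0; have [d d0 {}H] := H e e0.
exists d => // h hd; rewrite -(normc_conj h).
have -> : Num.conj (f (Num.conj (z + h) + c)) - Num.conj (f (Num.conj z + c)) -
   Num.conj l * h = Num.conj (f (Num.conj z + c + Num.conj h) -
     f (Num.conj z + c) - l * Num.conj h).
  have -> : Num.conj (z + h) + c = Num.conj z + c + Num.conj h by rewrite cjD addrAC.
  by rewrite !cjB cjM conjK.
by rewrite normc_conj; apply: H; rewrite normc_conj.
Qed.

Lemma derivableM_c f g z : derivable (f : R[i]^o -> R[i]^o) z 1 ->
  derivable (g : R[i]^o -> R[i]^o) z 1 ->
  derivable ((fun w => f w * g w) : R[i]^o -> R[i]^o) z 1.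
Proof. exact: derivableM. Qed.

Lemma derivableD_c f g z : derivable (f : R[i]^o -> R[i]^o) z 1 ->
  derivable (g : R[i]^o -> R[i]^o) z 1 ->
  derivable ((fun w => f w + g w) : R[i]^o -> R[i]^o) z 1.
Proof. exact: derivableD. Qed.

Lemma derivableV_c f z : f z != 0 -> derivable (f : R[i]^o -> R[i]^o) z 1 ->
  derivable ((fun w => (f w)^-1) : R[i]^o -> R[i]^o) z 1.
Proof. exact: derivableV. Qed.

Lemma derivable_cst_c (c : R[i]) z :
  derivable ((fun=> c) : R[i]^o -> R[i]^o) z 1.
Proof. exact: derivable_cst. Qed.

Lemma derivable_id_c z : derivable ((fun w => w) : R[i]^o -> R[i]^o) z 1.
Proof. exact: derivable_id. Qed.

Lemma derivable_subr_c (w z : R[i]) :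
  derivable ((fun u => u - w) : R[i]^o -> R[i]^o) z 1.
Proof. by apply: derivableD_c; [exact: derivable_id_c|exact: derivable_cst_c]. Qed.

Lemma derivable_near_c f g z (d : R) : 0 < d ->
  (forall h, normc h <= d -> f (z + h) = g (z + h)) ->
  derivable (f : R[i]^o -> R[i]^o) z 1 -> derivable (g : R[i]^o -> R[i]^o) z 1.
Proof.
move=> d0 fg /derivable_cdiff[l H]; apply/derivable_cdiff; exists l => e e0.
have [d' d'0 {}H] := H e e0; exists (Num.min d d').
  by rewrite lt_min d0 d'0.
move=> h; rewrite le_min => /andP[h1 h2]; rewrite -fg// -[g z]addr0.
by have := fg 0; rewrite normc_0 !addr0 => <-; [exact: H|exact: ltW].
Qed.

End ComplexDiff.

(** * Integrals of complex functions and Goursat's theorem *)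

Section ComplexIntegral.
Variable R : realType.
Notation mu := (@lebesgue_measure R).
Implicit Types (f g : R -> R[i]) (D A B : set (measurableTypeR R)).

Definition cmeasurable D f :=
  measurable_fun D (fun t => re (f t)) /\ measurable_fun D (fun t => im (f t)).

Definition cintegrable D f :=
  mu.-integrable D (EFin \o (fun t => re (f t))) /\
  mu.-integrable D (EFin \o (fun t => im (f t))).

Definition cint D f : R[i] :=
  (\int[mu]_(t in D) re (f t)) +i* (\int[mu]_(t in D) im (f t)).

Lemma cintegralE f : cintegral f = cint setT f. Proof. by []. Qed.

Lemma cintegrable_measurable D f : cintegrable D f -> cmeasurable D f.
Proof. by move=> [/measurable_int/measurable_EFinP ? /measurable_int/measurable_EFinP]. Qed.

Lemma eq_cint D f g : {in D, f =1 g} -> cint D f = cint D g.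
Proof.
by move=> fg; rewrite /cint; congr (_ +i* _); apply: eq_Rintegral => x xD; rewrite fg.
Qed.

Lemma eq_cintegrable D f g : {in D, f =1 g} -> measurable D ->
  cintegrable D f -> cintegrable D g.
Proof.
move=> fg mD [h1 h2]; split.
  by apply: eq_integrable h1 => // x xD /=; rewrite fg.
by apply: eq_integrable h2 => // x xD /=; rewrite fg.
Qed.

Lemma Rintegrable_lin D (g1 g2 : R -> R) a b : measurable D ->
  mu.-integrable D (EFin \o g1) -> mu.-integrable D (EFin \o g2) ->
  mu.-integrable D (EFin \o (fun t => a * g1 t + b * g2 t)).
Proof.
move=> mD h1 h2.
have := integrableD mD (integrableZl mD a h1) (integrableZl mD b h2).
by apply: eq_integrable => // x xD /=; rewrite !EFinD !EFinM.
Qed.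

Lemma Rintegral_lin D (g1 g2 : R -> R) a b : measurable D ->
  mu.-integrable D (EFin \o g1) -> mu.-integrable D (EFin \o g2) ->
  \int[mu]_(t in D) (a * g1 t + b * g2 t) =
  a * \int[mu]_(t in D) g1 t + b * \int[mu]_(t in D) g2 t.
Proof.
move=> mD h1 h2; rewrite RintegralD//; first by rewrite !RintegralZl.
- have := integrableZl mD a h1.
  by apply: eq_integrable => // x xD /=; rewrite EFinM.
- have := integrableZl mD b h2.
  by apply: eq_integrable => // x xD /=; rewrite EFinM.
Qed.

Lemma cintegrableD D f g : measurable D -> cintegrable D f -> cintegrable D g ->
  cintegrable D (fun t => f t + g t).
Proof.
move=> mD [f1 f2] [g1 g2]; split.
  have := Rintegrable_lin 1 1 mD f1 g1.
  by apply: eq_integrable => // x xD /=; rewrite !mul1r reD.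
have := Rintegrable_lin 1 1 mD f2 g2.
by apply: eq_integrable => // x xD /=; rewrite !mul1r imD.
Qed.

Lemma cintegrableZ D f c : measurable D -> cintegrable D f ->
  cintegrable D (fun t => c * f t).
Proof.
move=> mD [f1 f2]; split.
  have := Rintegrable_lin (re c) (- im c) mD f1 f2.
  by apply: eq_integrable => // x xD /=; rewrite mulNr reM.
have := Rintegrable_lin (im c) (re c) mD f1 f2.
by apply: eq_integrable => // x xD /=; rewrite imM addrC.
Qed.

Lemma cintegrableB D f g : measurable D -> cintegrable D f -> cintegrable D g ->
  cintegrable D (fun t => f t - g t).
Proof.
move=> mD hf hg; have := cintegrableD mD hf (cintegrableZ (-1) mD hg).
by apply: eq_cintegrable => // x _ /=; rewrite mulN1r.
Qed.

Lemma cintD D f g : measurable D -> cintegrable D f -> cintegrable D g ->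
  cint D (fun t => f t + g t) = cint D f + cint D g.
Proof.
move=> mD [f1 f2] [g1 g2]; apply: complex_ext.
  rewrite reD /cint/= -RintegralD//.
  by apply: eq_Rintegral => x _; rewrite reD.
rewrite imD /cint/= -RintegralD//.
by apply: eq_Rintegral => x _; rewrite imD.
Qed.

Lemma cintZ D f c : measurable D -> cintegrable D f ->
  cint D (fun t => c * f t) = c * cint D f.
Proof.
move=> mD [f1 f2]; apply: complex_ext.
  rewrite reM /cint/= -mulNr -Rintegral_lin//.
  by apply: eq_Rintegral => x _; rewrite reM mulNr.
rewrite imM /cint/= addrC [X in _ = X + _]mulrC [X in _ = _ + X]mulrC.
rewrite [X in _ = X + _]mulrC [X in _ = _ + X]mulrC addrC -Rintegral_lin//.
by apply: eq_Rintegral => x _; rewrite imM.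
Qed.

Lemma cintB D f g : measurable D -> cintegrable D f -> cintegrable D g ->
  cint D (fun t => f t - g t) = cint D f - cint D g.
Proof.
move=> mD hf hg; rewrite -[X in _ = _ + X]mulN1r -cintZ// -cintD//; last first.
  exact: cintegrableZ.
by apply: eq_cint => x _; rewrite mulN1r.
Qed.

Lemma cint_conj D f : measurable D -> cintegrable D f ->
  cint D (fun t => Num.conj (f t)) = Num.conj (cint D f).
Proof.
move=> mD [f1 f2]; apply: complex_ext.
  by rewrite reJ; apply: eq_Rintegral => x _; rewrite reJ.
rewrite imJ /= -mulN1r -RintegralZl//.
by apply: eq_Rintegral => x _; rewrite imJ mulN1r.
Qed.

Lemma measurable_normc D f : cmeasurable D f ->
  measurable_fun D (fun t => normc (f t)).
Proof.
move=> [h1 h2].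
rewrite (_ : (fun t => _) = (fun t => Num.sqrt (re (f t) ^+ 2 + im (f t) ^+ 2))).
  have ms : measurable_fun setT (@Num.sqrt R).
    by apply: continuous_measurable_fun; exact: sqrt_continuous.
  apply: (measurableT_comp ms).
  by apply: measurable_funD; apply: measurable_funX.
by apply/funext => t; case: (f t).
Qed.

Lemma cintegrable_normc D f : measurable D -> cintegrable D f ->
  mu.-integrable D (EFin \o (fun t => normc (f t))).
Proof.
move=> mD hf; have [h1 h2] := hf.
have mf := cintegrable_measurable hf.
apply: (le_integrable mD _ _ (integrableD mD (integrable_abse h1) (integrable_abse h2))).
  by apply/measurable_EFinP; exact: measurable_normc.
move=> x xD /=; rewrite lee_fin ger0_norm ?normc_ge0// ger0_norm ?addr_ge0//.
exact: normc_le_reim.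
Qed.

Lemma cintegrable_le D f (g : R -> R) : measurable D -> cmeasurable D f ->
  mu.-integrable D (EFin \o g) -> (forall x, D x -> normc (f x) <= g x) ->
  cintegrable D f.
Proof.
move=> mD [m1 m2] ig fg; split.
  apply: le_integrable ig => //; first exact/measurable_EFinP.
  move=> x xD /=; rewrite lee_fin; apply: le_trans (ler_norm _).
  by apply: le_trans (fg x xD); exact: normc_re.
apply: le_integrable ig => //; first exact/measurable_EFinP.
move=> x xD /=; rewrite lee_fin; apply: le_trans (ler_norm _).
by apply: le_trans (fg x xD); exact: normc_im.
Qed.

(** The factor 2 comes from bounding real and imaginary parts separately. It is harmless, because
    the bound serves only for quantities that are made arbitrarily small. *)
Lemma normc_cint D f : measurable D -> cintegrable D f ->
  normc (cint D f) <= 2 * \int[mu]_(t in D) normc (f t).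
Proof.
move=> mD hf; have [h1 h2] := hf; have hn := cintegrable_normc mD hf.
apply: le_trans (normc_le_reim _) _; rewrite mulr_natl mulr2n lerD//=.
  apply: le_trans (le_normr_Rintegral _ _) _ => //.
  apply: le_Rintegral => //; last by move=> x _; exact: normc_re.
  exact: (integrable_abse h1).
apply: le_trans (le_normr_Rintegral _ _) _ => //.
apply: le_Rintegral => //; last by move=> x _; exact: normc_im.
exact: (integrable_abse h2).
Qed.

Lemma cint_setU A B f : measurable A -> measurable B ->
  cintegrable (A `|` B) f -> [disjoint A & B] ->
  cint (A `|` B) f = cint A f + cint B f.
Proof.
move=> mA mB [h1 h2] AB; apply: complex_ext.
  by rewrite reD /= Rintegral_setU.
by rewrite imD /= Rintegral_setU.
Qed.

Lemma cintegrableS A B f : measurable A -> measurable B -> A `<=` B ->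
  cintegrable B f -> cintegrable A f.
Proof. by move=> mA mB AB [h1 h2]; split; [move: h1|move: h2]; exact: integrableS. Qed.

End ComplexIntegral.

Section IntervalIntegral.
Variable R : realType.
Notation mu := (@lebesgue_measure R).
Implicit Types (f g : R -> R[i]) (a b x : R).

Definition cont_at f x := forall e : R, 0 < e -> exists2 d : R, 0 < d &
  forall y, `|y - x| <= d -> normc (f y - f x) <= e.

Lemma cont_at_re f x : cont_at f x -> {for x, continuous (fun t => re (f t))}.
Proof.
move=> h; apply/cvgrPdist_le => e e0; have [d d0 H] := h e e0.
exists d => // y /= yd; rewrite -reB; apply: le_trans (normc_re _) _.
by rewrite normc_distC; apply: H; rewrite distrC ltW.
Qed.

Lemma cont_at_im f x : cont_at f x -> {for x, continuous (fun t => im (f t))}.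
Proof.
move=> h; apply/cvgrPdist_le => e e0; have [d d0 H] := h e e0.
exists d => // y /= yd; rewrite -imB; apply: le_trans (normc_im _) _.
by rewrite normc_distC; apply: H; rewrite distrC ltW.
Qed.

Lemma cont_cintegrable a b f : (forall x, a <= x <= b -> cont_at f x) ->
  cintegrable `[a, b] f.
Proof.
move=> h; split; apply: continuous_compact_integrable; try exact: segment_compact.
  apply: continuous_in_subspaceT => x /set_mem/=; rewrite in_itv/= => xab.
  exact/cont_at_re/h.
apply: continuous_in_subspaceT => x /set_mem/=; rewrite in_itv/= => xab.
exact/cont_at_im/h.
Qed.

Lemma cont_cmeasurable f : (forall x, cont_at f x) -> cmeasurable setT f.
Proof.
move=> h; split; apply: continuous_measurable_fun => x.
  exact/cont_at_re/h.
exact/cont_at_im/h.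
Qed.

Lemma Rintegral_split a m b (g : R -> R) : a <= m -> m <= b ->
  mu.-integrable `[a, b] (EFin \o g) ->
  \int[mu]_(t in `[a, b]) g t =
  \int[mu]_(t in `[a, m]) g t + \int[mu]_(t in `[m, b]) g t.
Proof.
move=> am mb ig; have := @Rintegral_itvB R g (BLeft a) (BRight b) m ig.
rewrite !bnd_simp => /(_ am mb) /eqP; rewrite subr_eq addrC => /eqP ->.
rewrite Rintegral_itv_obnd_cbnd//; apply: integrableS ig => //.
by move=> x /=; rewrite !in_itv/= => /andP[/ltW mx ->]; rewrite (le_trans am mx).
Qed.

Lemma cint_split a m b f : a <= m -> m <= b -> cintegrable `[a, b] f ->
  cint `[a, b] f = cint `[a, m] f + cint `[m, b] f.
Proof.
move=> am mb [h1 h2]; apply: complex_ext.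
  by rewrite reD /= -Rintegral_split.
by rewrite imD /= -Rintegral_split.
Qed.

Lemma normc_cint_itv a b f M : a <= b -> cintegrable `[a, b] f ->
  (forall x, a <= x <= b -> normc (f x) <= M) ->
  normc (cint `[a, b] f) <= 2 * (M * (b - a)).
Proof.
move=> ab hf fM; apply: le_trans (normc_cint _ hf) _ => //.
rewrite ler_pM2l//.
have -> : M * (b - a) = \int[mu]_(t in `[a, b]) M.
  rewrite Rintegral_cst//=; congr (_ * _).
  by rewrite lebesgue_measure_itv/= lte_fin; case: ltgtP ab => //= ->; rewrite subrr.
apply: le_Rintegral => //.
- exact: cintegrable_normc.
- by apply: continuous_compact_integrable; [exact: segment_compact|apply: continuous_subspaceT => x; exact: cvg_cst].

Qed.

Lemma Rintegral_id a b : a <= b -> \int[mu]_(t in `[a, b]) t = (b ^+ 2 - a ^+ 2) / 2.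
Proof.
rewrite le_eqVlt => /predU1P[->|ab].
  by rewrite set_itv1 Rintegral_set1 subrr mul0r.
have Fd (x : R) : is_derive x (1 : R) (fun t : R => t ^+ 2 / 2) x.
  apply: is_derive_eq; rewrite /GRing.scale/=; field; exact.
rewrite /Rintegral (@continuous_FTC2 _ (fun t : R => t) (fun t : R => t ^+ 2 / 2) a b)//=.
- by rewrite mulrBl.
- by apply: continuous_subspaceT => x; exact: cvg_id.
- split.
  + by move=> x _; have [] := Fd x.
  + apply: cvg_at_right_filter; apply: cvgM; last exact: cvg_cst.
    exact: exprn_continuous.
  + apply: cvg_at_left_filter; apply: cvgM; last exact: cvg_cst.
    exact: exprn_continuous.
- by move=> x _; rewrite derive1E (@derive_val _ _ _ _ _ _ _ (Fd x)).
Qed.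

Lemma cint_cst a b c : a <= b -> cint `[a, b] (fun=> c) = c * (b - a)%:C.
Proof.
move=> ab; have E : fine (mu `[a, b]) = b - a.
  by rewrite lebesgue_measure_itv/= lte_fin; case: ltgtP ab => //= ->; rewrite subrr.
by apply: complex_ext; rewrite /cint ?reM ?imM/= !Rintegral_cst// E; ring.
Qed.

Lemma cint_id a b : a <= b ->
  cint `[a, b] (fun t => t%:C) = ((b ^+ 2 - a ^+ 2) / 2)%:C.
Proof.
move=> ab; apply: complex_ext; rewrite /cint/= ?Rintegral_id//.
by rewrite Rintegral_cst// mul0r.
Qed.

Lemma cont_at_cst c x : cont_at (fun=> c) x.
Proof. by move=> e e0; exists 1 => // h _; rewrite subrr normc_0 ltW. Qed.

Lemma cont_at_realc x : cont_at (fun t => t%:C) x.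
Proof.
move=> e e0; exists e => // y hy.
by rewrite (_ : y%:C - x%:C = (y - x)%:C) ?normc_real//; apply: complex_ext => /=; ring.
Qed.

Lemma cont_atZ f c x : cont_at f x -> cont_at (fun t => c * f t) x.
Proof.
move=> hf e e0.
have c0 : 0 < 1 + normc c by rewrite ltr_wpDr// normc_ge0.
have [d d0 {}hf] := hf _ (divr_gt0 e0 c0).
exists d => // y /hf h; rewrite -mulrBr normcM_eq.
apply: (@le_trans _ _ ((1 + normc c) * (e / (1 + normc c)))).
  by rewrite ler_pM ?normc_ge0// lerDr.
by rewrite mulrC divfK// gt_eqF.
Qed.

Lemma cdiff_cont_at_h (g : R[i] -> R[i]) (x y : R) l : cdiff g (x +i* y) l ->
  cont_at (fun t => g (t +i* y)) x.
Proof.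
move=> h e e0; have [d d0 H] := cdiff_cont h e0; exists d => // t td.
have -> : t +i* y = x +i* y + (t - x)%:C by apply: complex_ext => /=; ring.
by apply: H; rewrite normc_real.
Qed.

Lemma cdiff_cont_at_v (g : R[i] -> R[i]) (x y : R) l : cdiff g (x +i* y) l ->
  cont_at (fun t => g (x +i* t)) y.
Proof.
move=> h e e0; have [d d0 H] := cdiff_cont h e0; exists d => // t td.
have -> : x +i* t = x +i* y + 'i * (t - y)%:C by apply: complex_ext => /=; ring.
by apply: H; rewrite normcM_eq normc_i mul1r normc_real.
Qed.

End IntervalIntegral.

(** * Goursat's theorem on rectangles *)

Section Goursat.
Variable R : realType.
Implicit Types (g : R[i] -> R[i]) (a b c d : R).

(** The contour integral of g dz around the rectangle [a, b] x [c, d], counterclockwise. *)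
Definition rectI g a b c d : R[i] :=
  cint `[a, b] (fun t => g (t +i* c)) - cint `[a, b] (fun t => g (t +i* d)) +
  'i * (cint `[c, d] (fun t => g (b +i* t)) - cint `[c, d] (fun t => g (a +i* t))).

Definition cdiff_rect g a b c d := forall x y, a <= x <= b -> c <= y <= d ->
  exists l, cdiff g (x +i* y) l.

Lemma cdiff_rectS g a b c d a' b' c' d' : a <= a' -> b' <= b -> c <= c' -> d' <= d ->
  cdiff_rect g a b c d -> cdiff_rect g a' b' c' d'.
Proof.
move=> h1 h2 h3 h4 H x y /andP[x1 x2] /andP[y1 y2]; apply: H.
  by rewrite (le_trans h1 x1) (le_trans x2 h2).
by rewrite (le_trans h3 y1) (le_trans y2 h4).
Qed.

Lemma cdiff_rect_h g a b c d y : cdiff_rect g a b c d -> c <= y <= d ->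
  cintegrable `[a, b] (fun t => g (t +i* y)).
Proof.
move=> H hy; apply: cont_cintegrable => x hx; have [l hl] := H x y hx hy.
exact: cdiff_cont_at_h hl.
Qed.

Lemma cdiff_rect_v g a b c d x : cdiff_rect g a b c d -> a <= x <= b ->
  cintegrable `[c, d] (fun t => g (x +i* t)).
Proof.
move=> H hx; apply: cont_cintegrable => y hy; have [l hl] := H x y hx hy.
exact: cdiff_cont_at_v hl.
Qed.

Lemma rectI_split g a b c d m n : a <= m <= b -> c <= n <= d ->
  cdiff_rect g a b c d ->
  rectI g a b c d = rectI g a m c n + rectI g m b c n + rectI g a m n d +
    rectI g m b n d.
Proof.
move=> /andP[am mb] /andP[cn nd] H; have ab := le_trans am mb; have cd := le_trans cn nd.
have sp y : c <= y <= d -> cint `[a, b] (fun t => g (t +i* y)) =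
    cint `[a, m] (fun t => g (t +i* y)) + cint `[m, b] (fun t => g (t +i* y)).
  by move=> hy; apply: cint_split => //; exact: cdiff_rect_h hy.
have sv x : a <= x <= b -> cint `[c, d] (fun t => g (x +i* t)) =
    cint `[c, n] (fun t => g (x +i* t)) + cint `[n, d] (fun t => g (x +i* t)).
  by move=> hx; apply: cint_split => //; exact: cdiff_rect_v hx.
rewrite /rectI (sp c) ?lexx ?cd// (sp d) ?lexx ?cd// (sv a) ?lexx ?ab//.
rewrite (sv b) ?lexx ?ab//; ring.
Qed.

Lemma rectIB g h a b c d : a <= b -> c <= d ->
  cdiff_rect g a b c d -> cdiff_rect h a b c d ->
  rectI (fun z => g z - h z) a b c d = rectI g a b c d - rectI h a b c d.
Proof.
move=> ab cd hg hh; rewrite /rectI !cintB//.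
- ring.
all: try by apply: cdiff_rect_v; [exact: hg|rewrite lexx ab].
all: try by apply: cdiff_rect_v; [exact: hh|rewrite lexx ab].
all: try by apply: cdiff_rect_h; [exact: hg|rewrite lexx cd].
all: try by apply: cdiff_rect_h; [exact: hh|rewrite lexx cd].
Qed.

Lemma cdiff_affine (k l z : R[i]) : cdiff (fun w => k + l * w) z l.
Proof.
move=> e e0; exists 1 => // h _.
have -> : k + l * (z + h) - (k + l * z) - l * h = 0 by ring.
by rewrite normc_0 mulr_ge0 ?normc_ge0// ltW.
Qed.

(** The only contour integral computed in closed form: Goursat's argument subtracts the first-order
    Taylor polynomial, which is affine. *)
Lemma rectI_affine k l a b c d : a <= b -> c <= d ->
  rectI (fun w => k + l * w) a b c d = 0.
Proof.
move=> ab cd.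
have ci (u v : R) (p q : R[i]) : u <= v -> cint `[u, v] (fun t => p + q * t%:C) =
    p * (v - u)%:C + q * ((v ^+ 2 - u ^+ 2) / 2)%:C.
  move=> uv; rewrite cintD//; last 2 first.
  - by apply: cont_cintegrable => x _; exact: cont_at_cst.
  - by apply: cont_cintegrable => x _; apply: cont_atZ; exact: cont_at_realc.
  rewrite cint_cst// cintZ ?cint_id//.
  by apply: cont_cintegrable => x _; exact: cont_at_realc.
have ch y : cint `[a, b] (fun t => k + l * (t +i* y)) =
    cint `[a, b] (fun t => (k + l * 'i * y%:C) + l * t%:C).
  by apply: eq_cint => t _; apply: complex_ext; rewrite !(reD, imD, reM, imM)/=; ring.
have cv x : cint `[c, d] (fun t => k + l * (x +i* t)) =
    cint `[c, d] (fun t => (k + l * x%:C) + (l * 'i) * t%:C).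
  by apply: eq_cint => t _; apply: complex_ext; rewrite !(reD, imD, reM, imM)/=; ring.
rewrite /rectI !ch !cv !ci//.
have eB (u u' : R) : (u - u')%:C = u%:C - u'%:C :> R[i] by exact: (rmorphB (real_complex R)).
rewrite !eB; move: (_ / 2)%:C (_ / 2)%:C a%:C b%:C c%:C d%:C => *; ring.
Qed.

Lemma normc_rectI_le g a b c d M : a <= b -> c <= d -> cdiff_rect g a b c d ->
  (forall x y, a <= x <= b -> c <= y <= d -> normc (g (x +i* y)) <= M) ->
  normc (rectI g a b c d) <= 4 * M * (b - a + (d - c)).
Proof.
move=> ab cd H gM.
have bh y : c <= y <= d -> normc (cint `[a, b] (fun t => g (t +i* y))) <= 2 * (M * (b - a)).
  move=> hy; apply: normc_cint_itv => //; first exact: cdiff_rect_h hy.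
  by move=> x hx; exact: gM.
have bv x : a <= x <= b -> normc (cint `[c, d] (fun t => g (x +i* t))) <= 2 * (M * (d - c)).
  move=> hx; apply: normc_cint_itv => //; first exact: cdiff_rect_v hx.
  by move=> y hy; exact: gM.
apply: le_trans (normcD_le _ _) _; rewrite normcM_eq normc_i mul1r.
apply: le_trans (lerD (normcB_le _ _) (normcB_le _ _)) _.
have h1 := bh c; have h2 := bh d; have h3 := bv a; have h4 := bv b.
rewrite lexx cd in h1; rewrite lexx cd in h2; rewrite lexx ab in h3; rewrite lexx ab in h4.
have {}h1 := h1 isT; have {}h2 := h2 isT; have {}h3 := h3 isT; have {}h4 := h4 isT.
lra.
Qed.

Record qrect := QRect { qa : R; qb : R; qc : R; qd : R }.

Definition qI g (q : qrect) := rectI g (qa q) (qb q) (qc q) (qd q).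
Definition qok g (q : qrect) :=
  [/\ qa q <= qb q, qc q <= qd q & cdiff_rect g (qa q) (qb q) (qc q) (qd q)].
Definition qsub (p q : qrect) :=
  [/\ qa q <= qa p, qb p <= qb q, qc q <= qc p & qd p <= qd q].
Definition qstep g (q p : qrect) := [/\ qsub p q,
   qb p - qa p = (qb q - qa q) / 2, qd p - qc p = (qd q - qc q) / 2 &
   normc (qI g q) <= 4 * normc (qI g p)].

(* One of the four quarters carries at least a quarter of the integral. *)
Lemma quarter_rect g q : qok g q -> exists p, qok g p /\ qstep g q p.
Proof.
case: q => a b c d [/= ab cd H].
have aux (x x1 x2 x3 x4 : R) : x <= x1 + x2 + x3 + x4 -> 4 * x1 < x -> 4 * x2 < x ->
  4 * x3 < x -> 4 * x4 < x -> False by lra.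
pose m := (a + b) / 2; pose n := (c + d) / 2.
have am : a <= m by rewrite /m; lra. have mb : m <= b by rewrite /m; lra.
have cn : c <= n by rewrite /n; lra. have nd : n <= d by rewrite /n; lra.
have E := @rectI_split g a b c d m n; rewrite am mb cn nd in E.
have qm1 : m - a = (b - a) / 2 by rewrite /m; field.
have qm2 : b - m = (b - a) / 2 by rewrite /m; field.
have qn1 : n - c = (d - c) / 2 by rewrite /n; field.
have qn2 : d - n = (d - c) / 2 by rewrite /n; field.
have {E} := E isT isT H; set I := rectI g a b c d.
set I1 := rectI _ _ _ _ _; set I2 := rectI _ _ _ _ _.
set I3 := rectI _ _ _ _ _; set I4 := rectI _ _ _ _ _ => E.
have : normc I <= normc I1 + normc I2 + normc I3 + normc I4.
  rewrite E; apply: le_trans (normcD_le _ _) _; rewrite lerD2r.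
  by apply: le_trans (normcD_le _ _) _; rewrite lerD2r; exact: normcD_le.
move=> tri; have [i1|i1] := leP (normc I) (4 * normc I1).
  exists (QRect a m c n); split; [split|split] => //=.
  - exact: cdiff_rectS H.
have [i2|i2] := leP (normc I) (4 * normc I2).
  exists (QRect m b c n); split; [split|split] => //=.
  - exact: cdiff_rectS H.
have [i3|i3] := leP (normc I) (4 * normc I3).
  exists (QRect a m n d); split; [split|split] => //=.
  - exact: cdiff_rectS H.
have [i4|i4] := leP (normc I) (4 * normc I4).
  exists (QRect m b n d); split; [split|split] => //=.
  - exact: cdiff_rectS H.
by have := aux _ _ _ _ _ tri i1 i2 i3 i4.
Qed.

Lemma nested_point (u v : nat -> R) : (forall n, u n <= u n.+1) ->
  (forall n, v n.+1 <= v n) -> (forall n, u n <= v n) ->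
  exists p, forall n, u n <= p <= v n.
Proof.
move=> hu hv uv.
have um m n : (m <= n)%N -> u m <= u n.
  by move=> /subnK <-; elim: (n - m)%N => //= k ih; apply: le_trans ih _; rewrite addSn.
have vm m n : (m <= n)%N -> v n <= v m.
  by move=> /subnK <-; elim: (n - m)%N => //= k ih; apply: le_trans ih; rewrite addSn.
have ub n : ubound (range u) (v n).
  move=> _ [m _ <-]; have [mn|/ltnW nm] := leqP m n.
    exact: le_trans (um _ _ mn) (uv n).
  exact: le_trans (uv m) (vm _ _ nm).
exists (sup (range u)) => n; apply/andP; split.
  by apply: ub_le_sup; [exists (v 0%N); exact: ub|exists n].
by apply: ge_sup; [exists (u 0%N), 0%N|exact: ub].
Qed.

(** Repeated bisection. Near the limit point g is affine up to an error e |h|, and affine functions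
    integrate to zero, so the integral over the n-th rectangle is of order e (D / 2^n)^2. This beats
    the factor 4^n lost in the bisections. *)
Theorem goursat g a b c d : a <= b -> c <= d -> cdiff_rect g a b c d ->
  rectI g a b c d = 0.
Proof.
move=> ab cd H.
have [s [s0 sok]] : exists s : nat -> qrect, s 0%N = QRect a b c d /\
    forall n, qok g (s n) /\ qstep g (s n) (s n.+1).
  (* A rectangle is packaged with its validity, so that the chosen quarter can be taken again and
     again. *)
  pose T := {q | qok g q}.
  have [F HF] : exists F : T -> T, forall q : T, qstep g (sval q) (sval (F q)).
    have [F HF] := @choice T T (fun q p => qstep g (sval q) (sval p)) (fun q =>
      let: ex_intro p (conj h1 h2) := quarter_rect (svalP q) in
      ex_intro _ (exist _ p h1) h2).
    by exists F.
  have ok0 : qok g (QRect a b c d) by [].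
  exists (fun n => sval (iter n F (exist _ _ ok0))); split => // n; split; last exact: HF.
  exact: svalP.
have [p1 hp1] : exists p, forall n, qa (s n) <= p <= qb (s n).
  apply: nested_point => n; first by have [_ [[]]] := sok n.
    by have [_ [[]]] := sok n.
  by have [[]] := sok n.
have [p2 hp2] : exists p, forall n, qc (s n) <= p <= qd (s n).
  apply: nested_point => n; first by have [_ [[]]] := sok n.
    by have [_ [[]]] := sok n.
  by have [[]] := sok n.
pose D := (b - a) + (d - c).
have D0 : 0 <= D by rewrite /D addr_ge0 ?subr_ge0.
have hD n : (qb (s n) - qa (s n)) + (qd (s n) - qc (s n)) = D / 2 ^+ n.
  elim: n => [|n ih]; first by rewrite s0/= expr0 divr1.
  have [_ [_ -> -> _]] := sok n; rewrite -mulrDl ih exprS; field.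
  by rewrite expf_neq0.
have hI n : normc (rectI g a b c d) <= 4 ^+ n * normc (qI g (s n)).
  elim: n => [|n ih]; first by rewrite s0 expr0 mul1r.
  apply: le_trans ih _; have [_ [_ _ _ h]] := sok n.
  by rewrite exprSr -mulrA ler_wpM2l// exprn_ge0.
have [l hl] : exists l, cdiff g (p1 +i* p2) l.
  have := hp1 0%N; have := hp2 0%N; rewrite s0/= => h2 h1; exact: H.
suff Hle e : 0 < e -> normc (rectI g a b c d) <= 4 * e * D * D.
  apply/eqP; rewrite -normc_eq0 eq_le normc_ge0 andbT.
  apply/ler_addgt0Pr => e e0; rewrite add0r.
  have K0 : 0 < 4 * D * D + 1 by rewrite ltr_wpDl// !mulr_ge0.
  apply: le_trans (Hle (e / (4 * D * D + 1)) _) _; first by rewrite divr_gt0.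
  have -> : 4 * (e / (4 * D * D + 1)) * D * D = e * ((4 * D * D) / (4 * D * D + 1)).
    by field; rewrite gt_eqF.
  by rewrite ler_piMr ?(ltW e0)// ler_pdivrMr// mul1r lerDl.
move=> e0; have [r r0 hr] := hl e e0.
have [n hn] : exists n, D / 2 ^+ n <= r.
  exists (Num.truncn (D / r)).+1.
  rewrite ler_pdivrMr ?exprn_gt0// -ler_pdivrMl// mulrC.
  apply: le_trans (ltW (truncnS_gt _)) _.
  by rewrite -natrX ler_nat ltnW// ltn_expl.
apply: le_trans (hI n) _.
set q := s n.
have [[qab qcd qH] _] := sok n; rewrite -/q in qab qcd qH.
(* The map w -> k + l w is the first-order approximation of g at the limit point. *)
pose k := g (p1 +i* p2) - l * (p1 +i* p2).
have dk : cdiff_rect (fun w => k + l * w) (qa q) (qb q) (qc q) (qd q).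
  by move=> x y _ _; exists l; exact: cdiff_affine.
have E : qI g q = rectI (fun w => g w - (k + l * w)) (qa q) (qb q) (qc q) (qd q).
  by rewrite rectIB// rectI_affine// subr0.
have db : normc (qI g q) <= 4 * (e * (D / 2 ^+ n)) * (qb q - qa q + (qd q - qc q)).
  rewrite E; apply: normc_rectI_le => //.
    move=> x y hx hy; have [m hm] := qH x y hx hy.
    rewrite (_ : (fun w => _) = (fun w => g w + (- k + (-1) * l * w))); last first.
      by apply/funext => w; ring.
    apply/derivable_cdiff/derivableD_c; apply/derivable_cdiff; first by exists m.
    by eexists; exact: cdiff_affine.
  move=> x y hx hy.
  pose h := (x - p1) +i* (y - p2).
  have -> : x +i* y = (p1 +i* p2) + h by apply: complex_ext; rewrite /h/=; ring.
  have hh : normc h <= D / 2 ^+ n.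
    rewrite -hD -/q; apply: le_trans (normc_le_reim _) _ => /=.
    have := hp1 n; have := hp2 n; rewrite -/q => /andP[? ?] /andP[? ?].
    move: hx hy => /andP[? ?] /andP[? ?].
    by rewrite lerD// ler_norml; lra.
  have -> : g (p1 +i* p2 + h) - (k + l * (p1 +i* p2 + h)) =
     g (p1 +i* p2 + h) - g (p1 +i* p2) - l * h by rewrite /k; ring.
  by apply: le_trans (hr h (le_trans hh hn)) _; rewrite ler_wpM2l// ltW.
apply: le_trans (ler_wpM2l _ db) _; first by rewrite exprn_ge0.
rewrite hD (_ : 4 ^+ n = 2 ^+ n * 2 ^+ n); last by rewrite -exprMn; congr (_ ^+ _); ring.
have -> : 2 ^+ n * 2 ^+ n * (4 * (e * (D / 2 ^+ n)) * (D / 2 ^+ n)) = 4 * e * D * D.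
  by field; rewrite expf_neq0.
by [].
Qed.

End Goursat.

(** * Moving an integral across a horizontal strip *)

Section ShiftContour.
Variable R : realType.
Notation mu := (@lebesgue_measure R).
Local Notation mR := (measurableTypeR R).

(** Rounding y down to a multiple of 1 / (n + 1) gives a function that is measurable on each of
    countably many strips; continuity in y recovers F as the pointwise limit. *)
Lemma measurable_caratheodory (F : R -> R -> R) :
  (forall y, measurable_fun (setT : set mR) (fun x : mR => F x y)) ->
  (forall x, continuous (F x)) ->
  measurable_fun setT (fun p : mR * mR => F p.1 p.2).
Proof.
move=> mF cF.
pose a (n : nat) (y : R) : R := (Num.floor (n.+1%:R * y))%:~R / n.+1%:R.
have a_le n y : `|a n y - y| <= n.+1%:R^-1.
  rewrite /a; have := floor_le (n.+1%:R * y); have := floorD1_gt (n.+1%:R * y).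
  set f := Num.floor _; rewrite intrD => h1 h2.
  have n0 : 0 < n.+1%:R :> R by [].
  have -> : f%:~R / n.+1%:R - y = (f%:~R - n.+1%:R * y) / n.+1%:R.
    by move: n0; move: (n.+1%:R : R) => N N0; field; rewrite gt_eqF.
  rewrite normrM normfV (@ger0_norm _ n.+1%:R)// ler_piMl ?invr_ge0//.
  by rewrite ler_norml; lra.
apply: (@measurable_fun_cvg _ _ _ _ (fun n (p : mR * mR) => F p.1 (a n p.2))); last first.
  move=> [x y] _ /=.
  have : F x z @[z --> y] --> F x y by exact: cF.
  apply: cvg_comp; apply/cvgrPdist_le => e e0; near=> n.
  rewrite distrC; apply: le_trans (a_le n y) _.
  rewrite -[e]invrK lef_pV2 ?posrE ?invr_gt0//.
  by apply: (@le_trans _ _ n%:R); [near: n; exact: nbhs_infty_ger|rewrite ler_nat].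
move=> n _ Y mY; rewrite setTI.
pose b (k : int) : R := k%:~R / n.+1%:R.
have n0 : 0 < n.+1%:R :> R by [].
rewrite (_ : _ @^-1` Y = \bigcup_(k : int) (((fun x : mR => F x (b k)) @^-1` Y) `*`
   (`[b k, b (k + 1)[%classic : set mR))).
  apply: countable_bigcupT_measurable; first exact: countableP.
  move=> k; apply: measurableX; last exact: measurable_itv.
  by have := mF (b k) measurableT Y mY; rewrite setTI.
have E (k : int) (y : R) : b k <= y < b (k + 1) -> a n y = b k.
  rewrite /b ler_pdivrMr// ltr_pdivlMr// => h; rewrite /a; congr (_%:~R / _).
  by apply/eqP; rewrite floor_eq mulrC.
apply/seteqP; split => [[x y] /= h|[x y] /= [k _ [/= h]]].
  exists (Num.floor (n.+1%:R * y)) => //=; split => //=.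
  rewrite in_itv/= /b ler_pdivrMr// ltr_pdivlMr// mulrC.
  by have := floor_itv (y * n.+1%:R).
by rewrite in_itv/= => /E ->.
Unshelve. all: by end_near. Qed.

Lemma ge0_tail (f : R -> R) : mu.-integrable setT (EFin \o f) ->
  (forall x, 0 <= f x) -> forall e : R, 0 < e -> exists2 N : R, 0 <= N &
  forall a b, a <= - N -> N <= b ->
    \int[mu]_x f x - \int[mu]_(x in `[a, b]) f x <= e.
Proof.
move=> fi f0 e e0.
pose F (n : nat) : set mR := `[- n%:R, n%:R]%classic.
have mf := measurable_int _ fi.
have h : (\int[mu]_(x in F i) (f x)%:E)%E @[i --> \oo] -->
    (\int[mu]_(x in \bigcup_i F i) (f x)%:E)%E.
  apply: ge0_nondecreasing_set_cvg_integral.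
  - apply/nondecreasing_seqP => n; apply/subsetPset => x; rewrite /F/= !in_itv/=.
    by rewrite -natr1 => /andP[h1 h2]; lra.
  - by move=> i; exact: measurable_itv.
  - by move=> i; apply: measurable_funS mf.
  - by move=> i x _; rewrite lee_fin.
have FT : \bigcup_i F i = setT.
  apply/seteqP; split => // x _; exists (Num.truncn `|x|).+1 => //.
  rewrite /F/= in_itv/= -ler_norml; apply/ltW; exact: truncnS_gt.
rewrite FT in h.
have fin_itv A : measurable (A : set mR) -> (\int[mu]_(x in A) (f x)%:E)%E \is a fin_num.
  by move=> mA; apply: integrable_fin_num => //; apply: integrableS fi.
have : fine (\int[mu]_(x in F i) (f x)%:E)%E @[i --> \oo] -->
    fine (\int[mu]_x (f x)%:E)%E.
  by apply: fine_cvg; rewrite fineK//; exact: fin_itv.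
move=> /cvgrPdist_le /(_ e e0) [n _ Hn].
exists n%:R => // a b an bn.
have := Hn n (leqnn n); rewrite -/(Rintegral _ _ _) -/(Rintegral _ _ _) => H.
have : \int[mu]_(x in F n) f x <= \int[mu]_(x in `[a, b]) f x.
  apply: fine_le; [by apply: fin_itv; exact: measurable_itv|by apply: fin_itv|].
  apply: ge0_subset_integral.
  - exact: measurable_itv.
  - exact: measurable_itv.
  - exact: (measurable_funS measurableT).
  - by move=> x _; rewrite lee_fin.
  - by apply: subset_itv; rewrite bnd_simp.
have := ler_norm (\int[mu]_x f x - \int[mu]_(x in F n) f x).
lra.
Qed.

Lemma cint_tail (f : R -> R[i]) : cintegrable setT f ->
  forall e : R, 0 < e -> exists2 N : R, 0 <= N & forall a b, a <= - N -> N <= b ->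
    normc (cint setT f - cint `[a, b] f) <= e.
Proof.
move=> fi e e0.
have ni := cintegrable_normc measurableT fi.
have e2 : 0 < e / 2 by rewrite divr_gt0.
have [N N0 HN] := ge0_tail ni (fun x => normc_ge0 (f x)) e2.
exists N => // a b aN bN.
have mI : measurable (`[a, b]%classic : set mR) by [].
have mC : measurable (~` `[a, b]%classic : set mR) by exact: measurableC.
have dis : [disjoint (`[a, b]%classic : set mR) & ~` `[a, b]%classic].
  by apply/disj_setPS; rewrite setICr.
have E : cint setT f = cint `[a, b] f + cint (~` `[a, b]) f.
  by rewrite -cint_setU ?setUv.
have E' : \int[mu]_x normc (f x) = \int[mu]_(x in `[a, b]) normc (f x) +
    \int[mu]_(x in ~` `[a, b]) normc (f x).
  by rewrite -Rintegral_setU ?setUv.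
rewrite E addrC addrA addNr add0r.
apply: le_trans (normc_cint _ _) _ => //; first exact: cintegrableS fi.
have := HN a b aN bN; rewrite E' -ler_pdivlMl// mulrC; lra.
Qed.

(** If V exceeded c on a half-line, its integral would be infinite. This supplies vertical edges
    with small integrals although the integrand has no known pointwise decay. *)
Lemma exists_small_section (V : R -> \bar R) (c : R) : measurable_fun (setT : set mR) V ->
  (forall x, (0 <= V x)%E) -> (\int[mu]_x V x < +oo)%E -> 0 < c ->
  forall N : R, (exists2 x, N <= x & (V x <= c%:E)%E) /\
                (exists2 x, x <= N & (V x <= c%:E)%E).
Proof.
move=> mV V0 Vi c0 N.
have key (A : set mR) : measurable A -> mu A = +oo%E -> exists2 x, A x & (V x <= c%:E)%E.
  move=> mA muA; apply: contrapT => H.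
  have HA x : A x -> (c%:E <= V x)%E.
    move=> Ax; rewrite leNgt; apply/negP => /ltW h; apply: H; by exists x.
  have : (\int[mu]_(x in A) c%:E <= \int[mu]_x V x)%E.
    apply: (@le_trans _ _ (\int[mu]_(x in A) V x)%E).
      by apply: ge0_le_integral => //; [move=> x _; rewrite lee_fin ltW|exact: measurable_funS mV].
    by apply: ge0_subset_integral.
  rewrite integral_cst//.
  have -> : (c%:E * lebesgue_measure A = +oo)%E by rewrite [lebesgue_measure A]muA gt0_muley ?lte_fin.
  by rewrite leye_eq => /eqP h; rewrite h in Vi.
split.
  have [|x] := @key `[N, +oo[%classic (measurable_itv _).
    by rewrite [LHS]lebesgue_measure_itv/= ?ltry ?ltNyr.
  by rewrite /= in_itv/= andbT => *; exists x.
have [|x] := @key `]-oo, N]%classic (measurable_itv _).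
  by rewrite [LHS]lebesgue_measure_itv/= ?ltry ?ltNyr.
by rewrite /= in_itv/= => *; exists x.
Qed.

Definition strip_diff (g : R[i] -> R[i]) (a b : R) := forall x y, a <= y <= b ->
  exists l, cdiff g (x +i* y) l.

Lemma strip_cmeasurable g a b y : strip_diff g a b -> a <= y <= b ->
  cmeasurable setT (fun x => g (x +i* y)).
Proof.
move=> H hy; apply: cont_cmeasurable => x; have [l hl] := H x y hy.
exact: cdiff_cont_at_h hl.
Qed.

Lemma cintegrableP f : cmeasurable (setT : set mR) f ->
  (\int[mu]_x (normc (f x))%:E < +oo)%E -> cintegrable setT f.
Proof.
move=> mf fi.
apply: (@cintegrable_le _ _ _ (fun x => normc (f x))) => //.
apply/integrableP; split; first by apply/measurable_EFinP; exact: measurable_normc.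
apply: le_lt_trans fi; apply: ge0_le_integral => //.
- apply: measurableT_comp => //; apply/measurable_EFinP; exact: measurable_normc.
- by apply/measurable_EFinP; exact: measurable_normc.
- by move=> x _; rewrite /= ger0_norm ?normc_ge0.
Qed.

(** Tonelli's theorem: integrating first along the horizontal lines bounds the double integral by M
    (b - a). *)
Lemma strip_vertical g a b (M : R) : a <= b -> strip_diff g a b ->
  (forall y, a <= y <= b -> (\int[mu]_x (normc (g (x +i* y)))%:E <= M%:E)%E) ->
  let V x := (\int[mu]_(y in `[a, b]) (normc (g (x +i* y)))%:E)%E in
  measurable_fun (setT : set mR) V /\ (\int[mu]_x V x < +oo)%E.
Proof.
move=> ab H HM V.
(* Clamping y to [a, b] makes the integrand continuous in y on the whole line, as
   [measurable_caratheodory] asks. *)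
pose c (y : R) := Num.max a (Num.min y b).
have cab y : a <= c y <= b by rewrite /c le_max lexx/= ge_max ab ge_min lexx orbT.
have cid y : a <= y <= b -> c y = y.
  by move=> /andP[h1 h2]; rewrite /c min_l// max_r.
have cc : continuous c.
  move=> y; apply/cvgrPdist_le => e e0; exists e => // z /= hz.
  apply: le_trans (ltW hz); move: hz => _; rewrite /c /Order.max /Order.min.
  have h1 := ler_norm (y - z).
  have h2 : z - y <= `|y - z| by rewrite distrC ler_norm.
  rewrite ler_norml.
  by case: (ltP y b) => ?; case: (ltP z b) => ?; (do 2?[case: ltP => ?]); lra.
pose F x y := normc (g (x +i* c y)).
have mF : measurable_fun setT (fun p : mR * mR => F p.1 p.2).
  apply: measurable_caratheodory => [y|x y].
    by apply: measurable_normc; exact: (strip_cmeasurable H (cab y)).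
  apply: (@continuous_comp _ _ _ c (fun y => normc (g (x +i* y)))); first exact: cc.
  have [l hl] := H x (c y) (cab y).
  apply/cvgrPdist_le => e e0; have [d d0 Hd] := cdiff_cont_at_v hl e0.
  exists d => // z /= hz; rewrite distrC.
  apply: le_trans (Hd z _); last by rewrite distrC ltW.
  rewrite ler_norml lerBrDr addrC.
  have h1 := normcD_le (g (x +i* c y)) (g (x +i* z) - g (x +i* c y)).
  have h2 := normcB_le (g (x +i* z)) (g (x +i* z) - g (x +i* c y)).
  rewrite addrC subrK in h1; rewrite opprB addrC subrK in h2.
  by apply/andP; split; lra.
pose G (p : mR * mR) : \bar R := (F p.1 p.2 * \1_`[a, b]%classic p.2)%:E.
have mG : measurable_fun setT G.
  apply/measurable_EFinP; apply: measurable_funM => //.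
  have mi : measurable_fun setT (\1_(`[a, b]%classic : set mR) : mR -> R).
    by apply: measurable_indic; exact: measurable_itv.
  exact: (measurableT_comp mi measurable_snd).
have G0 p : (0 <= G p)%E by rewrite lee_fin mulr_ge0 ?normc_ge0.
have VE x : V x = (\int[mu]_y G (x, y))%E.
  rewrite /V integral_mkcond; apply: eq_integral => y _; rewrite patchE /G/= indicE.
  case: ifPn => [|_]; last by rewrite mulr0.
  by rewrite mulr1 inE/= in_itv/= => /cid cy; rewrite /F cy.
have VE' : V = (fun x => \int[mu]_y G (x, y))%E by apply/funext.
split; first by rewrite VE'; exact: (measurable_fun_fubini_tonelli_F G mG G0).
rewrite VE' (fubini_tonelli G mG G0).
apply: (@le_lt_trans _ _ (\int[mu]_(y in `[a, b]) M%:E)%E).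
  rewrite [leRHS]integral_mkcond; apply: ge0_le_integral => //.
  - by move=> y _; exact: integral_ge0.
  - exact: (measurable_fun_fubini_tonelli_G G mG G0).
  - by apply/(measurable_restrictT _ _).1 => //; exact: measurable_cst.
  - move=> y _; rewrite patchE; case: ifPn => [|ny].
      rewrite inE/= in_itv/= => yab; apply: le_trans (HM y yab).
      apply: ge0_le_integral => //.
      + exact: measurableT_comp mG (measurable_pair2 y).
      + by apply/measurable_EFinP; apply: measurable_normc; exact: (strip_cmeasurable H yab).
      + move=> x _; rewrite lee_fin indicE /F cid//= ler_piMr ?normc_ge0//.
        by case: (_ \in _).
    by rewrite integral0_eq// => x _; rewrite /G/= indicE (negbTE ny) mulr0.
rewrite integral_cst//= lebesgue_measure_itv/= lte_fin.
by case: ifP => _; rewrite ?mule0 ?ltry// -EFinB -EFinM ltry.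
Qed.

(** Goursat's theorem on a long rectangle whose vertical edges are placed where
    [exists_small_section] makes their integrals small; the horizontal edges differ from the full
    lines by small tails. *)
Theorem cint_shift g a b (M : R) : a <= b -> strip_diff g a b ->
  (forall y, a <= y <= b -> (\int[mu]_x (normc (g (x +i* y)))%:E <= M%:E)%E) ->
  cint setT (fun x => g (x +i* a)) = cint setT (fun x => g (x +i* b)).
Proof.
move=> ab H HM.
have [mV Vi] := strip_vertical ab H HM.
have ci y : a <= y <= b -> cintegrable setT (fun x => g (x +i* y)).
  move=> hy; apply: cintegrableP; first exact: (strip_cmeasurable H hy).
  by apply: le_lt_trans (HM y hy) _; rewrite ltry.
have aab : a <= a <= b by rewrite lexx ab.
have bab : a <= b <= b by rewrite lexx ab.
apply/eqP; rewrite -subr_eq0 -normc_eq0 eq_le normc_ge0 andbT.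
apply/ler_addgt0Pr => e e0; rewrite add0r.
(* Two tails of size d and two vertical edges of size 2 d. *)
pose d := e / 6; have d0 : 0 < d by rewrite divr_gt0.
have [N1 _ h1] := cint_tail (ci a aab) d0.
have [N2 _ h2] := cint_tail (ci b bab) d0.
pose N := Num.max 0 (Num.max N1 N2).
have V0 x : (0 <= \int[mu]_(y in `[a, b]) (normc (g (x +i* y)))%:E)%E.
  by apply: integral_ge0 => y _; rewrite lee_fin normc_ge0.
have [[X XN VX] _] := exists_small_section mV V0 Vi d0 N.
have [_ [Y YN VY]] := exists_small_section mV V0 Vi d0 (- N).
have N0 : 0 <= N by rewrite /N le_max lexx.
have NN1 : N1 <= N by rewrite /N !le_max lexx !orbT.
have NN2 : N2 <= N by rewrite /N !le_max lexx !orbT.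
have YX : Y <= X by lra.
have Hr : cdiff_rect g Y X a b by move=> x y _ hy; exact: H.
have := goursat YX ab Hr; rewrite /rectI => G.
have vert x : Y <= x <= X -> (\int[mu]_(y in `[a, b]) (normc (g (x +i* y)))%:E <= d%:E)%E ->
    normc (cint `[a, b] (fun t => g (x +i* t))) <= 2 * d.
  move=> hx hd; have hi := cdiff_rect_v Hr hx.
  apply: le_trans (normc_cint _ hi) _ => //; rewrite ler_pM2l//.
  rewrite -lee_fin; apply: le_trans hd; rewrite /Rintegral fineK//.
  by apply: integrable_fin_num => //; exact: cintegrable_normc.
have v1 := vert X _ VX; rewrite YX lexx in v1; have {}v1 := v1 isT.
have v2 := vert Y _ VY; rewrite YX lexx in v2; have {}v2 := v2 isT.
have t1 := h1 Y X _ _; have {}t1 : normc (cint [set: R] (fun x => g (x +i* a)) - cint `[Y, X] (fun x => g (x +i* a))) <= d by apply: t1; lra.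
have t2 := h2 Y X _ _; have {}t2 : normc (cint [set: R] (fun x => g (x +i* b)) - cint `[Y, X] (fun x => g (x +i* b))) <= d by apply: t2; lra.
move: G t1 t2 v1 v2.
set A := cint setT _; set B := cint setT _; set A' := cint `[Y, X] _; set B' := cint `[Y, X] _.
set P := cint `[a, b] _; set Q := cint `[a, b] _ => G t1 t2 v1 v2.
have -> : A - B = (A - A') - (B - B') - 'i * (P - Q).
  have -> : 'i * (P - Q) = - (A' - B') by apply/eqP; rewrite -addr_eq0 addrC G.
  by ring.
apply: le_trans (normcB_le _ _) _; rewrite normcM_eq normc_i mul1r.
apply: le_trans (lerD (normcB_le _ _) (normcB_le _ _)) _.
have E : e = 6 * d by rewrite /d; field.
move: (normc _) (normc _) (normc _) (normc _) t1 t2 v1 v2 => p1 p2 p3 p4.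
rewrite E; clear; lra.
Qed.

End ShiftContour.

(** * Square-integrable functions and the Poisson kernel *)

Section SquareIntegrable.
Variable R : realType.
Notation mu := (@lebesgue_measure R).
Local Notation mR := (measurableTypeR R).
Implicit Types (f g : R -> R[i]).

Definition sqi f := cmeasurable (setT : set mR) f /\
  (\int[mu]_x (normc (f x) ^+ 2)%:E < +oo)%E.

Definition l2 f : R := \int[mu]_x (normc (f x) ^+ 2).

Lemma measurable_normc2 f : cmeasurable (setT : set mR) f ->
  measurable_fun (setT : set mR) (fun x => normc (f x) ^+ 2).
Proof. by move=> mf; apply: measurable_funX; exact: measurable_normc. Qed.

Lemma ge0_integrable (h : R -> R) : measurable_fun (setT : set mR) h ->
  (forall x, 0 <= h x) -> (\int[mu]_x (h x)%:E < +oo)%E ->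
  mu.-integrable setT (EFin \o h).
Proof.
move=> mh h0 hi; apply/integrableP; split; first exact/measurable_EFinP.
by under eq_integral => x _ do rewrite /= ger0_norm//.
Qed.

Lemma integrable_EFin (h : R -> R) : mu.-integrable setT (EFin \o h) ->
  (\int[mu]_x (h x)%:E)%E = (\int[mu]_x h x)%:E.
Proof. by move=> hi; rewrite /Rintegral fineK//; exact: integrable_fin_num. Qed.

Lemma sqi_int f : sqi f -> mu.-integrable setT (EFin \o (fun x => normc (f x) ^+ 2)).
Proof.
move=> [mf fi]; apply: ge0_integrable => //; first exact: measurable_normc2.
by move=> x; rewrite sqr_ge0.
Qed.

Lemma l2E f : sqi f -> (\int[mu]_x (normc (f x) ^+ 2)%:E)%E = (l2 f)%:E.
Proof. by move=> /sqi_int /integrable_EFin. Qed.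

Lemma l2_ge0 f : 0 <= l2 f.
Proof. by apply: Rintegral_ge0 => x _; rewrite sqr_ge0. Qed.

Lemma sqi_le f (M : R) : cmeasurable (setT : set mR) f ->
  (\int[mu]_x (normc (f x) ^+ 2)%:E <= M%:E)%E -> sqi f /\ l2 f <= M.
Proof.
move=> mf fM; have sf : sqi f by split => //; apply: le_lt_trans fM _; rewrite ltry.
by split => //; rewrite -lee_fin -l2E.
Qed.

Lemma cmeasurableM f g : cmeasurable (setT : set mR) f -> cmeasurable (setT : set mR) g ->
  cmeasurable (setT : set mR) (fun x => f x * g x).
Proof.
move=> [f1 f2] [g1 g2]; split.
  by under eq_fun do rewrite reM; apply: measurable_funB; apply: measurable_funM.
by under eq_fun do rewrite imM; apply: measurable_funD; apply: measurable_funM.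
Qed.

Lemma cmeasurableD f g : cmeasurable (setT : set mR) f -> cmeasurable (setT : set mR) g ->
  cmeasurable (setT : set mR) (fun x => f x + g x).
Proof.
move=> [f1 f2] [g1 g2]; split.
  by under eq_fun do rewrite reD; apply: measurable_funD.
by under eq_fun do rewrite imD; apply: measurable_funD.
Qed.

Lemma cmeasurable_cst c : cmeasurable (setT : set mR) (fun=> c : R[i]).
Proof. by split; exact: measurable_cst. Qed.

Lemma cmeasurableZ c f : cmeasurable (setT : set mR) f ->
  cmeasurable (setT : set mR) (fun x => c * f x).
Proof. by move=> mf; apply: cmeasurableM => //; exact: cmeasurable_cst. Qed.

Lemma cmeasurable_conj f : cmeasurable (setT : set mR) f ->
  cmeasurable (setT : set mR) (fun x => Num.conj (f x)).
Proof.
move=> [f1 f2]; split.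
  by under eq_fun do rewrite reJ.
by under eq_fun do rewrite imJ; apply: measurable_funN.
Qed.

(** Weighted arithmetic-geometric means, in place of Cauchy-Schwarz. The free parameter s lets a
    small factor compensate for a large one. *)
Lemma sqiM f g (s : R) : sqi f -> sqi g -> 0 < s ->
  cintegrable setT (fun x => f x * g x) /\
  \int[mu]_x normc (f x * g x) <= (s * l2 f + s^-1 * l2 g) / 2.
Proof.
move=> sf sg s0; have i1 := sqi_int sf; have i2 := sqi_int sg.
have i3 := Rintegrable_lin (s / 2) (s^-1 / 2) measurableT i1 i2.
have b x : normc (f x * g x) <= s / 2 * normc (f x) ^+ 2 + s^-1 / 2 * normc (g x) ^+ 2.
  rewrite normcM_eq; set u := normc (f x); set v := normc (g x).
  rewrite -subr_ge0; have -> : s / 2 * u ^+ 2 + s^-1 / 2 * v ^+ 2 - u * v =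
    s / 2 * (u - s^-1 * v) ^+ 2 by field; rewrite gt_eqF.
  by rewrite mulr_ge0 ?sqr_ge0// divr_ge0// ltW.
have ci : cintegrable setT (fun x => f x * g x).
  apply: (cintegrable_le measurableT _ i3); last by move=> x _; exact: b.
  by apply: cmeasurableM; [exact: sf.1|exact: sg.1].
split => //.
apply: (@le_trans _ _ (\int[mu]_x (s / 2 * normc (f x) ^+ 2 + s^-1 / 2 * normc (g x) ^+ 2))).
  apply: le_Rintegral => //; exact: cintegrable_normc.
rewrite Rintegral_lin// -/(l2 f) -/(l2 g); lra.
Qed.

Lemma sqiM_int f g : sqi f -> sqi g -> cintegrable setT (fun x => f x * g x).
Proof. by move=> sf sg; have [] := sqiM sf sg (@ltr01 R). Qed.

Lemma sqiM_bound f g : sqi f -> sqi g ->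
  (\int[mu]_x (normc (f x * g x))%:E <= (l2 f + l2 g)%:E)%E.
Proof.
move=> sf sg; have [ci b] := sqiM sf sg (@ltr01 R).
have i1 := cintegrable_normc measurableT ci.
rewrite integrable_EFin// lee_fin; apply: le_trans b _.
by rewrite invr1 !mul1r; have := l2_ge0 f; have := l2_ge0 g; lra.
Qed.

Lemma cintM_le f g (s : R) : sqi f -> sqi g -> 0 < s ->
  normc (cint setT (fun x => f x * g x)) <= s * l2 f + s^-1 * l2 g.
Proof.
move=> sf sg s0; have [ci b] := sqiM sf sg s0.
by apply: le_trans (normc_cint _ ci) _ => //; lra.
Qed.

Lemma sqiD f g : sqi f -> sqi g -> sqi (fun x => f x + g x) /\
  l2 (fun x => f x + g x) <= 2 * l2 f + 2 * l2 g.
Proof.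
move=> sf sg; have i1 := sqi_int sf; have i2 := sqi_int sg.
have i3 := Rintegrable_lin 2 2 measurableT i1 i2.
apply: sqi_le; first by apply: cmeasurableD; [exact: sf.1|exact: sg.1].
rewrite -Rintegral_lin// -integrable_EFin//; apply: ge0_le_integral => //.
- by move=> x _; rewrite lee_fin sqr_ge0.
- apply/measurable_EFinP; apply: measurable_normc2.
  by apply: cmeasurableD; [exact: sf.1|exact: sg.1].
- by case/integrableP : i3.
- move=> x _; rewrite lee_fin.
  have h := normcD_le (f x) (g x); have h0 := normc_ge0 (f x + g x).
  have : normc (f x + g x) ^+ 2 <= (normc (f x) + normc (g x)) ^+ 2.
    by rewrite ler_pXn2r// nnegrE ?addr_ge0 ?normc_ge0.
  have := sqr_ge0 (normc (f x) - normc (g x)); rewrite !expr2; lra.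
Qed.

Lemma sqiZ c f : sqi f -> sqi (fun x => c * f x) /\
  l2 (fun x => c * f x) = normc c ^+ 2 * l2 f.
Proof.
move=> sf; have i1 := sqi_int sf.
have E : \int[mu]_x (normc (c * f x) ^+ 2) = normc c ^+ 2 * l2 f.
  rewrite /l2 -RintegralZl//.
  by apply: eq_Rintegral => x _; rewrite normcM_eq exprMn.
split => //; split; first exact: cmeasurableZ sf.1.
under eq_integral => x _ do rewrite normcM_eq exprMn EFinM.
rewrite ge0_integralZl//.
- by rewrite l2E// -EFinM ltry.
- by apply/measurable_EFinP; exact: measurable_normc2 sf.1.
- by move=> x _; rewrite lee_fin sqr_ge0.
- by rewrite lee_fin sqr_ge0.
Qed.

Lemma sqiB f g : sqi f -> sqi g -> sqi (fun x => f x - g x) /\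
  l2 (fun x => f x - g x) <= 2 * l2 f + 2 * l2 g.
Proof.
move=> sf sg; have [sg' e] := sqiZ (-1) sg.
have := sqiD sf sg'; rewrite e normc_opp normc_1 expr1n mul1r.
by rewrite (_ : (fun x => f x + -1 * g x) = (fun x => f x - g x))//; apply/funext => x; rewrite mulN1r.
Qed.

Lemma sqi_conj f : sqi f -> sqi (fun x => Num.conj (f x)) /\
  l2 (fun x => Num.conj (f x)) = l2 f.
Proof.
move=> sf; split; first split; first exact: cmeasurable_conj sf.1.
  by under eq_integral => x _ do rewrite normc_conj; exact: sf.2.
by apply: eq_Rintegral => x _; rewrite normc_conj.
Qed.

Lemma cint_l2 f : sqi f -> cint setT (fun x => f x * Num.conj (f x)) = (l2 f)%:C.
Proof.
move=> sf; apply: complex_ext => /=.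
  by apply: eq_Rintegral => x _; rewrite mul_conj.
rewrite (_ : (fun x => im (f x * Num.conj (f x))) = fun=> 0); last first.
  by apply/funext => x; rewrite mul_conj.
by rewrite Rintegral_cst// mul0r.
Qed.

Lemma sqi_integrable_mul f g : sqi f -> sqi g ->
  cintegrable setT (fun x => f x * Num.conj (g x)).
Proof. by move=> sf sg; apply: sqiM_int => //; exact: (sqi_conj sg).1. Qed.

Lemma l2B f g : sqi f -> sqi g ->
  (l2 (fun x => f x - g x))%:C = (l2 f)%:C + (l2 g)%:C -
   cint setT (fun x => f x * Num.conj (g x)) - cint setT (fun x => g x * Num.conj (f x)).
Proof.
move=> sf sg; rewrite -cint_l2; last exact: (sqiB sf sg).1.
rewrite -!cint_l2// -cintD//; try exact: sqi_integrable_mul.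
rewrite -!cintB//; try exact: sqi_integrable_mul.
- by apply: eq_cint => x _ /=; rewrite cjB; ring.
- by apply: cintegrableB => //; [apply: cintegrableD|]; rewrite ?measurableT//; exact: sqi_integrable_mul.
- by apply: cintegrableD => //; exact: sqi_integrable_mul.
Qed.

End SquareIntegrable.

Section PoissonKernel.
Variable R : realType.
Notation mu := (@lebesgue_measure R).
Local Notation mR := (measurableTypeR R).

Lemma integralT_oneDsqrV : (\int[mu]_x ((1 + x ^+ 2)^-1)%:E = pi%:E)%E.
Proof.
rewrite (@ge0_symfun_integralT _ (fun x => (1 + x ^+ 2)^-1)).
- rewrite -set_itvcy.
  rewrite [X in (_ * X)%E](_ : _ = (pi / 2)%:E); last exact: integral0y_oneDsqr.
  by rewrite -EFinM mulrC divfK.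
- by move=> x; rewrite invr_ge0 addr_ge0 ?sqr_ge0.
- exact: continuous_oneDsqrV.
- by move=> x /=; rewrite sqrrN.
Qed.

Lemma pdenom_gt0 (u v t : R) : 0 < v -> 0 < (t - u) ^+ 2 + v ^+ 2.
Proof. by move=> v0; rewrite ltr_wpDl ?sqr_ge0// exprn_gt0. Qed.

Lemma integral_poisson (u v : R) : 0 < v ->
  (\int[mu]_t (v / ((t - u) ^+ 2 + v ^+ 2))%:E = pi%:E)%E.
Proof.
move=> v0; rewrite -integralT_oneDsqrV.
pose F (t : R) := (t - u) / v.
have Fd (x : R) : is_derive x (1 : R) F v^-1.
  by apply: is_derive_eq; rewrite /GRing.scale/=; field; rewrite gt_eqF.
have F'E : F^`()%classic = fun=> v^-1.
  by apply/funext => x; rewrite derive1E (@derive_val _ _ _ _ _ _ _ (Fd x)).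
rewrite (@increasing_ge0_integration_by_substitutionT _ F (fun x => (1 + x ^+ 2)^-1)).
- apply: eq_integral => t _; congr EFin; rewrite /= F'E /F /=.
  have h1 := pdenom_gt0 u t v0.
  have h2 : 1 + ((t - u) / v) ^+ 2 = ((t - u) ^+ 2 + v ^+ 2) / v ^+ 2.
    by field; rewrite gt_eqF.
  change (v / ((t - u) ^+ 2 + v ^+ 2) = (1 + ((t - u) / v) ^+ 2)^-1 * v^-1).
  by rewrite h2 invf_div; field; rewrite (gt_eqF v0) (gt_eqF h1).
- by move=> x y xy; rewrite /F ltr_pM2r ?invr_gt0// ltrD2r.
- by rewrite F'E => x; exact: cvg_cst.
- by rewrite F'E; exact: is_cvg_cst.
- by rewrite F'E; exact: is_cvg_cst.
- by move=> x; have [] := Fd x.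
- apply/cvgrNyPle => A; near=> t; rewrite /F ler_pdivrMr// lerBlDr.
  near: t; apply: nbhs_ninfty_le; exact: num_real.
- apply/cvgryPge => A; near=> t; rewrite /F ler_pdivlMr// lerBrDr.
  near: t; apply: nbhs_pinfty_ge; exact: num_real.
- exact: continuous_oneDsqrV.
- by move=> x; rewrite invr_ge0 addr_ge0 ?sqr_ge0.
Unshelve. all: by end_near. Qed.

Lemma normc2_sub (t : R) (w : R[i]) : normc (t%:C - w) ^+ 2 = (t - re w) ^+ 2 + im w ^+ 2.
Proof. by rewrite normc2 reB imB/= sub0r sqrrN. Qed.

Lemma sub_real_neq0 (t : R) (w : R[i]) : im w != 0 -> t%:C - w != 0.
Proof.
apply: contraNneq => /(congr1 (@complex.Im R)); rewrite imB/= sub0r => /eqP.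
by rewrite oppr_eq0.
Qed.

Lemma cont_at_ker (w : R[i]) (x : R) : im w != 0 -> cont_at (fun t => (t%:C - w)^-1) x.
Proof.
move=> w0.
have [l hl] : exists l, cdiff (fun z => (z - w)^-1) (x +i* 0) l.
  apply/derivable_cdiff; apply: derivableV_c; first exact: sub_real_neq0.
  exact: derivable_subr_c.
exact: cdiff_cont_at_h hl.
Qed.

(** The squared modulus is 1 / |Im w| times a Poisson kernel, whose integral is pi. *)
Lemma sqi_ker (w : R[i]) : im w != 0 ->
  sqi (fun t => (t%:C - w)^-1) /\ l2 (fun t => (t%:C - w)^-1) = pi / `|im w|.
Proof.
move=> w0; set v := `|im w|; have v0 : 0 < v by rewrite normr_gt0.
have E : (\int[mu]_t (normc ((t%:C - w)^-1) ^+ 2)%:E = (pi / v)%:E)%E.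
  under eq_integral => t _.
    rewrite normcV_eq exprVn normc2_sub.
    have -> : ((t - re w) ^+ 2 + im w ^+ 2)^-1 = v^-1 * (v / ((t - re w) ^+ 2 + v ^+ 2)).
      by rewrite mulKf ?gt_eqF// /v real_normK ?num_real.
    rewrite EFinM; over.
  rewrite ge0_integralZl//=.
  - by rewrite integral_poisson// -EFinM mulrC.
  - apply/measurable_EFinP; apply: continuous_measurable_fun => t.
    apply: cvgM; first exact: cvg_cst.
    apply: cvgV; first by rewrite gt_eqF// pdenom_gt0.
    apply: cvgD; last exact: cvg_cst.
    by apply: (@cvg_comp _ _ _ (fun t => t - re w) (fun t => t ^+ 2)); last exact: exprn_continuous; apply: cvgB; [exact: cvg_id|exact: cvg_cst].
  - by move=> t _; rewrite lee_fin divr_ge0 ?(ltW v0)// ltW// pdenom_gt0.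
  - by rewrite lee_fin invr_ge0 ltW.
have sk : sqi (fun t => (t%:C - w)^-1).
  split; first by apply: cont_cmeasurable => x; exact: cont_at_ker.
  by rewrite E ltry.
by split => //; apply: EFin_inj; rewrite -l2E.
Qed.

End PoissonKernel.

Section NonnegativeIntegrals.
Variable R : realType.
Notation mu := (@lebesgue_measure R).
Local Notation mR := (measurableTypeR R).
Implicit Types (A B D : set mR) (f g : R -> R).

Lemma ge0_int_le D f g : measurable D ->
  measurable_fun (setT : set mR) f -> measurable_fun (setT : set mR) g ->
  (forall t, D t -> 0 <= f t) -> (forall t, D t -> f t <= g t) ->
  (\int[mu]_(t in D) (f t)%:E <= \int[mu]_(t in D) (g t)%:E)%E.
Proof.
move=> mD mf mg f0 fg; apply: ge0_le_integral => //.
- by apply/measurable_EFinP; exact: measurable_funS mf.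
- by apply/measurable_EFinP; exact: measurable_funS mg.
Qed.

Lemma ge0_intZl D c f : measurable D -> measurable_fun (setT : set mR) f ->
  (forall t, 0 <= f t) -> 0 <= c ->
  (\int[mu]_(t in D) (c * f t)%:E = c%:E * \int[mu]_(t in D) (f t)%:E)%E.
Proof.
move=> mD mf f0 c0; under eq_integral => t _ do rewrite EFinM.
rewrite ge0_integralZl//.
- by apply/measurable_EFinP; exact: measurable_funS mf.
- by move=> t _; rewrite lee_fin.
Qed.

Lemma ge0_int_subset A B f : measurable A -> measurable B ->
  measurable_fun (setT : set mR) f -> (forall t, 0 <= f t) -> A `<=` B ->
  (\int[mu]_(t in A) (f t)%:E <= \int[mu]_(t in B) (f t)%:E)%E.
Proof.
move=> mA mB mf f0 AB; apply: ge0_subset_integral => //.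
- by apply/measurable_EFinP; exact: measurable_funS mf.
- by move=> t _; rewrite lee_fin.
Qed.

Lemma ge0_intD D f g : measurable D ->
  measurable_fun (setT : set mR) f -> measurable_fun (setT : set mR) g ->
  (forall t, 0 <= f t) -> (forall t, 0 <= g t) ->
  (\int[mu]_(t in D) (f t + g t)%:E =
   \int[mu]_(t in D) (f t)%:E + \int[mu]_(t in D) (g t)%:E)%E.
Proof.
move=> mD mf mg f0 g0; under eq_integral => t _ do rewrite EFinD.
rewrite ge0_integralD//.
- by move=> t _; rewrite lee_fin.
- by apply/measurable_EFinP; exact: measurable_funS mf.
- by move=> t _; rewrite lee_fin.
- by apply/measurable_EFinP; exact: measurable_funS mg.
Qed.

Lemma ge0_int_setU A B f : measurable A -> measurable B ->
  measurable_fun (setT : set mR) f -> (forall t, 0 <= f t) -> A `&` B = set0 ->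
  (\int[mu]_(t in A `|` B) (f t)%:E =
   \int[mu]_(t in A) (f t)%:E + \int[mu]_(t in B) (f t)%:E)%E.
Proof.
move=> mA mB mf f0 AB; apply: ge0_integral_setU => //.
- by apply/measurable_EFinP; exact: measurable_funS mf.
- by move=> t _; rewrite lee_fin.
- by apply/disj_setPS; rewrite AB.
Qed.

Lemma measurable_cM c f : measurable_fun (setT : set mR) f ->
  measurable_fun (setT : set mR) (fun t => c * f t).
Proof. by move=> mf; apply: measurable_funM => //; exact: measurable_cst. Qed.

End NonnegativeIntegrals.

(** * Poisson averages at Lebesgue points *)

Section PoissonLebesgue.
Variable R : realType.
Notation mu := (@lebesgue_measure R).
Local Notation mR := (measurableTypeR R).

Lemma lebesgue_pt_ball (g : R -> R) (x e : R) : lebesgue_pt g x -> 0 < e ->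
  exists2 d : R, 0 < d & forall r, 0 < r -> r < d ->
    (\int[mu]_(t in ball x r) `|g t - g x|%:E <= (e * (2 * r))%:E)%E.
Proof.
move=> gx e0.
have : \forall r \near (0 : R)^'+, (davg g x r < e%:E)%E.
  have : nbhs 0%E [set y : \bar R | (y < e%:E)%E].
    apply: open_nbhs_nbhs; split; first exact: open_ereal_lt_ereal.
    by rewrite /= lte_fin.
  by move=> /gx.
move=> [d /= d0 H]; exists d => // r r0 rd.
have : (davg g x r < e%:E)%E by apply: H => //=; rewrite sub0r normrN gtr0_norm.
rewrite /davg /iavg lebesgue_measure_ball ?(ltW r0)// => h.
have r2 : (0 < r *+ 2)%R by rewrite mulrn_wgt0.
move: h; rewrite inver gt_eqF// muleC -lte_pdivlMr ?invr_gt0// invrK => /ltW h.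
by apply: le_trans h _; rewrite -EFinM mulr_natl.
Qed.

Lemma pow2_between (s d : R) : 0 < s -> s < d ->
  exists n : nat, d / 2 <= 2 ^+ n * s < d.
Proof.
move=> s0 sd.
have ex : exists n : nat, d / 2 <= 2 ^+ n * s.
  exists (Num.truncn (d / 2 / s)).+1; rewrite -ler_pdivrMr//.
  apply: le_trans (ltW (truncnS_gt _)) _.
  by rewrite -natrX ler_nat ltnW// ltn_expl.
case: (ex_minnP ex) => n hn min; exists n; rewrite hn/=.
case: n hn min => [|n] hn min; first by rewrite expr0 mul1r.
have : 2 ^+ n * s < d / 2.
  by rewrite ltNge; apply/negP => /min; rewrite ltnn.
by rewrite exprS -mulrA; lra.
Qed.

Section AtPoint.
Variables (g : R -> R) (x : R).
Hypothesis mg : measurable_fun (setT : set mR) g.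
Hypothesis ig : (\int[mu]_t (g t ^+ 2)%:E < +oo)%E.
Hypothesis lx : lebesgue_pt g x.

Let phi t := `|g t - g x|.
Let P s t := s / ((t - x) ^+ 2 + s ^+ 2).

Let mphi : measurable_fun (setT : set mR) phi.
Proof.
apply: measurableT_comp => //; apply: measurable_funB => //; exact: measurable_cst.
Qed.

Lemma measurable_poisson s : 0 < s -> measurable_fun (setT : set mR) (P s).
Proof.
move=> s0; apply: continuous_measurable_fun => t.
apply: cvgM; first exact: cvg_cst.
apply: cvgV; first by rewrite gt_eqF// pdenom_gt0.
apply: cvgD; last exact: cvg_cst.
apply: (@cvg_comp _ _ _ (fun t => t - x) (fun t => t ^+ 2)); last exact: exprn_continuous.
by apply: cvgB; [exact: cvg_id|exact: cvg_cst].
Qed.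

Let P_ge0 s t : 0 < s -> 0 <= P s t.
Proof. by move=> s0; rewrite divr_ge0// ltW// pdenom_gt0. Qed.

Let mS' s : 0 < s -> measurable_fun (setT : set mR) (fun t => P s t * phi t).
Proof.
by move=> s0; apply: measurable_funM => //; exact: measurable_poisson.
Qed.

Let phi_ge0 t : 0 <= phi t. Proof. exact: normr_ge0. Qed.

(** Dyadic decomposition. The ball of radius s contributes 2 e; on the annulus from 2^k s to 2^(k+1)
    s the kernel is at most s / (2^k s)^2, which gives 4 e / 2^k. Summed up to K these are e (10 - 8
    / 2^K). *)
Lemma poisson_near (s d e : R) : 0 < s -> 0 < e ->
  (forall r, 0 < r -> r < d ->
    (\int[mu]_(t in ball x r) (phi t)%:E <= (e * (2 * r))%:E)%E) ->
  forall K : nat, 2 ^+ K * s < d ->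
  (\int[mu]_(t in ball x (2 ^+ K * s)) (P s t * phi t)%:E <=
     (e * (10 - 8 / 2 ^+ K))%:E)%E.
Proof.
move=> s0 e0 H; elim=> [|K ih] hK.
  rewrite expr0 mul1r divr1 in hK *.
  have mB : measurable (ball x s : set mR) by exact: measurable_ball.
  apply: (@le_trans _ _ (\int[mu]_(t in ball x s) (s^-1 * phi t)%:E)%E).
    apply: ge0_int_le => //; [exact: mS'|exact: measurable_cM| |].
      by move=> t _; rewrite mulr_ge0// P_ge0.
    move=> t _; rewrite ler_wpM2r// /P.
    rewrite ler_pdivrMr ?pdenom_gt0// mulrDr expr2 mulKf ?gt_eqF//.
    by rewrite lerDr mulr_ge0 ?invr_ge0 ?sqr_ge0// ltW.
  rewrite ge0_intZl//; last by rewrite invr_ge0 ltW.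
  apply: (@le_trans _ _ (s^-1%:E * (e * (2 * s))%:E)%E).
    by rewrite lee_wpmul2l ?lee_fin ?invr_ge0 ?(ltW s0)//; exact: H.
  rewrite -EFinM lee_fin.
  have -> : s^-1 * (e * (2 * s)) = e * 2 by field; rewrite gt_eqF.
  by rewrite ler_wpM2l// ?(ltW e0)//; lra.
set r := 2 ^+ K * s; have r0 : 0 < r by rewrite mulr_gt0// exprn_gt0.
have E2 : 2 ^+ K.+1 * s = 2 * r by rewrite exprS -mulrA.
rewrite E2 in hK *.
have rd : r < d by lra.
have {}ih := ih rd.
have mB : measurable (ball x r : set mR) by exact: measurable_ball.
have mB2 : measurable (ball x (2 * r) : set mR) by exact: measurable_ball.
have sub : ball x r `<=` ball x (2 * r) by apply: le_ball; lra.
have dE : ball x (2 * r) = ball x r `|` (ball x (2 * r) `\` ball x r).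
  by rewrite setDUK.
have mDi : measurable (ball x (2 * r) `\` ball x r : set mR) by exact: measurableD.
have q0 : 0 <= s / r ^+ 2 by rewrite divr_ge0 ?sqr_ge0// ltW.
rewrite dE ge0_int_setU//; [|exact: mS'|by move=> t; rewrite mulr_ge0// P_ge0|
  by rewrite setIDA setDE setIAC setICr set0I].
have h2 : (\int[mu]_(t in ball x (2 * r) `\` ball x r) (P s t * phi t)%:E <=
     (e * (4 / 2 ^+ K))%:E)%E.
  apply: (@le_trans _ _ (\int[mu]_(t in ball x (2 * r)) ((s / r ^+ 2) * phi t)%:E)%E).
    apply: (@le_trans _ _ (\int[mu]_(t in ball x (2 * r) `\` ball x r) ((s / r ^+ 2) * phi t)%:E)%E).
      apply: ge0_int_le => //; [exact: mS'|exact: measurable_cM| |].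
        by move=> t _; rewrite mulr_ge0// P_ge0.
      move=> t [_]; rewrite /ball/= => /negP; rewrite -leNgt => rt.
      rewrite ler_wpM2r// /P ler_pM2l// lef_pV2 ?posrE ?exprn_gt0 ?pdenom_gt0//.
      rewrite -[leLHS]addr0 lerD ?sqr_ge0// -[(t - x) ^+ 2]real_normK ?num_real//.
      by rewrite ler_pXn2r ?nnegrE ?(ltW r0)// distrC.
    apply: ge0_int_subset => //; first exact: measurable_cM.
    by move=> t; rewrite mulr_ge0.
  rewrite ge0_intZl//.
  apply: (@le_trans _ _ ((s / r ^+ 2)%:E * (e * (2 * (2 * r)))%:E)%E).
    by rewrite lee_wpmul2l ?lee_fin//; apply: H => //; lra.
  rewrite -EFinM lee_fin /r le_eqVlt; apply/orP; left; apply/eqP; field.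
  by rewrite expf_neq0//= gt_eqF.
apply: le_trans (leeD ih h2) _; rewrite -EFinD lee_fin -mulrDr.
rewrite ler_wpM2l ?(ltW e0)// le_eqVlt; apply/orP; left; apply/eqP.
by rewrite exprS; field; rewrite expf_neq0.
Qed.

(** At distance at least rho the kernel of height s is at most a multiple s k of the kernel of
    height 1, and |g - g x| is at most g^2 + 1 + |g x|, so the integral is linear in s with a
    constant that depends on rho but not on r. *)
Lemma poisson_far (rho : R) : 0 < rho -> exists2 C : R, 0 < C & forall s r, 0 < s ->
  rho <= r ->
  (\int[mu]_(t in ~` ball x r) (P s t * phi t)%:E <= (s * C)%:E)%E.
Proof.
move=> rho0.
pose G := fine (\int[mu]_t (g t ^+ 2)%:E).
have G0 : 0 <= G by apply: fine_ge0; apply: integral_ge0 => t _; rewrite lee_fin sqr_ge0.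
have GE : (\int[mu]_t (g t ^+ 2)%:E = G%:E)%E.
  by rewrite fineK// ge0_fin_numE// integral_ge0// => t _; rewrite lee_fin sqr_ge0.
(* Chosen so that d2 + 1 <= k d2 as soon as d2 >= rho^2. *)
pose k := 1 + rho ^- 2.
have k0 : 0 < k by rewrite ltr_pwDl// invr_ge0 sqr_ge0.
pose c := 1 + `|g x|.
have c0 : 0 < c by rewrite ltr_pwDl.
exists (k * (G + c * pi)); first by rewrite mulr_gt0// ltr_wpDl// mulr_gt0// pi_gt0.
move=> s r s0 rr.
have mB : measurable (~` ball x r : set mR) by apply: measurableC; exact: measurable_ball.
pose h t := g t ^+ 2 + c * P 1 t.
have mh : measurable_fun (setT : set mR) h.
  apply: measurable_funD; first exact: measurable_funX.
  by apply: measurable_funM; [exact: measurable_cst|exact: measurable_poisson].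
have h0 t : 0 <= h t by rewrite addr_ge0 ?sqr_ge0// mulr_ge0 ?(ltW c0)// P_ge0.
have hint : (\int[mu]_t (h t)%:E = (G + c * pi)%:E)%E.
  have cP0 t : 0 <= c * P 1 t by rewrite mulr_ge0 ?(ltW c0)// P_ge0.
  rewrite ge0_intD//.
  - rewrite ge0_intZl ?(ltW c0)//.
    + by rewrite GE integral_poisson// -EFinM -EFinD.
    + exact: measurable_poisson.
    + by move=> t; rewrite P_ge0.
  - exact: measurable_funX.
  - by apply: measurable_cM; exact: measurable_poisson.
  - by move=> t; rewrite sqr_ge0.
apply: (@le_trans _ _ (\int[mu]_(t in ~` ball x r) ((s * k) * h t)%:E)%E).
  apply: ge0_int_le => //.
  - exact: mS'.
  - exact: measurable_cM.
  - by move=> t _; rewrite mulr_ge0// P_ge0.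
  - move=> t; rewrite /ball/= => /negP; rewrite -leNgt => rt.
    have {rt}rt : rho ^+ 2 <= (t - x) ^+ 2.
      rewrite -[leRHS]real_normK ?num_real// ler_pXn2r ?nnegrE ?(ltW rho0)//.
      by rewrite distrC; exact: le_trans rr rt.
    set d2 := (t - x) ^+ 2 in rt *.
    have r20 : 0 < rho ^+ 2 by rewrite exprn_gt0.
    have d20 : 0 < d2 by lra.
    have P1 : 0 < d2 + 1 ^+ 2 by rewrite expr1n; lra.
    have hP : P s t <= s * k * (d2 + 1 ^+ 2)^-1.
      rewrite /P -/d2 -mulrA ler_pM2l// -[leLHS]mul1r.
      rewrite ler_pdivrMr; last by rewrite ltr_pwDl// sqr_ge0.
      rewrite -mulrA mulrC -mulrA ler_pdivlMl// mulr1.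
      have h1 : d2 + 1 ^+ 2 <= d2 * k.
        rewrite /k expr1n mulrDr mulr1 lerD2l.
        by rewrite ler_pdivlMr// mul1r.
      apply: le_trans h1 _; rewrite ler_wpM2r ?(ltW k0)//.
      by rewrite lerDl sqr_ge0.
    apply: (@le_trans _ _ (s * k * (d2 + 1 ^+ 2)^-1 * phi t)).
      by rewrite ler_wpM2r.
    rewrite -[leLHS]mulrA ler_wpM2l ?mulr_ge0 ?(ltW s0) ?(ltW k0)//.
    have hphi : phi t <= g t ^+ 2 + c.
      rewrite /phi /c; apply: le_trans (ler_normB _ _) _; rewrite addrA lerD2r.
      rewrite -[g t ^+ 2]real_normK ?num_real//.
      have := sqr_ge0 (`|g t| - 2^-1); rewrite !expr2; lra.
    apply: (@le_trans _ _ ((d2 + 1 ^+ 2)^-1 * (g t ^+ 2 + c))).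
      by rewrite ler_wpM2l// invr_ge0 ltW.
    rewrite /h mulrDr lerD//; last by rewrite /P div1r mulrC.
    rewrite ler_piMl ?sqr_ge0// invf_le1//; lra.
rewrite ge0_intZl//; last by rewrite mulr_ge0 ?ltW.
apply: (@le_trans _ _ ((s * k)%:E * \int[mu]_t (h t)%:E)%E).
  rewrite lee_wpmul2l ?lee_fin ?mulr_ge0 ?(ltW s0) ?(ltW k0)//.
  exact: ge0_int_subset.
by rewrite hint -EFinM mulrA.
Qed.

Lemma poisson_lebesgue (e : R) : 0 < e -> exists2 d : R, 0 < d & forall s, 0 < s -> s <= d ->
  (\int[mu]_t (s / ((t - x) ^+ 2 + s ^+ 2) * `|g t - g x|)%:E <= e%:E)%E.
Proof.
move=> e0.
(* The near part is at most 10 e / 20, the far part at most e / 2. The dyadic radius between d / 2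
   and d separates the two. *)
have e20 : 0 < e / 20 by rewrite divr_gt0.
have [d d0 Hd] := lebesgue_pt_ball lx e20.
have d20 : 0 < d / 2 by rewrite divr_gt0.
have [C C0 HC] := poisson_far d20.
exists (Num.min (d / 2) (e / 2 / C)); first by rewrite lt_min d20 !divr_gt0.
move=> s s0; rewrite le_min => /andP[sd sC].
have [K /andP[K1 K2]] : exists n : nat, d / 2 <= 2 ^+ n * s < d.
  by apply: pow2_between => //; lra.
set r := 2 ^+ K * s in K1 K2.
have mB : measurable (ball x r : set mR) by exact: measurable_ball.
have mC : measurable (~` ball x r : set mR) by exact: measurableC.
rewrite -(setUv (ball x r)) ge0_int_setU//; [|exact: mS'|
  by move=> t; rewrite mulr_ge0// P_ge0|exact: setICr].
apply: (@le_trans _ _ ((e / 20 * (10 - 8 / 2 ^+ K))%:E + (s * C)%:E)%E).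
  apply: leeD; last exact: HC.
  exact: (poisson_near s0 e20 Hd).
rewrite -EFinD lee_fin.
have h1 : s * C <= e / 2 by rewrite -ler_pdivlMr.
have h2 : e / 20 * (10 - 8 / 2 ^+ K) <= e / 20 * 10.
  by rewrite ler_wpM2l ?(ltW e20)// lerBlDr lerDl divr_ge0// exprn_ge0.
lra.
Qed.

End AtPoint.
End PoissonLebesgue.

(** * Cauchy formula and boundary values in the half-plane *)

Section CauchyPoisson.
Variable R : realType.
Notation mu := (@lebesgue_measure R).
Local Notation mR := (measurableTypeR R).
Implicit Types (g : R -> R[i]).

Definition hker (a : R) (w : R[i]) : R -> R[i] := fun x => (x +i* a - w)^-1.

Lemma sqi_hker a w : im w != a -> sqi (hker a w) /\ l2 (hker a w) = pi / `|im w - a|.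
Proof.
move=> wa; rewrite (_ : hker a w = fun t => (t%:C - (re w +i* (im w - a)))^-1).
  by apply: sqi_ker; rewrite /= subr_eq0.
apply/funext => t; rewrite /hker; congr (_^-1).
by apply: complex_ext; rewrite ?reB ?imB/=; ring.
Qed.

(** The Poisson kernel of the half-plane, multiplied by pi. *)
Definition pker (x s : R) : R -> R := fun t => s / ((t - x) ^+ 2 + s ^+ 2).

(** Partial fractions: the two poles are x + i (y + s) and its mirror image in the line of height
    y. *)
Lemma pkerE x y s t : 0 < s ->
  2 * 'i * (pker x s t)%:C = hker y (x +i* (y + s)) t - hker y (x +i* (y - s)) t.
Proof.
move=> s0; have d0 := pdenom_gt0 x t s0.
have e1 : t +i* y - (x +i* (y + s)) = (t - x) +i* (- s).
  by apply: complex_ext; rewrite ?reB ?imB/=; ring.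
have e2 : t +i* y - (x +i* (y - s)) = (t - x) +i* s.
  by apply: complex_ext; rewrite ?reB ?imB/=; ring.
rewrite /hker e1 e2 /pker; apply: complex_ext;
  rewrite ?reB ?imB ?reV ?imV ?normc2 ?reM ?imM ?reM ?imM/= ?sqrrN; field; rewrite gt_eqF//.
Qed.

Lemma sqi_pker x s : 0 < s -> sqi (fun t => (pker x s t)%:C).
Proof.
move=> s0.
have h1 : im (x +i* (0 + s)) != 0 by rewrite /= add0r gt_eqF.
have h2 : im (x +i* (0 - s)) != 0 by rewrite /= sub0r oppr_eq0 gt_eqF.
have [k1 _] := sqi_hker h1; have [k2 _] := sqi_hker h2.
have [k3 _] := sqiZ ((2 * 'i)^-1) (sqiB k1 k2).1.
rewrite (_ : (fun t => _) = (fun x0 => (2 * 'i)^-1 *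
   (hker 0 (x +i* (0 + s)) x0 - hker 0 (x +i* (0 - s)) x0)))//.
apply/funext => t; rewrite -pkerE// mulKf// mulf_neq0 ?ic_neq0//.
Qed.

Lemma pker_integrable x s : 0 < s -> mu.-integrable setT (EFin \o pker x s) /\
  \int[mu]_t pker x s t = pi.
Proof.
move=> s0; have mp : measurable_fun (setT : set mR) (pker x s) by exact: measurable_poisson.
have ip : mu.-integrable setT (EFin \o pker x s).
  apply: ge0_integrable => //.
    by move=> t; rewrite divr_ge0 ?(ltW s0)// ltW// pdenom_gt0.
  by rewrite integral_poisson// ltry.
by split => //; rewrite /Rintegral integral_poisson.
Qed.

Lemma sqi_re g : sqi g -> measurable_fun (setT : set mR) (fun t => re (g t)) /\
  (\int[mu]_t (re (g t) ^+ 2)%:E < +oo)%E.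
Proof.
move=> sg; have mre := sg.1.1; split => //; apply: le_lt_trans sg.2.
apply: ge0_int_le => //.
- exact: measurable_funX.
- exact: measurable_normc2 sg.1.
- by move=> t _; rewrite sqr_ge0.
- by move=> t _; rewrite normc2 lerDl sqr_ge0.
Qed.

Lemma sqi_im g : sqi g -> measurable_fun (setT : set mR) (fun t => im (g t)) /\
  (\int[mu]_t (im (g t) ^+ 2)%:E < +oo)%E.
Proof.
move=> sg; have mim := sg.1.2; split => //; apply: le_lt_trans sg.2.
apply: ge0_int_le => //.
- exact: measurable_funX.
- exact: measurable_normc2 sg.1.
- by move=> t _; rewrite sqr_ge0.
- by move=> t _; rewrite normc2 lerDr sqr_ge0.
Qed.

Lemma poisson_real_approx (h : R -> R) x (e : R) : measurable_fun (setT : set mR) h ->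
  (\int[mu]_t (h t ^+ 2)%:E < +oo)%E -> lebesgue_pt h x -> 0 < e ->
  exists2 d : R, 0 < d & forall s, 0 < s -> s <= d ->
   mu.-integrable setT (EFin \o (fun t => pker x s t * h t)) ->
   `|\int[mu]_t (pker x s t * h t) - pi * h x| <= e.
Proof.
move=> mh ih lx e0; have [d d0 H] := poisson_lebesgue mh ih lx e0.
exists d => // s s0 sd hi; have [pi1 pi2] := pker_integrable x s0.
have E : \int[mu]_t (pker x s t * h t) - pi * h x =
    \int[mu]_t (1 * (pker x s t * h t) + (- h x) * pker x s t).
  by rewrite Rintegral_lin// pi2 mul1r mulNr mulrC.
have I := Rintegrable_lin 1 (- h x) measurableT hi pi1.
rewrite E; apply: le_trans (le_normr_Rintegral _ _) _ => //.
rewrite -lee_fin -integrable_EFin; last exact: (integrable_abse I).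
apply: le_trans (H s s0 sd); rewrite le_eqVlt; apply/orP; left; apply/eqP.
apply: eq_integral => t _; congr EFin.
have p0 : 0 <= pker x s t by rewrite divr_ge0 ?(ltW s0)// ltW// pdenom_gt0.
have -> : 1 * (pker x s t * h t) + - h x * pker x s t = pker x s t * (h t - h x) by ring.
by rewrite normrM ger0_norm.
Qed.

Lemma poisson_approx g x (e : R) : sqi g -> lebesgue_pt (fun t => re (g t)) x ->
  lebesgue_pt (fun t => im (g t)) x -> 0 < e ->
  exists2 d : R, 0 < d & forall s, 0 < s -> s <= d ->
   normc (cint setT (fun t => g t * (2 * 'i * (pker x s t)%:C)) -
          2 * 'i * pi%:C * g x) <= e.
Proof.
move=> sg l1 l2 e0; have e4 : 0 < e / 4 by rewrite divr_gt0.
have [m1 i1] := sqi_re sg; have [m2 i2] := sqi_im sg.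
have [d d0 H1] := poisson_real_approx m1 i1 l1 e4.
have [d' d'0 H2] := poisson_real_approx m2 i2 l2 e4.
exists (Num.min d d'); first by rewrite lt_min d0.
move=> s s0; rewrite le_min => /andP[sd sd'].
have ci : cintegrable setT (fun t => (pker x s t)%:C * g t).
  by apply: sqiM_int => //; exact: sqi_pker.
rewrite (_ : (fun t => g t * (2 * 'i * (pker x s t)%:C)) =
  (fun t => (2 * 'i) * ((pker x s t)%:C * g t))); last by apply/funext => t; ring.
rewrite cintZ// -[2 * 'i * pi%:C * g x]mulrA -mulrBr normcM_eq.
have -> : normc (2 * 'i) = 2 :> R.
  by rewrite normcM_eq normc_i mulr1 (_ : 2 = (2 : R)%:C) ?normc_real ?ger0_norm// rmorphMn.
have [c1 c2] := ci.
have hre t : re ((pker x s t)%:C * g t) = pker x s t * re (g t) by rewrite reM/=; ring.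
have him t : im ((pker x s t)%:C * g t) = pker x s t * im (g t) by rewrite imM/=; ring.
have {}H1 := H1 s s0 sd; have {}H2 := H2 s s0 sd'.
have {}H1 : `|\int[mu]_t (pker x s t * re (g t)) - pi * re (g x)| <= e / 4.
  by apply: H1; apply: eq_integrable c1 => // t _ /=; rewrite hre.
have {}H2 : `|\int[mu]_t (pker x s t * im (g t)) - pi * im (g x)| <= e / 4.
  by apply: H2; apply: eq_integrable c2 => // t _ /=; rewrite him.
have : normc (cint setT (fun t => (pker x s t)%:C * g t) - pi%:C * g x) <= e / 4 + e / 4.
  apply: le_trans (normc_le_reim _) _; rewrite reB imB reM imM/= !mul0r subr0 addr0.
  rewrite (_ : (fun t => re ((pker x s t)%:C * g t)) = (fun t => pker x s t * re (g t))).
    rewrite (_ : (fun t => im ((pker x s t)%:C * g t)) = (fun t => pker x s t * im (g t))).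
      exact: lerD.
    by apply/funext.
  by apply/funext.
lra.
Qed.

Lemma cont_at_lebesgue (h : R -> R) x : continuous h -> lebesgue_pt h x.
Proof.
move=> ch; apply: (@continuous_lebesgue_pt _ _ _ setT) => //.
- by split => //; exact: openT.
- by apply: continuous_measurable_fun.
- exact: ch.
Qed.

End CauchyPoisson.

(** * Cauchy integrals and L^2 norms on horizontal lines *)

Section HardyHorizontal.
Variable R : realType.
Notation mu := (@lebesgue_measure R).
Local Notation mR := (measurableTypeR R).
Variables (f : R[i] -> R[i]) (M : R).
Hypothesis fd : forall z, upper z -> exists l, cdiff f z l.
Hypothesis fM : forall y : R, 0 < y ->
  (\int[mu]_x ((normc (f (x +i* y)) ^+ 2)%:E) <= M%:E)%E.

Definition hline (h : R[i] -> R[i]) (y : R) : R -> R[i] := fun x => h (x +i* y).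

Let N (y : R) := l2 (hline f y).

Lemma hline_strip a b : 0 < a -> strip_diff f a b.
Proof. by move=> a0 x y /andP[ay _]; apply: fd; rewrite /upper/= (lt_le_trans a0). Qed.

Lemma sqi_hline y : 0 < y -> sqi (hline f y) /\ l2 (hline f y) <= M.
Proof.
move=> y0; apply: sqi_le; last exact: fM.
by apply: (@strip_cmeasurable _ _ y y); [exact: hline_strip|rewrite lexx].
Qed.

Lemma hline_M_ge0 : 0 <= M.
Proof. by have [_] := sqi_hline (@ltr01 R); apply: le_trans; exact: l2_ge0. Qed.

Definition cauchyT (h : R[i] -> R[i]) (a : R) (w : R[i]) : R[i] :=
  cint setT (fun x => hline h a x * hker a w x).

(** The integrand stays analytic while the line moves, since w lies outside the strip; the distance
    [D] from w to the strip bounds the kernel uniformly. *)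
Lemma cauchyT_const a b w : 0 < a -> a <= b -> im w < a \/ b < im w ->
  cauchyT f a w = cauchyT f b w.
Proof.
move=> a0 ab wab.
pose D := if im w < a then a - im w else im w - b.
have D0 : 0 < D.
  by rewrite /D; case: ifPn => h; rewrite subr_gt0//; case: wab h => [->|].
have hD y : a <= y <= b -> im w != y /\ D <= `|im w - y|.
  move=> /andP[ay yb]; rewrite /D; case: ifPn => [wa|nwa].
    have yw : im w < y by exact: lt_le_trans ay.
    by split; [rewrite lt_eqF|rewrite distrC ger0_norm ?subr_ge0 ?lerD2r// ltW].
  have bw : b < im w by case: wab nwa => [->|].
  have yw : y < im w by exact: le_lt_trans bw.
  split; first by rewrite gt_eqF.
  by rewrite ger0_norm ?subr_ge0 ?(ltW yw)// lerD2l lerN2.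
apply: (@cint_shift _ (fun z => f z * (z - w)^-1) a b (M + pi / D)) => //.
  move=> x y hy; have [l hl] := @hline_strip a b a0 x y hy.
  have [wy _] := hD y hy.
  have zw : x +i* y - w != 0.
    apply: contraNneq wy => /(congr1 (@complex.Im R)); rewrite imB/= => h.
    by rewrite eq_sym -subr_eq0 h.
  apply/derivable_cdiff; apply: derivableM_c; first by apply/derivable_cdiff; exists l.
  by apply: (@derivableV_c _ (fun z => z - w)); [exact: zw|exact: derivable_subr_c].
move=> y hy; have [wy Dy] := hD y hy.
have y0 : 0 < y by case/andP : hy => /(lt_le_trans a0).
have [sf lf] := sqi_hline y0; have [sk lk] := sqi_hker wy.
apply: le_trans (sqiM_bound sf sk) _; rewrite lee_fin lerD// lk.
by rewrite ler_wpM2l ?pi_ge0// lef_pV2 ?posrE ?normr_gt0 ?subr_eq0.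
Qed.

Lemma cauchyT_bound a w s : 0 < a -> im w != a -> 0 < s ->
  normc (cauchyT f a w) <= s * M + s^-1 * (pi / `|im w - a|).
Proof.
move=> a0 wa s0; have [sf lf] := sqi_hline a0; have [sk lk] := sqi_hker wa.
apply: le_trans (cintM_le sf sk s0) _; rewrite lk lerD2r ler_wpM2l//.
exact: ltW.
Qed.

(** The line can be moved up indefinitely without meeting w, and the L^2 norm of the kernel tends to
    zero as its distance to w grows. *)
Lemma cauchyT_below a w : 0 < a -> im w < a -> cauchyT f a w = 0.
Proof.
move=> a0 wa; apply/eqP; rewrite -normc_eq0 eq_le normc_ge0 andbT.
apply/ler_addgt0Pr => e e0; rewrite add0r.
have M0 := hline_M_ge0.
(* In the bound s M + pi / (s D), the choice of s settles the first term, and then the choice of D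
   the second one. *)
pose s := e / 2 / (M + 1); have s0 : 0 < s by rewrite !divr_gt0// ltr_wpDl.
pose D := Num.max (a - im w) (2 * pi / (s * e)).
have D0 : 0 < D by rewrite /D lt_max subr_gt0 wa.
have ab : a <= im w + D by rewrite -lerBlDl /D le_max lexx.
have bw : im w < im w + D by rewrite ltrDl.
rewrite (@cauchyT_const a (im w + D))//; last by left.
apply: le_trans (cauchyT_bound _ _ s0) _.
- exact: lt_le_trans ab.
- by rewrite lt_eqF.
rewrite opprD addrA subrr sub0r normrN gtr0_norm//.
have h1 : s * M <= e / 2.
  rewrite /s -[leRHS]mulr1 -mulrA ler_wpM2l ?divr_ge0 ?(ltW e0)//.
  by rewrite mulrC ler_pdivrMr ?mul1r ?lerDl// ltr_wpDl.
have h2 : s^-1 * (pi / D) <= e / 2.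
  rewrite mulrA ler_pdivrMr// mulrC ler_pdivrMr//.
  have : 2 * pi / (s * e) <= D by rewrite /D le_max lexx orbT.
  have se0 : 0 < s * e by exact: mulr_gt0.
  rewrite ler_pdivrMr// => h.
  have -> : e / 2 * D * s = D * (s * e) / 2 by clearbody D; clearbody s; ring.
  by rewrite ler_pdivlMr// [pi * 2]mulrC.
lra.
Qed.

(** The Cauchy integral at the mirror image x + i (y - s) vanishes by [cauchyT_below]; subtracting
    it turns the Cauchy kernel into the Poisson kernel. *)
Lemma cauchyT_poisson x y s : 0 < y -> 0 < s ->
  cauchyT f y (x +i* (y + s)) =
  cint setT (fun t => hline f y t * (2 * 'i * (pker x s t)%:C)).
Proof.
move=> y0 s0.
have h1 : im (x +i* (y + s)) != y by rewrite /= gt_eqF// ltrDl.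
have h2 : im (x +i* (y - s)) != y by rewrite /= lt_eqF// gtrBl.
have [sf _] := sqi_hline y0.
have [k1 _] := sqi_hker h1; have [k2 _] := sqi_hker h2.
have z : cauchyT f y (x +i* (y - s)) = 0 by apply: cauchyT_below => //=; rewrite gtrBl.
rewrite -[LHS]subr0 -z /cauchyT -cintB//; try exact: sqiM_int.
by apply: eq_cint => t _; rewrite (pkerE x y t s0); ring.
Qed.

Lemma hline_cont y x : 0 < y -> cont_at (hline f y) x.
Proof.
move=> y0; have [|l hl] := fd (z := x +i* y); first by [].
exact: cdiff_cont_at_h hl.
Qed.

(** By the resolvent identity the two kernels differ by i s times their product, which is at most s
    / (y - a) times the kernel at x + i y. *)
Lemma cauchyT_cont a x y (e : R) : 0 < a -> a < y -> 0 < e ->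
  exists2 d : R, 0 < d & forall s, 0 < s -> s <= d ->
  normc (cauchyT f a (x +i* (y + s)) - cauchyT f a (x +i* y)) <= e.
Proof.
move=> a0 ay e0; have M0 := hline_M_ge0.
pose r := y - a; have r0 : 0 < r by rewrite subr_gt0.
pose K := M + pi / r ^+ 3.
have K0 : 0 < K by rewrite ltr_wpDl// divr_gt0 ?pi_gt0// exprn_gt0.
exists (e / K); first by rewrite divr_gt0.
move=> s s0 sd; have [sf lf] := sqi_hline a0.
have h1 : im (x +i* (y + s)) != a by rewrite /= gt_eqF//; lra.
have h2 : im (x +i* y) != a by rewrite /= gt_eqF.
have [k1 _] := sqi_hker h1; have [k2 lk2] := sqi_hker h2.
have nz1 t : t +i* a - (x +i* (y + s)) != 0.
  apply/eqP => /(congr1 (@complex.Im R)); rewrite imB/= => /eqP; rewrite subr_eq0 lt_eqF//; lra.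
have nz2 t : t +i* a - (x +i* y) != 0.
  by apply/eqP => /(congr1 (@complex.Im R)); rewrite imB/= => /eqP; rewrite subr_eq0 lt_eqF.
have D t : hker a (x +i* (y + s)) t - hker a (x +i* y) t =
  'i * s%:C * hker a (x +i* (y + s)) t * hker a (x +i* y) t.
  have -> : 'i * s%:C = (t +i* a - (x +i* y)) - (t +i* a - (x +i* (y + s))).
    by apply: complex_ext; rewrite !(reB, imB, reM, imM)/=; ring.
  by rewrite /hker; field; rewrite nz1 nz2.
have [k3 _] := sqiB k1 k2.
have l3 : l2 (fun t => hker a (x +i* (y + s)) t - hker a (x +i* y) t) <= (s / r) ^+ 2 * (pi / r).
  have -> : pi / r = l2 (hker a (x +i* y)) by rewrite lk2/= gtr0_norm.
  rewrite -lee_fin -l2E// EFinM -l2E// -ge0_intZl//; last 3 first.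
  - exact: measurable_normc2 k2.1.
  - by move=> t; rewrite sqr_ge0.
  - by rewrite sqr_ge0.
  apply: ge0_int_le => //.
  - exact: measurable_normc2 k3.1.
  - by apply: measurable_cM; exact: measurable_normc2 k2.1.
  - by move=> t _; rewrite sqr_ge0.
  - move=> t _; rewrite D !normcM_eq normc_i mul1r normc_real gtr0_norm// exprMn.
    rewrite ler_wpM2r ?sqr_ge0// ler_pXn2r ?nnegrE ?mulr_ge0 ?normc_ge0 ?(ltW s0) ?invr_ge0 ?(ltW r0)//.
    rewrite ler_wpM2l ?(ltW s0)// /hker normcV_eq lef_pV2 ?posrE ?normc_gt0//.
    apply: le_trans (normc_im _); rewrite imB/= ler0_norm; rewrite /r; lra.
have -> : cauchyT f a (x +i* (y + s)) - cauchyT f a (x +i* y) =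
  cint setT (fun t => hline f a t * (hker a (x +i* (y + s)) t - hker a (x +i* y) t)).
  rewrite /cauchyT -cintB//; try exact: sqiM_int.
  by apply: eq_cint => t _; ring.
apply: le_trans (cintM_le sf k3 s0) _.
apply: (@le_trans _ _ (s * K)); last by rewrite -ler_pdivlMr.
rewrite /K mulrDr lerD ?ler_wpM2l ?(ltW s0)//.
apply: le_trans (ler_wpM2l _ l3) _; first by rewrite invr_ge0 ltW.
rewrite le_eqVlt; apply/orP; left; apply/eqP; field.
by rewrite (gt_eqF r0) (gt_eqF s0).
Qed.

(** No residue is computed. At the point w + i s, the integral over the line of height a equals the
    one over the line through w, which is a Poisson average of f; as s tends to zero it tends to the
    value at w because f is continuous on that line. *)
Theorem cauchyT_eq a w : 0 < a -> a < im w ->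
  cauchyT f a w = 2 * 'i * pi%:C * f w.
Proof.
case: w => x y a0 /= ay; have y0 : 0 < y by exact: lt_trans ay.
apply/eqP; rewrite -subr_eq0 -normc_eq0 eq_le normc_ge0 andbT.
apply/ler_addgt0Pr => e e0; rewrite add0r.
have e2 : 0 < e / 2 by rewrite divr_gt0.
have [d1 d10 H1] := cauchyT_cont x a0 ay e2.
have [sf _] := sqi_hline y0.
have c1 : continuous (fun t => re (hline f y t)) by move=> t; apply: cont_at_re; exact: hline_cont.
have c2 : continuous (fun t => im (hline f y t)) by move=> t; apply: cont_at_im; exact: hline_cont.
have [d2 d20 H2] := poisson_approx sf (@cont_at_lebesgue _ _ x c1) (@cont_at_lebesgue _ _ x c2) e2.
pose s := Num.min d1 d2.
have s0 : 0 < s by rewrite lt_min d10.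
have s1 : s <= d1 by rewrite ge_min lexx.
have s2 : s <= d2 by rewrite ge_min lexx orbT.
have {}H1 := H1 s s0 s1; have {}H2 := H2 s s0 s2.
rewrite -cauchyT_poisson// in H2.
rewrite -(@cauchyT_const a y _ a0 (ltW ay)) in H2; last by right => /=; rewrite ltrDl.
have -> : cauchyT f a (x +i* y) - 2 * 'i * pi%:C * f (x +i* y) =
  (cauchyT f a (x +i* (y + s)) - 2 * 'i * pi%:C * hline f y x) -
  (cauchyT f a (x +i* (y + s)) - cauchyT f a (x +i* y)) by rewrite /hline; ring.
apply: le_trans (normcB_le _ _) _; lra.
Qed.

(** The product [g] of f and its reflection in the line of height (a + b) / 2 is analytic. At height
    a it is the integrand on the left, at the middle height it is |f|^2, and the integral does not
    depend on the height. *)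
Lemma hline_inner_le a b : 0 < a -> a <= b ->
  cint setT (fun t => hline f a t * Num.conj (hline f b t)) = (N ((a + b) / 2))%:C.
Proof.
move=> a0 ab; pose m := (a + b) / 2; pose c := a + b.
have am : a <= m by rewrite /m; lra.
pose g z := f z * Num.conj (f (Num.conj z + 'i * c%:C)).
have gE x y : g (x +i* y) = hline f y x * Num.conj (hline f (c - y) x).
  rewrite /g /hline; congr (_ * Num.conj (f _)).
  by apply: complex_ext; rewrite !(reD, imD, reM, imM, reJ, imJ)/=; ring.
have := @cint_shift _ g a m (2 * M) am.
have E1 : (fun x => g (x +i* a)) = (fun t => hline f a t * Num.conj (hline f b t)).
  by apply/funext => t; rewrite gE /c addrAC subrr add0r.
have E2 : (fun x => g (x +i* m)) = (fun t => hline f m t * Num.conj (hline f m t)).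
  by apply/funext => t; rewrite gE (_ : c - m = m)// /c /m; field.
rewrite E1 E2 => ->.
- by rewrite cint_l2//; apply: (sqi_hline _).1; lra.
- move=> x y hy; have [l hl] := @hline_strip a m a0 x y hy.
  have [|l' hl'] := fd (z := Num.conj (x +i* y) + 'i * c%:C).
    by rewrite /upper imD imM imJ/= /c; move: hy; rewrite /m => /andP[? ?]; lra.
  apply/derivable_cdiff/derivableM_c; apply/derivable_cdiff; first by exists l.
  by eexists; exact: cdiff_conj hl'.
- move=> y /andP[ay ym].
  have [s1 l1] : sqi (hline f y) /\ l2 (hline f y) <= M by apply: sqi_hline; lra.
  have [s2 l2'] : sqi (hline f (c - y)) /\ l2 (hline f (c - y)) <= M.
    by apply: sqi_hline; rewrite /c; move: ym; rewrite /m; lra.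
  have [s3 l3] := sqi_conj s2.
  rewrite (_ : (fun x => _) = (fun x => (normc (hline f y x * Num.conj (hline f (c - y) x)))%:E)).
    by apply: le_trans (sqiM_bound s1 s3) _; rewrite lee_fin l3; lra.
  by apply/funext => x; rewrite gE.
Qed.

Lemma hline_inner a b : 0 < a -> 0 < b ->
  cint setT (fun t => hline f a t * Num.conj (hline f b t)) = (N ((a + b) / 2))%:C.
Proof.
move=> a0 b0; have [ab|/ltW ba] := leP a b; first exact: hline_inner_le.
have [sa _] := sqi_hline a0; have [sb _] := sqi_hline b0.
rewrite (_ : (fun t => _) = (fun t => Num.conj (hline f b t * Num.conj (hline f a t)))).
  rewrite cint_conj//; last exact: sqi_integrable_mul.
  by rewrite hline_inner_le// conjc_realc addrC.
by apply/funext => t; rewrite cjM conjK mulrC.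
Qed.

Lemma hline_dist a b : 0 < a -> 0 < b ->
  l2 (fun t => hline f a t - hline f b t) = N a + N b - 2 * N ((a + b) / 2).
Proof.
move=> a0 b0; have [sa _] := sqi_hline a0; have [sb _] := sqi_hline b0.
apply: complexI; rewrite l2B// !hline_inner// [b + a]addrC.
by apply: complex_ext; rewrite !(reB, imB, reD, imD)/=; rewrite /N; ring.
Qed.

(** By [hline_dist] the squared norms are midpoint convex in the height. If they increased once,
    they would grow at least linearly and exceed M. *)
Lemma hline_decr a b : 0 < a -> a <= b -> N b <= N a.
Proof.
move=> a0; rewrite le_eqVlt => /predU1P[->//|ab]; rewrite leNgt; apply/negP => Nab.
pose d := b - a; have d0 : 0 < d by rewrite subr_gt0.
pose e := N b - N a; have e0 : 0 < e by rewrite subr_gt0.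
(* Along the heights a + n d, convexity keeps every increment at least as large as the first one,
   e. *)
have st n : N a + n%:R * e <= N (a + n%:R * d) /\
    N (a + n%:R * d) + e <= N (a + n.+1%:R * d).
  elim: n => [|n [ih1 ih2]].
    by rewrite !mul0r !addr0 mul1r /d addrC subrK /e addrC subrK.
  have En : n.+1%:R = n%:R + 1 :> R by rewrite -natr1.
  split; first by rewrite {1}En mulrDl mul1r; lra.
  have h0 : 0 < a + n%:R * d by rewrite ltr_pwDl// mulr_ge0// ltW.
  have h2 : 0 < a + n.+2%:R * d by rewrite ltr_pwDl// mulr_ge0// ltW.
  have := hline_dist h0 h2; have := l2_ge0 (fun t => hline f (a + n%:R * d) t - hline f (a + n.+2%:R * d) t).
  have -> : (a + n%:R * d + (a + n.+2%:R * d)) / 2 = a + n.+1%:R * d.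
    by rewrite -!natr1; field.
  lra.
pose n := (Num.truncn (M / e)).+1.
have [h _] := st n; have h1 : M / e < n%:R by exact: truncnS_gt.
rewrite ltr_pdivrMr// in h1.
have h2 : 0 < a + n%:R * d by rewrite ltr_pwDl// mulr_ge0// ltW.
have [_] := sqi_hline h2; rewrite -/(N _).
have := l2_ge0 (hline f a); rewrite -/(N a); lra.
Qed.

(** The squared norms increase to their supremum as the height decreases to zero, so near zero all
    values in [hline_dist] lie within e / 2 of it. *)
Lemma hline_cauchy (e : R) : 0 < e -> exists2 d : R, 0 < d & forall a b,
  0 < a -> a <= d -> 0 < b -> b <= d ->
  l2 (fun t => hline f a t - hline f b t) <= e.
Proof.
move=> e0.
pose S := [set N y | y in [set y : R | 0 < y]].
have hS : has_sup S.
  split; first by exists (N 1); exists 1 => //=; exact: ltr01.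
  by exists M => _ [y /= y0 <-]; exact: (sqi_hline y0).2.
have e2 : 0 < e / 2 by rewrite divr_gt0.
have [_ [y0 /= y00 <-] hy] := sup_adherent e2 hS.
exists y0 => // a b a0 ad b0 bd; rewrite hline_dist//.
have ub y : 0 < y -> N y <= sup S.
  by move=> yp; apply: ub_le_sup; [case: hS|exists y].
have lb y : 0 < y -> y <= y0 -> sup S - e / 2 <= N y.
  by move=> yp yy; apply: (le_trans (ltW hy)); exact: hline_decr.
have := ub a a0; have := ub b b0; have := lb ((a + b) / 2).
have : 0 < (a + b) / 2 by lra.
have : (a + b) / 2 <= y0 by lra.
by move=> h1 h2 /(_ h2 h1); lra.
Qed.

End HardyHorizontal.

Section RealLimits.
Variable R : realType.

Lemma ae_imp (P Q : R -> Prop) : (forall x, P x -> Q x) ->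
  {ae @lebesgue_measure R, forall x, P x} -> {ae @lebesgue_measure R, forall x, Q x}.
Proof. by move=> h; apply: (@filterS _ _ (ae_filter_ringOfSetsType (@lebesgue_measure R))). Qed.

Lemma ae_and (P Q : R -> Prop) : {ae @lebesgue_measure R, forall x, P x} ->
  {ae @lebesgue_measure R, forall x, Q x} -> {ae @lebesgue_measure R, forall x, P x /\ Q x}.
Proof. exact: (@filterI _ _ (ae_filter_ringOfSetsType (@lebesgue_measure R))). Qed.

Lemma cvg_geometric_steps (u : nat -> R) (C : R) : 0 <= C ->
  (forall k, `|u k.+1 - u k| <= C * (1 / 2) ^+ k) -> cvgn u.
Proof.
move=> C0 h.
have h2 : `|1 / 2| < 1 :> R by rewrite ger0_norm//; lra.
have cs : cvgn (series (telescope u)).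
  apply: normed_cvg; apply: (@series_le_cvg _ _ (geometric C (1 / 2))).
  - by move=> n /=.
  - by move=> n /=; rewrite mulr_ge0// exprn_ge0.
  - by move=> n /=; exact: h.
  - exact: is_cvg_geometric_series.
rewrite telescopeK in cs.
have -> : u = (fun n => (u n - u 0%N) + u 0%N) by apply/funext => n; rewrite subrK.
by apply: is_cvgD => //; exact: is_cvg_cst.
Qed.

Lemma limn_einf_le (v : nat -> \bar R) (e : \bar R) : (forall k, (v k <= e)%E) ->
  (limn_einf v <= e)%E.
Proof.
move=> h; rewrite limn_einf_lim; apply: lime_le; first exact: is_cvg_einfs.
apply: nearW => n; apply: ge_ereal_inf; exists (v n) => //=; by exists n => /=.
Qed.

End RealLimits.

(** * The boundary function as an L^2 limit *)

Section BoundaryLimit.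
Variable R : realType.
Notation mu := (@lebesgue_measure R).
Local Notation mR := (measurableTypeR R).
Variables (f : R[i] -> R[i]) (M : R).
Hypothesis fd : forall z, upper z -> exists l, cdiff f z l.
Hypothesis fM : forall y : R, 0 < y ->
  (\int[mu]_x ((normc (f (x +i* y)) ^+ 2)%:E) <= M%:E)%E.

(** The rate 1 / 16 leaves room for the weight 4^k in [boundary_limit]. *)
Lemma hline_seq : exists y : nat -> R, (forall k, 0 < y k) /\
  forall k a, 0 < a -> a <= y k -> forall n, (k <= n)%N ->
    l2 (fun t => hline f a t - hline f (y n) t) <= (1 / 16) ^+ k.
Proof.
pose P (k : nat) (d : R) := 0 < d /\ forall a b,
    0 < a -> a <= d -> 0 < b -> b <= d ->
    l2 (fun t => hline f a t - hline f b t) <= (1 / 16) ^+ k.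
have exP k : exists d, P k d.
  have [|d d0 H] := hline_cauchy fd fM (e := (1 / 16) ^+ k).
    by rewrite exprn_gt0//; lra.
  by exists d.
have [D HD] := choice exP.
pose y := fix y (k : nat) := if k is k'.+1 then Num.min (y k') (D k) else D 0%N.
have y0 k : 0 < y k.
  by elim: k => [|k ih] /=; [case: (HD 0%N)|rewrite lt_min ih; case: (HD k.+1)].
have yD k : y k <= D k by case: k => [|k] //=; rewrite ge_min lexx orbT.
have yS k n : (k <= n)%N -> y n <= y k.
  move=> /subnK <-; elim: (n - k)%N => //= m ih.
  by rewrite ge_min ih.
exists y; split => // k a a0 ak n kn; apply: (HD k).2 => //.
  exact: le_trans ak (yD k).
exact: le_trans (yS _ _ kn) (yD k).
Qed.

(** The Riesz-Fischer argument: along rapidly chosen heights the weighted squares of successive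
    differences have an integrable sum, so almost everywhere the differences decay geometrically;
    Fatou's lemma turns the pointwise limit into a limit in L^2. *)
Lemma boundary_limit : exists f0 : R -> R[i], sqi f0 /\
  forall e : R, 0 < e -> exists2 d : R, 0 < d & forall a, 0 < a -> a <= d ->
    l2 (fun t => hline f a t - f0 t) <= e.
Proof.
have [y [y0 Hy]] := hline_seq.
have sy k : sqi (hline f (y k)) by exact: (sqi_hline fd fM (y0 k)).1.
have sd k : sqi (fun t => hline f (y k) t - hline f (y k.+1) t) by exact: (sqiB _ _).1.
pose d k t := normc (hline f (y k) t - hline f (y k.+1) t) ^+ 2.
have md k : measurable_fun (setT : set mR) (d k) by exact: measurable_normc2 (sd k).1.
have d0 k t : 0 <= d k t by exact: sqr_ge0.
(* The weight serves two ends: the integrals, at most 4^k 16^-k, stay summable, and a bound on 4^k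
   d_k makes the k-th difference of order 2^-k. *)
pose h (k : nat) (t : R) : \bar R := (4 ^+ k * d k t)%:E.
have mh k : measurable_fun (setT : set mR) (h k).
  by apply/measurable_EFinP; exact: measurable_cM.
have h0 k t : (0 <= h k t)%E by rewrite lee_fin mulr_ge0// ?sqr_ge0// exprn_ge0.
pose S t := (\sum_(0 <= k <oo) h k t)%E.
have mS : measurable_fun (setT : set mR) S.
  by apply: ge0_emeasurable_sum => // k t _ _; exact: h0.
have S0 t : (0 <= S t)%E by apply: nneseries_ge0 => k _ _; exact: h0.
have Si : mu.-integrable setT S.
  apply/integrableP; split => //.
  under eq_integral => t _ do rewrite gee0_abs//.
  rewrite integral_nneseries//.
  have gs := @cvg_geometric_eseries_half R 2 0.
  apply: (@le_lt_trans _ _ (\sum_(0 <= k <oo) (2 / (2 ^ (k + 1))%:R)%:E)%E).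
    apply: lee_nneseries => [k *|k _]; first exact: integral_ge0.
    rewrite ge0_intZl ?exprn_ge0//.
    rewrite l2E// -EFinM lee_fin.
    apply: (@le_trans _ _ (4 ^+ k * (1 / 16) ^+ k)).
      rewrite ler_wpM2l ?exprn_ge0//.
      by apply: Hy.
    have -> : 2 / (2 ^ (k + 1))%:R = (1 / 2) ^+ k :> R.
      by rewrite natrX addn1 exprS invfM mulrA mulfV// mul1r div1r exprVn.
    by rewrite -exprMn lerXn2r ?nnegrE//; lra.
  by rewrite (cvg_lim _ gs)// ltry.
have good : \forall t \ae mu, exists2 C : R, 0 <= C & forall k, 4 ^+ k * d k t <= C.
  have := integrable_ae measurableT Si; apply: filterS => t /(_ I) St.
  have cs : cvgn (series (fun k => 4 ^+ k * d k t)).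
    apply: nnseries_is_cvg => [k|]; first by apply: mulr_ge0; [exact: exprn_ge0|exact: d0].
    by rewrite -ge0_fin_numE//; exact: S0.
  have [A [_ HA]] := cvg_series_bounded cs.
  exists (`|A| + 1); first by rewrite addr_ge0.
  move=> k; apply: le_trans (ler_norm _) _; apply: HA => //.
  by have := ler_norm A; lra.
pose u k t := re (hline f (y k) t); pose v k t := im (hline f (y k) t).
have mu_ k : measurable_fun (setT : set mR) (u k) by exact: (sy k).1.1.
have mv_ k : measurable_fun (setT : set mR) (v k) by exact: (sy k).1.2.
(* Upper limits are measurable without any assumption on t, and they agree with the limit wherever
   there is one. *)
pose f0 t := fine (limn_esup (fun k => (u k t)%:E)) +i* fine (limn_esup (fun k => (v k t)%:E)).
have mf0 : cmeasurable (setT : set mR) f0.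
  split.
    apply: (measurableT_comp (fine_measurable measurableT)).
    by apply: measurable_fun_limn_esup => k; apply/measurable_EFinP.
  apply: (measurableT_comp (fine_measurable measurableT)).
  by apply: measurable_fun_limn_esup => k; apply/measurable_EFinP.
have conv : \forall t \ae mu, (u k t @[k --> \oo] --> re (f0 t)) /\ (v k t @[k --> \oo] --> im (f0 t)).
  apply: ae_imp good => t H.
  have [C C0 HC] := H.
  have HC' k : normc (hline f (y k) t - hline f (y k.+1) t) <= (1 + C) * (1 / 2) ^+ k.
    rewrite -(@ler_pXn2r _ 2) ?nnegrE ?normc_ge0 ?mulr_ge0 ?exprn_ge0 ?addr_ge0//.
    have := HC k; rewrite -ler_pdivlMl ?exprn_gt0// => hk.
    apply: le_trans hk _; rewrite exprMn -exprM mulnC exprM mulrC.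
    have -> : (1 / 2 : R) ^+ 2 = 4^-1 by field.
    rewrite exprVn ler_wpM2r ?invr_ge0 ?exprn_ge0//.
    by rewrite sqrrD expr1n mul1r; have := sqr_ge0 C; lra.
  have C1 : 0 <= 1 + C by rewrite addr_ge0.
  have cu : cvgn (fun k => u k t).
    apply: (cvg_geometric_steps C1) => k; apply: le_trans (HC' k).
    by rewrite /u -reB; apply: le_trans (normc_re _) _; rewrite normc_distC.
  have cv : cvgn (fun k => v k t).
    apply: (cvg_geometric_steps C1) => k; apply: le_trans (HC' k).
    by rewrite /v -imB; apply: le_trans (normc_im _) _; rewrite normc_distC.
  have key (w : nat -> R) : cvgn w -> w k @[k --> \oo] --> fine (limn_esup (fun k => (w k)%:E)).
    move=> cw; have : (w k)%:E @[k --> \oo] --> (limn w)%:E by apply/fine_cvgP; split; [exact: nearW|exact: cw].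
    by move=> /cvg_limn_einf_sup[_ ->].
  by split; exact: key.
have dist K a : 0 < a -> a <= y K ->
    (\int[mu]_t (normc (hline f a t - f0 t) ^+ 2)%:E <= ((1 / 16) ^+ K)%:E)%E.
  move=> a0 aK; have sa : sqi (hline f a) by exact: (sqi_hline fd fM a0).1.
  pose g n (t : mR) : \bar R := (normc (hline f a t - hline f (y (n + K)%N) t) ^+ 2)%:E.
  have mg n : measurable_fun (setT : set mR) (g n).
    by apply/measurable_EFinP; exact: (measurable_normc2 (sqiB sa (sy _)).1.1).
  have mf0' : cmeasurable (setT : set mR) (fun t => hline f a t - f0 t).
    have := cmeasurableD sa.1 (cmeasurableZ (-1) mf0).
    by rewrite (_ : (fun x => _) = (fun t => hline f a t - f0 t))//; apply/funext => t; rewrite mulN1r.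
  apply: (@le_trans _ _ (\int[mu]_t limn_einf (g^~ t))%E).
    rewrite le_eqVlt; apply/orP; left; apply/eqP; apply: ge0_ae_eq_integral => //.
    - by apply/measurable_EFinP; exact: measurable_normc2 mf0'.
    - rewrite /limn_einf; apply: measurableT_comp => //.
      by apply: measurable_fun_limn_esup => n; exact: measurableT_comp.
    - by move=> t _; rewrite lee_fin sqr_ge0.
    - move=> t _; rewrite limn_einf_lim; apply: lime_ge; first exact: is_cvg_einfs.
      by apply: nearW => n; apply: le_ereal_inf_tmp => _ [m _ <-]; rewrite lee_fin sqr_ge0.
    - apply: ae_imp conv => t [c1 c2] _.
      have cg : g n t @[n --> \oo] --> (normc (hline f a t - f0 t) ^+ 2)%:E.
        apply/fine_cvgP; split; first exact: nearW.
        rewrite normc2 reB imB.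
        rewrite (_ : fine \o g^~ t = fun n => (re (hline f a t) - u (n + K)%N t) * (re (hline f a t) - u (n + K)%N t) +
           (im (hline f a t) - v (n + K)%N t) * (im (hline f a t) - v (n + K)%N t)); last first.
          by apply/funext => n; rewrite /g /= normc2 reB imB.
        have e1 : u (n + K)%N t @[n --> \oo] --> re (f0 t) by rewrite (cvg_shiftn K (fun n => u n t)).
        have e2 : v (n + K)%N t @[n --> \oo] --> im (f0 t) by rewrite (cvg_shiftn K (fun n => v n t)).
        have e3 : re (hline f a t) - u (n + K)%N t @[n --> \oo] --> re (hline f a t) - re (f0 t).
          by apply: cvgB => //; exact: cvg_cst.
        have e4 : im (hline f a t) - v (n + K)%N t @[n --> \oo] --> im (hline f a t) - im (f0 t).
          by apply: cvgB => //; exact: cvg_cst.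
        exact: cvgD (cvgM e3 e3) (cvgM e4 e4).
      by have [-> _] := cvg_limn_einf_sup cg.
  apply: le_trans (fatou mu measurableT mg _) _; first by move=> n t _; rewrite lee_fin sqr_ge0.
  apply: limn_einf_le => n; rewrite l2E ?lee_fin; last exact: (sqiB sa (sy _)).1.
  by apply: Hy => //; exact: leq_addl.
have mB a : 0 < a -> cmeasurable (setT : set mR) (fun t => hline f a t - f0 t).
  move=> a0; have sa : sqi (hline f a) by exact: (sqi_hline fd fM a0).1.
  have := cmeasurableD sa.1 (cmeasurableZ (-1) mf0).
  by rewrite (_ : (fun x => _) = (fun t => hline f a t - f0 t))//; apply/funext => t; rewrite mulN1r.
exists f0; split.
  have [s1 _] := sqi_le (mB _ (y0 0%N)) (dist 0%N _ (y0 0%N) (lexx _)).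
  have := (sqiB (sy 0%N) s1).1; rewrite (_ : (fun x => _) = f0)//.
  by apply/funext => t; rewrite opprB addrC subrK.
(* 1 / e < K < 2^K < 16^K. *)
move=> e e0; pose K := (Num.truncn e^-1).+1.
exists (y K) => // a a0 aK; have [_ h1] := sqi_le (mB _ a0) (dist K _ a0 aK).
apply: le_trans h1 _; rewrite div1r exprVn -[e]invrK lef_pV2 ?posrE ?exprn_gt0 ?invr_gt0//.
apply: le_trans (ltW (truncnS_gt _)) _; rewrite -/K -natrX ler_nat ltnW// (@ltn_trans (2 ^ K))//.
  exact: ltn_expl.
by rewrite ltn_exp2r.
Qed.

End BoundaryLimit.

(** * Cauchy and Poisson formulas on the real line, and vertical limits *)

Section BoundaryFormulas.
Variable R : realType.
Notation mu := (@lebesgue_measure R).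
Local Notation mR := (measurableTypeR R).
Variables (f : R[i] -> R[i]) (M : R) (f0 : R -> R[i]).
Hypothesis fd : forall z, upper z -> exists l, cdiff f z l.
Hypothesis fM : forall y : R, 0 < y ->
  (\int[mu]_x ((normc (f (x +i* y)) ^+ 2)%:E) <= M%:E)%E.
Hypothesis sf0 : sqi f0.
Hypothesis f0_lim : forall e : R, 0 < e -> exists2 d : R, 0 < d & forall a, 0 < a -> a <= d ->
    l2 (fun t => hline f a t - f0 t) <= e.

Lemma hker_shift (a : R) (w : R[i]) : hker a (w + 'i * a%:C) = hker 0 w.
Proof.
apply/funext => t; rewrite /hker; congr (_^-1).
by apply: complex_ext; rewrite !(reD, imD, reN, imN, reM, imM)/=; ring.
Qed.

Lemma bdry_mul_lim (k : R -> R[i]) (e : R) : sqi k -> 0 < e ->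
  exists2 d : R, 0 < d & forall a, 0 < a -> a <= d ->
   normc (cint setT (fun t => hline f a t * k t) - cint setT (fun t => f0 t * k t)) <= e.
Proof.
move=> sk e0; pose s := 2 * (l2 k + 1) / e.
have k1 : 0 < l2 k + 1 by rewrite ltr_wpDl// l2_ge0.
have s0 : 0 < s by rewrite divr_gt0// mulr_gt0.
have es : 0 < e / 2 / s by apply: divr_gt0 => //; exact: divr_gt0.
have [d d0 H] := f0_lim es.
exists d => // a a0 ad.
have [sa _] := sqi_hline fd fM a0.
have [sB _] := sqiB sa sf0.
rewrite -cintB//; try exact: sqiM_int.
have -> : cint setT (fun t => hline f a t * k t - f0 t * k t) =
   cint setT (fun t => (hline f a t - f0 t) * k t).
  by apply: eq_cint => t _; ring.
apply: le_trans (cintM_le sB sk s0) _.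
have h1 : s * l2 (fun x => hline f a x - f0 x) <= e / 2.
  by rewrite mulrC -ler_pdivlMr//; exact: H.
have h2 : s^-1 * l2 k <= e / 2.
  rewrite mulrC ler_pdivrMr// /s.
  have -> : e / 2 * (2 * (l2 k + 1) / e) = l2 k + 1 by field; rewrite gt_eqF.
  by rewrite lerDl.
lra.
Qed.

(** Lifting the line and the point together by a leaves the kernel unchanged, so the integral at
    height a is 2 i pi f (w + i a); both sides converge as a tends to zero. *)
Lemma bdry_cauchy w : 0 < im w ->
  cint setT (fun t => f0 t * hker 0 w t) = 2 * 'i * pi%:C * f w.
Proof.
move=> w0; apply/eqP; rewrite -subr_eq0 -normc_eq0 eq_le normc_ge0 andbT.
apply/ler_addgt0Pr => e e0; rewrite add0r.
have e2 : 0 < e / 2 by rewrite divr_gt0.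
have sk : sqi (hker 0 w) by apply: (sqi_hker _).1; rewrite gt_eqF.
have [d d0 H] := bdry_mul_lim sk e2.
have [l hl] := fd w0.
pose K := normc (2 * 'i * pi%:C : R[i]) + 1.
have K0 : 0 < K by rewrite ltr_wpDl// normc_ge0.
have [d' d'0 H'] := cdiff_cont hl (divr_gt0 e2 K0).
pose a := Num.min d d'.
have a0 : 0 < a by rewrite lt_min d0.
have ad : a <= d by rewrite ge_min lexx.
have ad' : a <= d' by rewrite ge_min lexx orbT.
have {}H := H a a0 ad.
have {}H' := H' ('i * a%:C); rewrite normcM_eq normc_i mul1r normc_real gtr0_norm// in H'.
have {}H' := H' ad'.
have E : cint setT (fun t => hline f a t * hker 0 w t) = 2 * 'i * pi%:C * f (w + 'i * a%:C).
  rewrite -(hker_shift a) -/(cauchyT f a _) (cauchyT_eq fd fM)//.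
  by rewrite imD imM/= mul0r add0r mul1r ltrDr.
rewrite E in H.
set I := cint _ _ in H *.
have -> : I - 2 * 'i * pi%:C * f w = 2 * 'i * pi%:C * (f (w + 'i * a%:C) - f w) -
  (2 * 'i * pi%:C * f (w + 'i * a%:C) - I) by ring.
apply: le_trans (normcB_le _ _) _; rewrite normcM_eq.
have : normc (2 * 'i * pi%:C) * normc (f (w + 'i * a%:C) - f w) <= K * (e / 2 / K).
  by rewrite ler_pM ?normc_ge0// lerDl.
rewrite mulrC [K * _]mulrC divfK ?gt_eqF//; lra.
Qed.

Lemma bdry_cauchy_below w : im w < 0 ->
  cint setT (fun t => f0 t * hker 0 w t) = 0.
Proof.
move=> w0; apply/eqP; rewrite -normc_eq0 eq_le normc_ge0 andbT.
apply/ler_addgt0Pr => e e0; rewrite add0r.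
have sk : sqi (hker 0 w) by apply: (sqi_hker _).1; rewrite lt_eqF.
have [d d0 H] := bdry_mul_lim sk e0.
have {}H := H d d0 (lexx _).
rewrite -{1}(hker_shift d) -/(cauchyT f d _) (cauchyT_below fd fM)// in H.
  by rewrite sub0r normc_opp in H.
by rewrite imD imM/= mul0r add0r mul1r gtrDr.
Qed.

Lemma bdry_poisson x s : 0 < s ->
  cint setT (fun t => f0 t * (2 * 'i * (pker x s t)%:C)) = 2 * 'i * pi%:C * f (x +i* s).
Proof.
move=> s0.
have k1 : sqi (hker 0 (x +i* (0 + s))) by apply: (sqi_hker _).1; rewrite /= add0r gt_eqF.
have k2 : sqi (hker 0 (x +i* (0 - s))) by apply: (sqi_hker _).1; rewrite /= sub0r lt_eqF// oppr_lt0.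
have -> : (fun t => f0 t * (2 * 'i * (pker x s t)%:C)) = (fun t =>
   f0 t * hker 0 (x +i* (0 + s)) t - f0 t * hker 0 (x +i* (0 - s)) t).
  by apply/funext => t; rewrite (pkerE x 0 t s0) mulrBr.
rewrite cintB//; try exact: sqiM_int.
rewrite bdry_cauchy ?bdry_cauchy_below/= ?sub0r ?add0r ?oppr_lt0//.
by rewrite subr0.
Qed.

Lemma sq_locally_integrable (h : R -> R) : measurable_fun (setT : set mR) h ->
  (\int[mu]_t (h t ^+ 2)%:E < +oo)%E -> locally_integrable setT h.
Proof.
move=> mh ih; split => //; first exact: openT.
move=> K _ cK; have mK : measurable (K : set mR) by exact: compact_measurable.
have muK : (mu K < +oo)%E by exact: compact_finite_measure.
apply: (@le_lt_trans _ _ (\int[mu]_(t in K) (h t ^+ 2 + 1)%:E)%E).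
  apply: ge0_int_le => //.
  - exact: measurableT_comp.
  - apply: measurable_funD; [exact: measurable_funX|exact: measurable_cst].
  - move=> t _; rewrite -[h t ^+ 2]real_normK ?num_real//.
    have := sqr_ge0 (`|h t| - 2^-1); rewrite !expr2; lra.
rewrite ge0_intD//.
- rewrite lte_add_pinfty//.
    apply: le_lt_trans ih; apply: ge0_int_subset => //; first exact: measurable_funX.
    by move=> t; exact: sqr_ge0.
  by rewrite integral_cst// mul1e.
- exact: measurable_funX.
- by move=> t; exact: sqr_ge0.
Qed.

(** Fatou's theorem: f is the Poisson integral of f0, and almost every point is a Lebesgue point of
    both the real and the imaginary part of f0. *)
Lemma bdry_ae : {ae mu, forall x, forall e : R, 0 < e -> exists2 d : R, 0 < d &
  forall s, 0 < s -> s <= d -> normc (f (x +i* s) - f0 x) <= e}.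
Proof.
have [m1 i1] := sqi_re sf0; have [m2 i2] := sqi_im sf0.
have leb1 := lebesgue_differentiation (sq_locally_integrable m1 i1).
have leb2 := lebesgue_differentiation (sq_locally_integrable m2 i2).
apply: ae_imp (ae_and leb1 leb2) => x [p1 p2] e e0.
have pp : 0 < 2 * pi :> R by rewrite mulr_gt0// pi_gt0.
have nE : normc (2 * 'i * pi%:C : R[i]) = 2 * pi.
  rewrite !normcM_eq normc_i mulr1 normc_real gtr0_norm ?pi_gt0//.
  by rewrite (_ : 2 = (2 : R)%:C) ?normc_real ?ger0_norm// rmorphMn.
have ep : 0 < e * (2 * pi) by rewrite mulr_gt0.
have [d d0 H] := poisson_approx sf0 p1 p2 ep.
exists d => // s s0 sd; have := H s s0 sd.
by rewrite bdry_poisson// -mulrBr normcM_eq nE mulrC ler_pM2r.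
Qed.

End BoundaryFormulas.

Import HBNNSimple.

(** * The Hardy space *)

Section AlmostEverywhere.
Variable R : realType.
Notation mu := (@lebesgue_measure R).
Local Notation mR := (measurableTypeR R).

(* The library's a.e. congruence for integrals requires measurability, which is
   not available for [boundary_value]; the null set is removed from the simple
   functions in the definition of the integral instead. *)
Lemma nnintegral_ae_le (f g : mR -> \bar R) : (forall x, (0 <= g x)%E) ->
  {ae mu, forall x, f x = g x} ->
  (ereal_sup [set sintegral mu h | h in
      [set h : {nnsfun mR >-> R} | forall x, ((h x)%:E <= f x)%E]] <=
   ereal_sup [set sintegral mu h | h in
      [set h : {nnsfun mR >-> R} | forall x, ((h x)%:E <= g x)%E]])%E.
Proof.
move=> g0 [N [mN N0 HN]]; apply: ge_ereal_sup => _ [h /= hf <-].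
have mC : measurable (~` N) by exact: measurableC.
pose h' := proj_nnsfun h mC.
have h'E x : h' x = h x * \1_(~` N) x by [].
have -> : sintegral mu h = sintegral mu h'.
  rewrite -!integralT_nnsfun; apply: ge0_ae_eq_integral => //.
  - by apply/measurable_EFinP; exact: measurable_funP.
  - by apply/measurable_EFinP; exact: measurable_funP.
  - by move=> x _; rewrite lee_fin.
  - by move=> x _; rewrite lee_fin.
  - exists N; split => // x /=; apply: contra_notP => xN _.
    by congr EFin; rewrite [RHS]h'E indicE mem_set// mulr1.
apply: ereal_sup_ubound; exists h' => //= x.
have [xN|xN] := pselect (N x).
  by rewrite [X in X%:E]h'E indicE memNset ?mulr0//; exact: (fun p => p xN).
rewrite [X in X%:E]h'E indicE mem_set// mulr1; apply: le_trans (hf x) _.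
suff -> : f x = g x by [].
by apply: contrapT => fg; apply: xN; exact: HN.
Qed.

Lemma integral_ae (f g : mR -> \bar R) : {ae mu, forall x, f x = g x} ->
  (\int[mu]_x f x = \int[mu]_x g x)%E.
Proof.
move=> fg; rewrite /integral !patch_setT.
have gf : {ae mu, forall x, g x = f x} by apply: ae_imp fg.
congr (_ - _)%E; apply/eqP; rewrite eq_le; apply/andP; split; apply: nnintegral_ae_le.
- by move=> x; exact: funepos_ge0.
- by apply: ae_imp fg => x; rewrite !funeposE => ->.
- by move=> x; exact: funepos_ge0.
- by apply: ae_imp fg => x; rewrite !funeposE => ->.
- by move=> x; exact: funeneg_ge0.
- by apply: ae_imp fg => x; rewrite !funenegE => ->.
- by move=> x; exact: funeneg_ge0.
- by apply: ae_imp fg => x; rewrite !funenegE => ->.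
Qed.

Lemma cint_ae (f g : R -> R[i]) : {ae mu, forall x, f x = g x} ->
  cint setT f = cint setT g.
Proof.
move=> fg; rewrite /cint /Rintegral; congr (fine _ +i* fine _); apply: integral_ae.
  by apply: ae_imp fg => x ->.
by apply: ae_imp fg => x ->.
Qed.

Lemma l2_near (f g : R -> R[i]) (s : R) : sqi f -> sqi g -> 0 < s ->
  l2 f <= (1 + s) * l2 g + (1 + s^-1) * l2 (fun t => f t - g t).
Proof.
move=> sf sg s0; have [sB _] := sqiB sf sg.
rewrite /l2 -Rintegral_lin//; [|exact: sqi_int|exact: sqi_int].
apply: le_Rintegral => //; first exact: sqi_int.
  by apply: Rintegrable_lin => //; exact: sqi_int.
move=> t _; set a := normc (g t); set b := normc (f t - g t).
have h : normc (f t) <= a + b.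
  by have := normcD_le (g t) (f t - g t); rewrite addrC subrK.
apply: (@le_trans _ _ ((a + b) ^+ 2)).
  by rewrite ler_pXn2r ?nnegrE ?addr_ge0 ?normc_ge0.
rewrite -subr_ge0.
have -> : (1 + s) * a ^+ 2 + (1 + s^-1) * b ^+ 2 - (a + b) ^+ 2 = s * (a - s^-1 * b) ^+ 2.
  by field; rewrite gt_eqF.
by rewrite mulr_ge0 ?sqr_ge0// ltW.
Qed.

Lemma le_of_perturb (x y : R) : 0 <= y ->
  (forall s : R, 0 < s -> forall e : R, 0 < e -> x <= (1 + s) * y + e) -> x <= y.
Proof.
move=> y0 h; apply/ler_addgt0Pr => e e0.
have y1 : 0 < y + 1 by rewrite ltr_wpDl.
have := h (e / 2 / (y + 1)) _ (e / 2) _; rewrite !divr_gt0// => /(_ isT isT).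
have : e / 2 / (y + 1) * y <= e / 2.
  by rewrite mulrAC ler_pdivrMr// ler_wpM2l ?lerDl// divr_ge0// ltW.
rewrite mulrDl mul1r; lra.
Qed.

End AlmostEverywhere.

(** * The space H^2 and its reproducing kernel *)

Section HardySpace.
Variable R : realType.
Notation mu := (@lebesgue_measure R).
Local Notation mR := (measurableTypeR R).
Local Notation C := R[i].

Definition is_bdry (f : C -> C) (f0 : R -> C) := sqi f0 /\
  {ae mu, forall x, forall e : R, 0 < e -> exists2 d : R, 0 < d &
    forall s, 0 < s -> s <= d -> normc (f (x +i* s) - f0 x) <= e}.

Lemma hardy2_cdiff (f : C -> C^o) (z : C) : hardy2 f -> upper z -> exists l, cdiff f z l.
Proof. by move=> [_ fd _] uz; apply/derivable_cdiff; exact: fd. Qed.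

(** The last two clauses identify the squared norm of the boundary function with the supremum of
    those on the lines. Norms can then be estimated on lines, where no exceptional null set
    interferes. *)
Lemma hardy2P (f : C -> C^o) : hardy2 f -> exists f0 : R -> C, [/\ is_bdry f f0,
  forall w, upper w -> cint setT (fun t => f0 t * hker 0 w t) = 2 * 'i * pi%:C * f w,
  forall y, 0 < y -> sqi (hline f y) /\ l2 (hline f y) <= l2 f0 &
  forall M : R, (forall y, 0 < y ->
    (\int[mu]_x ((normc (f (x +i* y)) ^+ 2)%:E) <= M%:E)%E) -> l2 f0 <= M].
Proof.
move=> hf; have fd := fun z => @hardy2_cdiff f z hf.
have [_ _ [M fM]] := hf.
have [f0 [sf0 lim0]] := boundary_limit fd fM.
exists f0; split.
- by split => //; exact: (bdry_ae fd fM sf0 lim0).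
- exact: (bdry_cauchy fd fM sf0 lim0).
- move=> y y0; split; first exact: (sqi_hline fd fM y0).1.
  apply: le_of_perturb; first exact: l2_ge0.
  move=> s s0 e e0; have s1 : 0 < 1 + s^-1 by rewrite addr_gt0// invr_gt0.
  have [d d0 H] := lim0 _ (divr_gt0 e0 s1).
  pose a := Num.min d y; have a0 : 0 < a by rewrite lt_min d0.
  have ad : a <= d by rewrite ge_min lexx.
  have ay : a <= y by rewrite ge_min lexx orbT.
  apply: le_trans (hline_decr fd fM a0 ay) _.
  apply: le_trans (l2_near (sqi_hline fd fM a0).1 sf0 s0) _.
  by rewrite lerD2l mulrC -ler_pdivlMr//; exact: H.
- move=> M' fM'; have M'0 := hline_M_ge0 fd fM'.
  apply: le_of_perturb => // s s0 e e0.
  have s1 : 0 < 1 + s^-1 by rewrite addr_gt0// invr_gt0.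
  have [d d0 H] := lim0 _ (divr_gt0 e0 s1).
  have [sd ld] := sqi_hline fd fM' d0.
  apply: le_trans (l2_near sf0 sd s0) _.
  have h1 : (1 + s) * l2 (hline f d) <= (1 + s) * M'.
    by rewrite ler_wpM2l// addr_ge0// ltW.
  apply: lerD => //; rewrite mulrC -ler_pdivlMr//.
  have -> : l2 (fun t => f0 t - hline f d t) = l2 (fun t => hline f d t - f0 t).
    by apply: eq_Rintegral => t _; rewrite normc_distC.
  exact: H.
Qed.

Lemma is_bdry_value (f : C -> C^o) (f0 : R -> C) : is_bdry f f0 ->
  {ae mu, forall x, boundary_value f x = f0 x}.
Proof.
move=> [_ h]; apply: ae_imp h => x H.
apply: (@cvg_lim _ _ _ _ _ (fun y => f (x +i* y)) (f0 x : C^o)); first exact: norm_hausdorff.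
apply/cvgcP => e e0; have [d d0 Hd] := H e e0.
exists d => // s /= sd s0; apply: Hd => //.
by move: sd; rewrite sub0r normrN gtr0_norm// => /ltW.
Qed.

Lemma hdotE (f g : C -> C^o) (f0 g0 : R -> C) : is_bdry f f0 -> is_bdry g g0 ->
  hardy_dot f g = cint setT (fun t => f0 t * Num.conj (g0 t)) / (2 * pi)%:C.
Proof.
move=> bf bg; rewrite /hardy_dot cintegralE; congr (_ / _); apply: cint_ae.
by apply: ae_imp (ae_and (is_bdry_value bf) (is_bdry_value bg)) => x [-> ->].
Qed.

Lemma is_bdry_lin (c : C) (f g : C -> C^o) (f0 g0 : R -> C) : is_bdry f f0 -> is_bdry g g0 ->
  is_bdry (c *: f + g) (fun t => c * f0 t + g0 t).
Proof.
move=> [sf hf] [sg hg]; split; first by apply: (sqiD _ sg).1; exact: (sqiZ c sf).1.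
apply: ae_imp (ae_and hf hg) => x [H1 H2] e e0.
have c1 : 0 < normc c + 1 by rewrite ltr_wpDl// normc_ge0.
have e2 : 0 < e / 2 by rewrite divr_gt0.
have [d d0 {}H1] := H1 _ (divr_gt0 e2 c1); have [d' d'0 {}H2] := H2 _ e2.
exists (Num.min d d'); first by rewrite lt_min d0.
move=> s s0; rewrite le_min => /andP[s1 s2].
have -> : (c *: f + g) (x +i* s) - (c * f0 x + g0 x) =
  c * (f (x +i* s) - f0 x) + (g (x +i* s) - g0 x).
  by rewrite mulrBr opprD addrACA.
apply: le_trans (normcD_le _ _) _; rewrite normcM_eq.
have {}H1 := H1 s s0 s1; have {}H2 := H2 s s0 s2.
have : normc c * normc (f (x +i* s) - f0 x) <= (normc c + 1) * (e / 2 / (normc c + 1)).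
  by rewrite ler_pM ?normc_ge0// lerDl.
rewrite [X in _ <= X]mulrC divfK ?gt_eqF//; lra.
Qed.

Lemma hline_measurable (f : C -> C^o) (y : R) : (forall z, upper z -> exists l, cdiff f z l) -> 0 < y ->
  cmeasurable (setT : set mR) (fun x => f (x +i* y)).
Proof.
move=> fd y0; apply: (@strip_cmeasurable _ _ y y); last by rewrite lexx.
move=> x t /andP[ty _]; apply: fd; rewrite /upper/=; exact: lt_le_trans ty.
Qed.

Lemma hardy2_lin (c : C) (f g : C -> C^o) : hardy2 f -> hardy2 g -> hardy2 (c *: f + g).
Proof.
move=> hf hg; have [f0 fd [M fM]] := hf; have [g0 gd [M' gM]] := hg; split.
- by move=> z nz; rewrite [LHS](_ : _ = c * f z + g z)// f0// g0// mulr0 addr0.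
- move=> z uz; apply: (@derivableD_c _ (fun w => c * f w) g z); last exact: gd.
  by apply: derivableM_c; [exact: derivable_cst_c|exact: fd].
exists (2 * (normc c ^+ 2 * M) + 2 * M') => y y0.
have fd' := fun z => @hardy2_cdiff f z hf; have gd' := fun z => @hardy2_cdiff g z hg.
have [sf lf] := sqi_hline fd' fM y0; have [sg lg] := sqi_hline gd' gM y0.
have [scf lcf] := sqiZ c sf; have [ss ls] := sqiD scf sg.
have := l2E ss; rewrite (_ : (fun x => _) = (fun x : R => (normc ((c *: f + g) (x +i* y)) ^+ 2)%:E))// => ->.
rewrite lee_fin; apply: le_trans ls _; rewrite lcf lerD// ler_pM2l//.
by rewrite ler_wpM2l// sqr_ge0.
Qed.

Lemma hardy2_0 : hardy2 (0 : C -> C^o).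
Proof.
split=> [//|z _|]; first exact: derivable_cst_c.
exists 0 => y _; rewrite integral0_eq// => x _.
by rewrite [X in (normc X ^+ 2)%:E](_ : _ = 0)// normc_0 expr0n.
Qed.

Lemma twopi_neq0 : (2 * pi)%:C != 0 :> C.
Proof. by rewrite -normc_gt0 normc_real normr_gt0 mulf_neq0// gt_eqF// pi_gt0. Qed.

Lemma hdot_linl (c : C) (f g h : C -> C^o) : hardy2 f -> hardy2 g -> hardy2 h ->
  hardy_dot (c *: f + g) h = c * hardy_dot f h + hardy_dot g h.
Proof.
move=> /hardy2P[f0 [bf _ _ _]] /hardy2P[g0 [bg _ _ _]] /hardy2P[h0 [bh _ _ _]].
rewrite (hdotE (is_bdry_lin c bf bg) bh) (hdotE bf bh) (hdotE bg bh).
rewrite mulrA -mulrDl; congr (_ / _); rewrite -cintZ//; last first.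
  by apply: sqi_integrable_mul; [exact: bf.1|exact: bh.1].
rewrite -cintD//; last 2 first.
- by apply: cintegrableZ => //; apply: sqi_integrable_mul; [exact: bf.1|exact: bh.1].
- by apply: sqi_integrable_mul; [exact: bg.1|exact: bh.1].
by apply: eq_cint => t _; ring.
Qed.

Lemma hdotC (f g : C -> C^o) : hardy2 f -> hardy2 g -> hardy_dot g f = Num.conj (hardy_dot f g).
Proof.
move=> /hardy2P[f0 [bf _ _ _]] /hardy2P[g0 [bg _ _ _]].
rewrite (hdotE bf bg) (hdotE bg bf) cjM cjV conjc_realc; congr (_ / _).
rewrite -cint_conj//; last by apply: sqi_integrable_mul; [exact: bf.1|exact: bg.1].
by apply: eq_cint => t _; rewrite cjM conjK mulrC.
Qed.

Definition hnorm2 (f : C -> C^o) : R := re (hardy_dot f f).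

Lemma hnorm2E (f : C -> C^o) (f0 : R -> C) : is_bdry f f0 -> hardy_dot f f = (l2 f0 / (2 * pi))%:C.
Proof.
move=> bf; rewrite (hdotE bf bf) cint_l2; last exact: bf.1.
apply: complex_ext; rewrite ?reM ?imM ?reV ?imV ?normc_real/=.
  rewrite mul0r subr0 real_normK ?num_real//; congr (_ * _).
  have : (2 * pi : R) != 0 by rewrite mulf_neq0// gt_eqF// pi_gt0.
  by move: (2 * pi : R) => p p0; field.
by rewrite oppr0 mul0r mulr0 mul0r addr0.
Qed.

Lemma hnorm2_ge0 (f : C -> C^o) : hardy2 f -> 0 <= hnorm2 f.
Proof.
move=> /hardy2P[f0 [bf _ _ _]]; rewrite /hnorm2 (hnorm2E bf)/=.
by rewrite divr_ge0 ?l2_ge0// mulr_ge0// pi_ge0.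
Qed.

Lemma hnorm2_line (f : C -> C^o) (y : R) : hardy2 f -> 0 < y ->
  (\int[mu]_x ((normc (f (x +i* y)) ^+ 2)%:E) <= (2 * pi * hnorm2 f)%:E)%E.
Proof.
move=> /hardy2P[f0 [bf _ H _]] y0; have [sf lf] := H y y0.
rewrite (l2E sf) lee_fin /hnorm2 (hnorm2E bf)/= mulrC divfK//.
by rewrite mulf_neq0// gt_eqF// pi_gt0.
Qed.

Lemma hnorm2_le (f : C -> C^o) (M : R) : hardy2 f -> (forall y, 0 < y ->
    (\int[mu]_x ((normc (f (x +i* y)) ^+ 2)%:E) <= (2 * pi * M)%:E)%E) ->
  hnorm2 f <= M.
Proof.
move=> /hardy2P[f0 [bf _ _ H]] h; rewrite /hnorm2 (hnorm2E bf)/=.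
rewrite ler_pdivrMr ?mulr_gt0 ?pi_gt0// mulrC; exact: H.
Qed.

Definition hkernel (w : C) : C -> C^o :=
  fun z => if 0 < im z then 'i / (z - Num.conj w) else 0.

Lemma upper_sub_conj (z w : C) : upper z -> upper w -> z - Num.conj w != 0.
Proof.
rewrite /upper => uz uw; apply/eqP => /(congr1 (@complex.Im R)).
rewrite imB imJ/= => h; have : 0 < im z + im w by rewrite addr_gt0.
by rewrite -[im w]opprK h ltxx.
Qed.

Lemma near_upper (z : C) : upper z -> exists2 d : R, 0 < d & forall h : C, normc h <= d -> upper (z + h).
Proof.
rewrite /upper => uz; exists (im z / 2); first by rewrite divr_gt0.
move=> h hd; have := normc_im h; rewrite imD => h1.
have := le_trans h1 hd; rewrite ler_norml => /andP[? _]; lra.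
Qed.

Lemma hardy2_kernel (w : C) : upper w -> hardy2 (hkernel w).
Proof.
move=> uw; split.
- by move=> z /negP nz; rewrite /hkernel (negbTE nz).
- move=> z uz; have [d d0 H] := near_upper uz.
  apply: (@derivable_near_c _ (fun z => 'i * (z - Num.conj w)^-1) (hkernel w) z d) => //.
    by move=> h hd; rewrite /hkernel (H h hd).
  apply: derivableM_c; first exact: derivable_cst_c.
  apply: derivableV_c; first exact: upper_sub_conj.
  exact: derivable_subr_c.
exists (pi / im w) => y y0.
have hy : im (Num.conj w) != y by rewrite imJ lt_eqF// (lt_trans _ y0)// oppr_lt0.
have [sk lk] := sqi_hker hy.
rewrite (_ : (fun x => _) = (fun x => (normc (hker y (Num.conj w) x) ^+ 2)%:E)); last first.
  by apply/funext => x; rewrite /hkernel/= y0 normcM_eq normc_i mul1r.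
rewrite (l2E sk) lk lee_fin ler_pM2l ?pi_gt0// lef_pV2 ?posrE ?normr_gt0 ?subr_eq0//.
rewrite imJ -opprD normrN gtr0_norm ?lerDl ?(ltW y0)//.
by rewrite addr_gt0.
Qed.

Lemma bdry_kernel (w : C) : upper w ->
  is_bdry (hkernel w) (fun t => 'i * hker 0 (Num.conj w) t).
Proof.
move=> uw; have uw' : 0 < im w by [].
have h0 : im (Num.conj w) != 0 by rewrite imJ lt_eqF// oppr_lt0.
split; first exact: (sqiZ _ (sqi_hker h0).1).1.
apply: (ae_imp (P := fun=> True)) => [x _ e e0|]; last first.
  by exists set0; split => // x /=.
have nz : x +i* 0 - Num.conj w != 0.
  apply/eqP => /(congr1 (@complex.Im R)); rewrite imB imJ/= opprK add0r => h.
  by rewrite h ltxx in uw'.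
have /derivable_cdiff[l dv] :
    derivable ((fun z => (z - Num.conj w)^-1) : C^o -> C^o) (x +i* 0) 1.
  by apply: (@derivableV_c _ (fun z => z - Num.conj w)); [exact: nz|exact: derivable_subr_c].
have [d d0 H] := cdiff_cont dv e0.
exists d => // s s0 sd.
have := H ('i * s%:C); rewrite normcM_eq normc_i mul1r normc_real gtr0_norm// => /(_ sd).
have -> : x +i* 0 + 'i * s%:C = x +i* s.
  by apply: complex_ext; rewrite ?reD ?imD ?reM ?imM/=; ring.
by rewrite /hkernel/= s0 /hker -mulrBr normcM_eq normc_i mul1r.
Qed.

(** Cauchy's formula on the real line: conjugating the boundary kernel gives - i [hker 0 w], and - i
    times 2 i pi divided by 2 pi is 1. *)
Lemma hdot_kernel (f : C -> C^o) (w : C) : hardy2 f -> upper w -> hardy_dot f (hkernel w) = f w.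
Proof.
move=> /hardy2P[f0 [bf H _ _]] uw; rewrite (hdotE bf (bdry_kernel uw)).
have -> : (fun t => f0 t * Num.conj ('i * hker 0 (Num.conj w) t)) =
   (fun t => (- 'i) * (f0 t * hker 0 w t)).
  apply/funext => t; rewrite cjM conjc_i mulrCA; congr (_ * (_ * _)).
  rewrite /hker cjV; congr (_^-1); rewrite cjB conjK; congr (_ - _).
  by apply: complex_ext; rewrite /= ?oppr0.
have h0 : im w != 0 by rewrite gt_eqF.
rewrite cintZ//; last by apply: sqiM_int; [exact: bf.1|exact: (sqi_hker h0).1].
rewrite H//.
have -> : - 'i * (2 * 'i * pi%:C * f w) = - ('i * 'i) * (2 * pi%:C * f w) by ring.
rewrite sqr_ic opprK mul1r mulrC mulrA.
have -> : (2 * pi)%:C = 2 * pi%:C :> C by apply: complex_ext; rewrite ?reM ?imM/=; ring.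
rewrite mulVf ?mul1r//.
have := twopi_neq0; rewrite (_ : (2 * pi)%:C = 2 * pi%:C :> C)//.
by apply: complex_ext; rewrite ?reM ?imM/=; ring.
Qed.

(** Both claims are read off the horizontal lines, so boundary values of phi never enter. *)
Lemma hardy2_mul (phi : C -> C) (f : C -> C^o) (M : R) : 0 <= M ->
  (forall z, upper z -> derivable (phi : C^o -> C^o) z 1) ->
  (forall z, upper z -> normc (phi z) <= M) -> hardy2 f ->
  hardy2 (fun z => phi z * f z) /\ hnorm2 (fun z => phi z * f z) <= M ^+ 2 * hnorm2 f.
Proof.
move=> M0 pd pM hf; have [f0 fd _] := hf.
have fd' := fun z => @hardy2_cdiff f z hf.
have pfd z : upper z -> derivable ((fun z => phi z * f z) : C^o -> C^o) z 1.
  by move=> uz; apply: derivableM_c; [exact: pd|exact: fd].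
have b y : 0 < y -> (\int[mu]_x ((normc (phi (x +i* y) * f (x +i* y)) ^+ 2)%:E) <=
    (2 * pi * (M ^+ 2 * hnorm2 f))%:E)%E.
  move=> y0; have m1 : cmeasurable (setT : set mR) (fun x => f (x +i* y)) by exact: hline_measurable.
  have m2 : cmeasurable (setT : set mR) (fun x => phi (x +i* y) * f (x +i* y)).
    by apply: (@hline_measurable (fun z => phi z * f z)) => // z /pfd /derivable_cdiff.
  apply: (@le_trans _ _ (\int[mu]_x (M ^+ 2 * normc (f (x +i* y)) ^+ 2)%:E)%E).
    apply: ge0_int_le => //.
    - exact: measurable_normc2.
    - by apply: measurable_cM; exact: measurable_normc2.
    - by move=> x _; rewrite sqr_ge0.
    - move=> x _; rewrite normcM_eq exprMn ler_wpM2r ?sqr_ge0//.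
      by rewrite ler_pXn2r ?nnegrE ?normc_ge0//; exact: pM.
  rewrite ge0_intZl ?sqr_ge0//; last 2 first.
  - exact: measurable_normc2.
  - by move=> x; rewrite sqr_ge0.
  rewrite (_ : 2 * pi * _ = M ^+ 2 * (2 * pi * hnorm2 f)); last by ring.
  rewrite [X in (_ <= X)%E](_ : _ = (M ^+ 2)%:E * (2 * pi * hnorm2 f)%:E)%E//; apply: lee_wpmul2l; first by rewrite lee_fin sqr_ge0.
  exact: hnorm2_line.
have hh : hardy2 (fun z => phi z * f z).
  split=> [z nz||]; [by rewrite f0// mulr0|exact: pfd|].
  by exists (2 * pi * (M ^+ 2 * hnorm2 f)).
by split => //; exact: hnorm2_le.
Qed.

(** Fatou's lemma on each horizontal line. Since the limit is given as analytic, pointwise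
    convergence is enough. *)
Lemma hardy2_limit (u : nat -> C -> C^o) (f : C -> C^o) (M : R) :
  (forall n, hardy2 (u n)) -> (forall n, hnorm2 (u n) <= M) ->
  (forall z, ~ upper z -> f z = 0) ->
  (forall z, upper z -> derivable (f : C^o -> C^o) z 1) ->
  (forall z, upper z -> forall e : R, 0 < e -> \forall n \near \oo, normc (u n z - f z) <= e) ->
  hardy2 f /\ hnorm2 f <= M.
Proof.
move=> hu uM f0 fd uf.
have b y : 0 < y -> (\int[mu]_x ((normc (f (x +i* y)) ^+ 2)%:E) <= (2 * pi * M)%:E)%E.
  move=> y0.
  have mu_ n : measurable_fun (setT : set mR) (fun x => (normc (u n (x +i* y)) ^+ 2)%:E).
    apply/measurable_EFinP; apply: measurable_normc2; apply: hline_measurable => // z.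
    exact: hardy2_cdiff.
  apply: (@le_trans _ _ (\int[mu]_x (limn_einf (fun n => (normc (u n (x +i* y)) ^+ 2)%:E)))%E).
    rewrite le_eqVlt; apply/orP; left; apply/eqP; apply: eq_integral => x _.
    have uz : upper (x +i* y) by [].
    have cn : normc (u n (x +i* y)) @[n --> \oo] --> normc (f (x +i* y)).
      apply/cvgrPdist_le => e e0; apply: filterS (uf _ uz e e0) => n hn.
      rewrite ler_norml; have h1 := normcD_le (f (x +i* y)) (u n (x +i* y) - f (x +i* y)).
      have h2 := normcB_le (u n (x +i* y)) (u n (x +i* y) - f (x +i* y)).
      rewrite addrC subrK in h1; rewrite opprB addrC subrK in h2.
      by apply/andP; split; lra.
    have c2 : (normc (u n (x +i* y)) ^+ 2)%:E @[n --> \oo] --> (normc (f (x +i* y)) ^+ 2)%:E.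
      by apply/fine_cvgP; split; [exact: nearW|exact: (cvgM cn (cn))].
    by have [-> _] := cvg_limn_einf_sup c2.
  apply: le_trans (fatou mu measurableT mu_ _) _.
    by move=> n x _; rewrite lee_fin sqr_ge0.
  apply: limn_einf_le => n; apply: le_trans (hnorm2_line (hu n) y0) _.
  by rewrite lee_fin ler_wpM2l// mulr_ge0// pi_ge0.
have hf : hardy2 f by split => //; exists (2 * pi * M).
by split => //; exact: hnorm2_le.
Qed.

End HardySpace.

(** * Inner product spaces *)

Section Prehilbert.
Variables (R : realType) (V : lmodType R[i]) (S : set V) (dot : V -> V -> R[i]).
Local Notation C := R[i].

(** Relative to a set S, because [hardy_dot] behaves as an inner product only on H^2. The form is
    semidefinite; definiteness is a separate hypothesis where limits have to be unique. *)
Definition prehilbert : Prop := [/\ Defs.subspace S,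
  forall (c : C) x y z, S x -> S y -> S z -> dot (c *: x + y) z = c * dot x z + dot y z,
  forall x y, S x -> S y -> dot y x = Num.conj (dot x y) &
  forall x, S x -> 0 <= re (dot x x)].

Definition n2 (x : V) : R := re (dot x x).

Hypothesis ph : prehilbert.
Implicit Types (x y z : V) (c : C).

Lemma ph0 : S 0. Proof. by have [[]] := ph. Qed.
Lemma phL c x y : S x -> S y -> S (c *: x + y).
Proof. by have [[_ h] _ _ _] := ph; exact: h. Qed.
Lemma phZ c x : S x -> S (c *: x).
Proof. by move=> Sx; rewrite -[_ *: _]addr0; apply: phL => //; exact: ph0. Qed.
Lemma phD x y : S x -> S y -> S (x + y).
Proof. by move=> Sx Sy; rewrite -[x]scale1r; exact: phL. Qed.
Lemma phB x y : S x -> S y -> S (x - y).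
Proof. by move=> Sx Sy; apply: phD => //; rewrite -scaleN1r; exact: phZ. Qed.

Lemma ph_sum (I : Type) (r : seq I) (P : pred I) (v : I -> V) :
  (forall i, P i -> S (v i)) -> S (\sum_(i <- r | P i) v i).
Proof.
move=> h; elim/big_rec: _ => [|i x Pi Sx]; first exact: ph0.
by apply: phD => //; exact: h.
Qed.

Lemma dotC x y : S x -> S y -> dot y x = Num.conj (dot x y).
Proof. by have [_ _ h _] := ph; exact: h. Qed.
Lemma dotLl c x y z : S x -> S y -> S z -> dot (c *: x + y) z = c * dot x z + dot y z.
Proof. by have [_ h _ _] := ph; exact: h. Qed.
Lemma dotDl x y z : S x -> S y -> S z -> dot (x + y) z = dot x z + dot y z.
Proof. by move=> Sx Sy Sz; rewrite -[x]scale1r dotLl// mul1r scale1r. Qed.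
Lemma dot0l z : S z -> dot 0 z = 0.
Proof.
move=> Sz; have := dotDl ph0 ph0 Sz; rewrite addr0 => h.
by apply: (addrI (dot 0 z)); rewrite -h addr0.
Qed.
Lemma dotZl c x z : S x -> S z -> dot (c *: x) z = c * dot x z.
Proof.
by move=> Sx Sz; have := dotLl c Sx ph0 Sz; rewrite addr0 dot0l// addr0.
Qed.
Lemma dotBl x y z : S x -> S y -> S z -> dot (x - y) z = dot x z - dot y z.
Proof. by move=> Sx Sy Sz; rewrite addrC -scaleN1r dotLl// mulN1r addrC. Qed.
Lemma dotDr x y z : S x -> S y -> S z -> dot z (x + y) = dot z x + dot z y.
Proof.
by move=> *; rewrite dotC//; [rewrite dotDl// cjD -!dotC|exact: phD].
Qed.
Lemma dotZr c x z : S x -> S z -> dot z (c *: x) = Num.conj c * dot z x.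
Proof. by move=> *; rewrite dotC//; [rewrite dotZl// cjM -dotC|exact: phZ]. Qed.
Lemma dot0r z : S z -> dot z 0 = 0.
Proof. by move=> Sz; rewrite dotC// ?dot0l ?cj0//; exact: ph0. Qed.

Lemma dot_suml (I : Type) (r : seq I) (v : I -> V) (c : I -> C) z :
  (forall i, S (v i)) -> S z ->
  dot (\sum_(i <- r) c i *: v i) z = \sum_(i <- r) c i * dot (v i) z.
Proof.
move=> Sv Sz; elim: r => [|i r IH]; first by rewrite !big_nil dot0l.
by rewrite !big_cons dotLl// ?IH//; apply: ph_sum => j _; exact: phZ.
Qed.

Lemma dot_sumr (I : Type) (r : seq I) (v : I -> V) (c : I -> C) z :
  (forall i, S (v i)) -> S z ->
  dot z (\sum_(i <- r) c i *: v i) = \sum_(i <- r) Num.conj (c i) * dot z (v i).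
Proof.
move=> Sv Sz; elim: r => [|i r IH]; first by rewrite !big_nil dot0r.
have SS : S (\sum_(i <- r) c i *: v i) by apply: ph_sum => j _; exact: phZ.
by rewrite !big_cons dotDr// ?IH ?dotZr//; exact: phZ.
Qed.

Lemma dot_n2 x : S x -> dot x x = (n2 x)%:C.
Proof.
move=> Sx; have h := dotC Sx Sx; apply: complex_ext => //=.
have := congr1 (@complex.Im R) h; rewrite imJ; lra.
Qed.

Lemma n2_ge0 x : S x -> 0 <= n2 x.
Proof. by have [_ _ _ h] := ph; exact: h. Qed.

Lemma n2_0 : n2 0 = 0. Proof. by rewrite /n2 dot0l//; exact: ph0. Qed.

Lemma n2Z c x : S x -> n2 (c *: x) = normc c ^+ 2 * n2 x.
Proof.
move=> Sx; rewrite /n2 dotZl ?dotZr//; last exact: phZ.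
by rewrite mulrA mul_conj dot_n2// reM/= mul0r subr0.
Qed.

Lemma n2D x y : S x -> S y -> n2 (x + y) = n2 x + n2 y + 2 * re (dot x y).
Proof.
move=> Sx Sy; rewrite /n2 dotDl ?dotDr//; last exact: phD.
rewrite (dotC Sx Sy) !reD reJ; lra.
Qed.

Lemma n2N x : S x -> n2 (- x) = n2 x.
Proof. by move=> Sx; rewrite -scaleN1r n2Z// normc_opp normc_1 expr1n mul1r. Qed.

Lemma n2B x y : S x -> S y -> n2 (x - y) = n2 x + n2 y - 2 * re (dot x y).
Proof.
move=> Sx Sy; have Sy' : S (- y) by rewrite -scaleN1r; exact: phZ.
rewrite n2D// n2N// -scaleN1r dotZr// cjN cj1 mulN1r reN; lra.
Qed.

Lemma n2_distC x y : S x -> S y -> n2 (x - y) = n2 (y - x).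
Proof. by move=> Sx Sy; rewrite -n2N ?opprB//; exact: phB. Qed.

Lemma parallelogram x y : S x -> S y ->
  n2 (x + y) + n2 (x - y) = 2 * n2 x + 2 * n2 y.
Proof. by move=> Sx Sy; rewrite n2D// n2B//; lra. Qed.

Lemma cauchy_schwarz x y : S x -> S y -> normc (dot x y) ^+ 2 <= n2 x * n2 y.
Proof.
move=> Sx Sy; have nx := n2_ge0 Sx; have := n2_ge0 Sy.
set d := dot x y; rewrite le_eqVlt => /predU1P[y0|ny].
  rewrite -y0 mulr0 leNgt; apply/negP => d0.
  (* When y is a null vector, the squared norm of x - t d y is n2 x - 2 t |d|^2, and this t makes it
     -1. *)
  pose t := (n2 x + 1) / (2 * normc d ^+ 2).
  have St := phZ (t%:C * d) Sy.
  have := n2_ge0 (phB Sx St); rewrite n2B// n2Z// dotZr// -/d -y0 mulr0 addr0.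
  rewrite cjM conjc_realc -mulrA [_ * d]mulrC mul_conj reM/= mul0r subr0.
  have -> : 2 * (t * normc d ^+ 2) = n2 x + 1.
    by rewrite /t; field; apply: contraTneq d0 => ->; rewrite expr0n ltxx.
  lra.
(* This vector is n2 y times the component of x orthogonal to y; scaling by n2 y avoids a
   division. *)
have := n2_ge0 (phB (phZ (n2 y)%:C Sx) (phZ d Sy)).
rewrite n2B ?n2Z//; [|exact: phZ|exact: phZ].
rewrite dotZl ?dotZr// -/d; last exact: phZ.
rewrite [_ * d]mulrC mul_conj normc_real real_normK ?num_real// reM/= mul0r subr0 => h.
rewrite -subr_ge0 -(pmulr_rge0 _ ny).
by apply: le_trans h _; rewrite le_eqVlt; apply/orP; left; apply/eqP; ring.
Qed.

Lemma sqrt_n2D x y : S x -> S y ->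
  Num.sqrt (n2 (x + y)) <= Num.sqrt (n2 x) + Num.sqrt (n2 y).
Proof.
move=> Sx Sy; have nx := n2_ge0 Sx; have ny := n2_ge0 Sy.
rewrite -[leRHS]ger0_norm ?addr_ge0 ?sqrtr_ge0// -sqrtr_sqr ler_wsqrtr// n2D//.
rewrite sqrrD !sqr_sqrtr// -sqrtrM// -mulr_natl.
have : re (dot x y) <= Num.sqrt (n2 x * n2 y).
  apply: le_trans (ler_norm _) _; apply: le_trans (normc_re _) _.
  rewrite -[normc _]ger0_norm ?normc_ge0// -sqrtr_sqr ler_wsqrtr//.
  exact: cauchy_schwarz.
lra.
Qed.

Lemma n2D_le x y : S x -> S y -> n2 (x + y) <= 2 * n2 x + 2 * n2 y.
Proof. by move=> Sx Sy; rewrite -parallelogram// lerDl n2_ge0//; exact: phB. Qed.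

Lemma n2_orthonormal (n : nat) (e : nat -> V) (c : nat -> C) :
  (forall i, S (e i)) ->
  (forall i j, (i < n)%N -> (j < n)%N -> dot (e i) (e j) = (i == j)%:R) ->
  n2 (\sum_(i < n) c i *: e i) = \sum_(i < n) normc (c i) ^+ 2.
Proof.
move=> Se on; elim: n on => [|n IH] on; first by rewrite !big_ord0 n2_0.
have SS : S (\sum_(i < n) c i *: e i) by apply: ph_sum => j _; exact: phZ.
rewrite !big_ord_recr/= n2D//; last exact: phZ.
rewrite IH; last by move=> i j ni nj; apply: on; exact: ltnW.
rewrite n2Z// [n2 (e n)]/n2 on// eqxx mulr1.
rewrite dot_suml//; last exact: phZ.
rewrite [X in re X]big1 ?mulr0 ?addr0// => i _.
have ni := ltn_ord i.
by rewrite dotZr// on ?ltnS ?(ltnW ni)// (ltn_eqF ni) !mulr0.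
Qed.

Definition dcauchy (u : nat -> V) : Prop := forall e : R, 0 < e ->
  exists N, forall n m, (N <= n)%N -> (N <= m)%N -> n2 (u n - u m) <= e.

Definition dcvg (u : nat -> V) (p : V) : Prop := forall e : R, 0 < e ->
  exists N, forall n, (N <= n)%N -> n2 (u n - p) <= e.

Definition dcomplete (K : set V) : Prop := forall u, (forall n, K (u n)) ->
  dcauchy u -> exists2 p, K p & dcvg u p.

Lemma near_inv (e : R) : 0 < e -> exists N : nat, forall n, (N <= n)%N -> (n.+1%:R : R)^-1 <= e.
Proof.
move=> e0; exists (Num.truncn e^-1) => n Nn.
rewrite invf_ple ?posrE//; apply: le_trans (ltW (truncnS_gt _)) _.
by rewrite ler_nat ltnS.
Qed.

(** Removing from x its component along k lowers n2 x by |dot x k|^2 / n2 k, which can be at most e.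
    The slack e is there because the infimum in [projection] is only approached along a sequence. *)
Lemma almost_minimal x k (d e : R) : S x -> S k -> n2 x <= d + e ->
  (forall c, d <= n2 (x - c *: k)) -> normc (dot x k) ^+ 2 <= e * n2 k.
Proof.
move=> Sx Sk xd h; have := n2_ge0 Sk; rewrite le_eqVlt => /predU1P[k0|k0].
  by have := cauchy_schwarz Sx Sk; rewrite -k0 !mulr0.
have Skk := phZ (dot x k / (n2 k)%:C) Sk.
have := h (dot x k / (n2 k)%:C); rewrite n2B// n2Z// dotZr//.
have -> : Num.conj (dot x k / (n2 k)%:C) * dot x k =
   (normc (dot x k) ^+ 2 / n2 k)%:C.
  rewrite cjM cjV conjc_realc mulrAC [_ * dot x k]mulrC mul_conj.
  by rewrite -(fmorphV (real_complex R)) -(rmorphM (real_complex R)).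
rewrite normcM_eq normcV_eq normc_real gtr0_norm//=.
have -> : (normc (dot x k) * (n2 k)^-1) ^+ 2 * n2 k = normc (dot x k) ^+ 2 / n2 k.
  by field; rewrite gt_eqF.
by rewrite -ler_pdivrMr//; lra.
Qed.

(* The parallelogram identity makes a minimizing sequence Cauchy. *)
Lemma projection (K : set V) f : K `<=` S ->
  (forall c x y, K x -> K y -> K (c *: x + y)) -> K 0 -> dcomplete K ->
  S f -> exists2 p, K p & forall k, K k -> dot (f - p) k = 0.
Proof.
move=> KS KL K0 cK Sf.
pose D := [set n2 (f - k) | k in K].
have D0 : has_inf D.
  split; first by exists (n2 (f - 0)); exists 0.
  by exists 0 => _ [k Kk <-]; apply: n2_ge0; apply: phB => //; exact: KS.
pose d := inf D.
have dK k : K k -> d <= n2 (f - k) by move=> Kk; apply: ge_inf; [exact: D0.2|exists k].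
have /choice[u Hu] : forall n : nat, exists k, K k /\ n2 (f - k) <= d + (n.+1%:R)^-1.
  move=> n; have n0 : 0 < (n.+1%:R : R)^-1 by rewrite invr_gt0.
  have [_ [k Kk <-] /ltW hk] := inf_adherent n0 D0.
  by exists k.
have uK n := (Hu n).1; have uS n := KS _ (uK n).
have [|p Kp up] := cK u uK.
  move=> e e0; have e4 : 0 < e / 4 by rewrite divr_gt0.
  have [N HN] := near_inv e4; exists N => n m Nn Nm.
  have := parallelogram (phB Sf (uS m)) (phB Sf (uS n)).
  rewrite opprB [X in n2 X + _]addrACA -opprD [X in _ + n2 X]addrC addrA subrK.
  have -> : f + f - (u m + u n) = 2 *: (f - 2^-1 *: (u n + u m)).
    by rewrite scalerBr scalerA divff ?pnatr_eq0// scale1r scaler_nat mulr2n [u m + _]addrC.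
  have Kh : K (2^-1 *: (u n + u m)).
    have Kn : K (u n + u m) by rewrite -[u n]scale1r; exact: KL.
    by rewrite -[_ *: _]addr0; exact: KL.
  rewrite n2Z; last by apply: phB => //; exact: KS.
  have := dK _ Kh; have := le_trans (Hu n).2 (lerD (lexx d) (HN n Nn)).
  have := le_trans (Hu m).2 (lerD (lexx d) (HN m Nm)).
  have -> : normc (2 : C) = 2 by have := normc_real (2 : R); rewrite ger0_norm// => <-; congr normc; apply: complex_ext; rewrite ?reD ?imD/= ?addr0.
  lra.
exists p => // k Kk; have Sk := KS _ Kk; have Sp := KS _ Kp.
have nk := n2_ge0 Sk.
apply/eqP; rewrite -normc_eq0 -sqrf_eq0 eq_le sqr_ge0 andbT.
apply/ler_addgt0Pr => e e0; rewrite add0r.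
have k1 : 0 < n2 k + 1 by rewrite ltr_wpDl.
have e4 : 0 < e / 4 / (n2 k + 1) by rewrite !divr_gt0.
have [N HN] := near_inv e4; have [N' HN'] := up _ e4.
pose n := maxn N N'.
have h1 : normc (dot (f - u n) k) ^+ 2 <= (n.+1%:R)^-1 * n2 k.
  apply: (almost_minimal (phB Sf (uS n)) Sk (Hu n).2) => c.
  by rewrite -addrA -opprD; apply: dK; rewrite addrC; exact: KL.
have h2 := cauchy_schwarz (phB (uS n) Sp) Sk.
have h3 := HN n (leq_maxl _ _); have h4 := HN' n (leq_maxr _ _).
have -> : dot (f - p) k = dot (f - u n) k + dot (u n - p) k.
  by rewrite -dotDl ?addrA ?subrK//; exact: phB.
have h5 := normcD_le (dot (f - u n) k) (dot (u n - p) k).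
have h6 : normc (dot (f - u n) k + dot (u n - p) k) ^+ 2 <=
   2 * normc (dot (f - u n) k) ^+ 2 + 2 * normc (dot (u n - p) k) ^+ 2.
  apply: (@le_trans _ _ ((normc (dot (f - u n) k) + normc (dot (u n - p) k)) ^+ 2)).
    by rewrite ler_pXn2r ?nnegrE ?addr_ge0 ?normc_ge0.
  have := sqr_ge0 (normc (dot (f - u n) k) - normc (dot (u n - p) k)); nra.
apply: le_trans h6 _.
have h7 : e / 4 / (n2 k + 1) * n2 k <= e / 4.
  by rewrite mulrAC ler_pdivrMr// ler_wpM2l ?lerDl// divr_ge0// ltW.
have h8 := le_trans (le_trans h1 (ler_wpM2r nk h3)) h7.
have h9 := le_trans (le_trans h2 (ler_wpM2r nk h4)) h7.
by move: h8 h9; move: (normc _ ^+ 2) (normc _ ^+ 2) => A1 A2; lra.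
Qed.

Definition spn (a : nat -> V) (n : nat) : set V :=
  [set x | exists c : nat -> C, x = \sum_(i < n) c i *: a i].

Lemma spn_lin a n c x y : spn a n x -> spn a n y -> spn a n (c *: x + y).
Proof.
move=> [f ->] [g ->]; exists (fun i => c * f i + g i).
rewrite scaler_sumr -big_split/=; apply: eq_bigr => i _.
by rewrite scalerA scalerDl.
Qed.

Lemma spn0 a n : spn a n 0.
Proof. by exists (fun=> 0); rewrite big1// => i _; rewrite scale0r. Qed.

Lemma spnZ a n c x : spn a n x -> spn a n (c *: x).
Proof. by move=> h; rewrite -[_ *: _]addr0; apply: spn_lin => //; exact: spn0. Qed.

Lemma spn_sum a n m (c : nat -> C) (v : nat -> V) :
  (forall i, (i < m)%N -> spn a n (v i)) -> spn a n (\sum_(i < m) c i *: v i).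
Proof.
move=> h; apply: big_ind => [|x y hx hy|i _]; first exact: spn0.
  by rewrite -[x]scale1r; exact: spn_lin.
by apply: spnZ; exact: h.
Qed.

Lemma sum_pad (a : nat -> V) n m (c : nat -> C) : (n <= m)%N ->
  \sum_(i < n) c i *: a i = \sum_(i < m) (if (i < n)%N then c i else 0) *: a i.
Proof.
move=> nm; rewrite (big_ord_widen m (fun i => c i *: a i))// big_mkcond/=.
by apply: eq_bigr => i _; case: ifP => //; rewrite scale0r.
Qed.

Lemma spn_mono a n m : (n <= m)%N -> spn a n `<=` spn a m.
Proof. by move=> nm _ [c ->]; exists (fun i => if (i < n)%N then c i else 0); exact: sum_pad. Qed.

Lemma spn_mem a j n : (j < n)%N -> spn a n (a j).
Proof.
move=> jn; exists (fun i => (i == j)%:R).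
rewrite (bigD1 (Ordinal jn))//= eqxx scale1r big1 ?addr0// => i ij.
by rewrite (_ : (i == j :> nat) = false) ?scale0r//; apply: negbTE.
Qed.

Lemma lspan_spn a x : lspan (range a) x <-> exists n, spn a n x.
Proof.
split=> [[n [c [v [hv ->]]]]|[n [c ->]]]; last first.
  by exists n, (fun i => c i), (fun i => a i); split => // i; exists (i : nat).
elim: n c v hv => [|n IH] c v hv; first by exists 0; rewrite big_ord0; exact: spn0.
rewrite big_ord_recr/=.
have [//|m hm] := IH (fun i => c (widen_ord (leqnSn n) i)) (fun i => v (widen_ord (leqnSn n) i)) _.
have [j _ hj] := hv ord_max.
exists (maxn m j.+1); rewrite addrC; apply: spn_lin; last exact: spn_mono (leq_maxl _ _) _ hm.
by rewrite -hj; apply: spn_mem; rewrite leq_max ltnSn orbT.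
Qed.

(** * Extension of a bounded map from a dense span *)

Section Extension.
Variables (a b : nat -> V) (M : R).
Hypotheses (M0 : 0 <= M) (Sa : forall i, S (a i)) (Sb : forall i, S (b i)).
Hypothesis definite : forall x, S x -> n2 x = 0 -> x = 0.
Hypothesis Scomplete : dcomplete S.
Hypothesis adense : forall x, S x -> forall e : R, 0 < e ->
  exists n, exists2 p, spn a n p & n2 (x - p) <= e.
Hypothesis abound : forall n (c : nat -> C),
  n2 (\sum_(i < n) c i *: b i) <= M * n2 (\sum_(i < n) c i *: a i).

(** A relation and not a function, since a vector may have several expansions in the [a i]; [abound]
    and [definite] make it single-valued. *)
Let pairs (x y : V) : Prop := exists n (c : nat -> C),
  x = \sum_(i < n) c i *: a i /\ y = \sum_(i < n) c i *: b i.

Lemma ext_pairsL c x y x' y' : pairs x y -> pairs x' y' -> pairs (c *: x + x') (c *: y + y').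
Proof.
move=> [n [f [-> ->]]] [m [g [-> ->]]].
exists (maxn n m), (fun i => c * (if (i < n)%N then f i else 0) + (if (i < m)%N then g i else 0)).
rewrite !(sum_pad _ f (leq_maxl n m)) !(sum_pad _ g (leq_maxr n m)) !scaler_sumr -!big_split/=.
by split; apply: eq_bigr => i _; rewrite scalerA scalerDl.
Qed.

Lemma ext_pairsS x y : pairs x y -> S x /\ S y.
Proof. by move=> [n [c [-> ->]]]; split; apply: ph_sum => i _; exact: phZ. Qed.

Lemma ext_pairsB x y x' y' : pairs x y -> pairs x' y' -> n2 (y - y') <= M * n2 (x - x').
Proof.
move=> h h'; have [n [c [h1 h2]]] := ext_pairsL (-1) h' h.
by rewrite !scaleN1r in h1 h2; rewrite addrC h2 [x - x']addrC h1.
Qed.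

(** The closure of [pairs], which turns out to be the graph of the extension. *)
Let G (x y : V) : Prop := [/\ S x, S y & forall e : R, 0 < e -> exists p q,
  [/\ pairs p q, n2 (x - p) <= e & n2 (y - q) <= e]].

Lemma ext_of_pairs x y : pairs x y -> G x y.
Proof.
move=> h; have [Sx Sy] := ext_pairsS h; split => // e e0.
by exists x, y; rewrite !subrr n2_0 ltW.
Qed.

Lemma ext_lin c x y x' y' : G x y -> G x' y' -> G (c *: x + x') (c *: y + y').
Proof.
move=> [Sx Sy h] [Sx' Sy' h']; split; [exact: phL|exact: phL|move=> e e0].
pose k := 2 * normc c ^+ 2 + 2.
have k0 : 0 < k by rewrite ltr_wpDl// mulr_ge0// sqr_ge0.
have ek : 0 < e / k by rewrite divr_gt0.
have [p [q [pq xp yq]]] := h _ ek; have [p' [q' [pq' xp' yq']]] := h' _ ek.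
have [Sp Sq] := ext_pairsS pq; have [Sp' Sq'] := ext_pairsS pq'.
exists (c *: p + p'), (c *: q + q'); split; first exact: ext_pairsL.
  have -> : c *: x + x' - (c *: p + p') = c *: (x - p) + (x' - p').
    by rewrite scalerBr opprD addrACA.
  apply: le_trans (n2D_le (phZ c (phB Sx Sp)) (phB Sx' Sp')) _.
  rewrite n2Z; last exact: phB.
  have -> : e = 2 * (normc c ^+ 2 * (e / k)) + 2 * (e / k) by rewrite /k; field; exact: lt0r_neq0.
  by rewrite lerD// ler_pM2l// ler_wpM2l// sqr_ge0.
have -> : c *: y + y' - (c *: q + q') = c *: (y - q) + (y' - q').
  by rewrite scalerBr opprD addrACA.
apply: le_trans (n2D_le (phZ c (phB Sy Sq)) (phB Sy' Sq')) _.
rewrite n2Z; last exact: phB.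
have -> : e = 2 * (normc c ^+ 2 * (e / k)) + 2 * (e / k) by rewrite /k; field; exact: lt0r_neq0.
by rewrite lerD// ler_pM2l// ler_wpM2l// sqr_ge0.
Qed.

Lemma ext_bound x y : G x y -> n2 y <= M * n2 x.
Proof.
move=> [Sx Sy h]; have nx := n2_ge0 Sx; have ny := n2_ge0 Sy.
rewrite -(sqr_sqrtr ny) -[leRHS]sqr_sqrtr ?mulr_ge0//.
rewrite ler_pXn2r ?nnegrE ?sqrtr_ge0// sqrtrM//.
apply/ler_addgt0Pr => e e0.
have m1 : 0 < 1 + Num.sqrt M by rewrite ltr_pwDl// sqrtr_ge0.
pose t := e / (1 + Num.sqrt M); have t0 : 0 < t by rewrite divr_gt0.
have [p [q [pq xp yq]]] := h (t ^+ 2) (exprn_gt0 _ t0).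
have [Sp Sq] := ext_pairsS pq.
have h1 := sqrt_n2D Sq (phB Sy Sq); rewrite [X in n2 X]addrC subrK in h1.
have h2 := sqrt_n2D Sx (phB Sp Sx); rewrite [X in n2 X]addrC subrK n2_distC// in h2.
have h3 : Num.sqrt (n2 (y - q)) <= t.
  by rewrite -[t]ger0_norm ?(ltW t0)// -sqrtr_sqr ler_wsqrtr.
have h4 : Num.sqrt (n2 (x - p)) <= t.
  by rewrite -[t]ger0_norm ?(ltW t0)// -sqrtr_sqr ler_wsqrtr.
have h5 : Num.sqrt (n2 q) <= Num.sqrt M * Num.sqrt (n2 p).
  have [n [c [-> ->]]] := pq; rewrite -sqrtrM//; apply: ler_wsqrtr; exact: abound.
have h6 : Num.sqrt M * Num.sqrt (n2 p) <= Num.sqrt M * (Num.sqrt (n2 x) + t).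
  by rewrite ler_wpM2l ?sqrtr_ge0//; lra.
have h7 : e = t + Num.sqrt M * t by rewrite /t; field; exact: lt0r_neq0.
rewrite mulrDr in h6; lra.
Qed.

Lemma ext_ex x : S x -> exists y, G x y.
Proof.
move=> Sx.
have /choice[f Hf] : forall n : nat, exists pq : V * V,
    pairs pq.1 pq.2 /\ n2 (x - pq.1) <= (n.+1%:R)^-1.
  move=> n; have n0 : 0 < (n.+1%:R : R)^-1 by rewrite invr_gt0.
  have [m [p [c ->] hp]] := adense Sx n0.
  by exists (\sum_(i < m) c i *: a i, \sum_(i < m) c i *: b i); split => //; exists m, c.
have fS n := ext_pairsS (Hf n).1.
have [|y Sy fy] := Scomplete (u := fun n => (f n).2) (fun n => (fS n).2).
  (* Two approximants within k of x are within 4 k of each other, and their images within 4 M k,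
     which stays below e. *)
  move=> e e0; have k0 : 0 < e / (4 * M + 1) by rewrite divr_gt0// ltr_wpDl// mulr_ge0.
  have [N HN] := near_inv k0; exists N => n m Nn Nm.
  apply: le_trans (ext_pairsB (Hf n).1 (Hf m).1) _.
  have := n2D_le (phB (fS n).1 Sx) (phB Sx (fS m).1); rewrite addrA subrK.
  rewrite n2_distC//; last exact: (fS n).1.
  have h3 := le_trans (Hf n).2 (HN n Nn); have h4 := le_trans (Hf m).2 (HN m Nm) => h5.
  have h6 : n2 ((f n).1 - (f m).1) <= 4 * (e / (4 * M + 1)) by lra.
  apply: le_trans (ler_wpM2l M0 h6) _.
  have h7 : (4 * M + 1) * (e / (4 * M + 1)) = e by field; rewrite gt_eqF// ltr_wpDl// mulr_ge0.
  have : 0 <= e / (4 * M + 1) by exact: ltW.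
  by rewrite -[X in _ -> _ <= X]h7; move: (e / _) => t; nra.
exists y; split => // e e0; have [N HN] := near_inv e0; have [N' HN'] := fy e e0.
pose n := maxn N N'; exists (f n).1, (f n).2; split; first exact: (Hf n).1.
  by apply: le_trans (Hf n).2 _; apply: HN; exact: leq_maxl.
rewrite n2_distC//; last exact: (fS n).2.
by apply: HN'; exact: leq_maxr.
Qed.

Lemma ext_fun x y y' : G x y -> G x y' -> y' = y.
Proof.
move=> h h'; have [_ Sy _] := h; have [_ Sy' _] := h'.
have := ext_bound (ext_lin (-1) h h'); rewrite !scaleN1r addNr n2_0 mulr0 => h0.
apply/eqP; rewrite -subr_eq0 addrC; apply/eqP/definite; first by rewrite addrC; exact: phB.
by apply/eqP; rewrite eq_le h0 addrC n2_ge0//; exact: phB.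
Qed.

Lemma bounded_extension : exists L : V -> V,
  [/\ forall x, S x -> S (L x),
      forall c x y, S x -> S y -> L (c *: x + y) = c *: L x + L y,
      forall x, S x -> n2 (L x) <= M * n2 x &
      forall j, L (a j) = b j].
Proof.
have /choice[L HL] : forall x, exists y, S x -> G x y.
  move=> x; have [/ext_ex[y Gy]|nx] := pselect (S x); first by exists y.
  by exists 0 => /nx.
exists L; split => [x Sx|c x y Sx Sy|x Sx|j].
- by have [] := HL x Sx.
- by apply: (ext_fun (ext_lin c (HL x Sx) (HL y Sy))); apply: HL; exact: phL.
- exact: ext_bound (HL x Sx).
apply: (@ext_fun (a j)); last by apply: HL.
apply: ext_of_pairs; exists j.+1, (fun i => (i == j)%:R).
by split; rewrite (bigD1 ord_max)//= eqxx scale1r big1 ?addr0// => i ij;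
  rewrite (_ : (i == j :> nat) = false) ?scale0r//; apply: negbTE; exact: ij.
Qed.

End Extension.

(** * Gram-Schmidt orthonormalization *)

Section GramSchmidt.
Variable h : nat -> V.
Hypothesis Sh : forall i, S (h i).
Hypothesis hfree : forall n x, spn h n x -> 0 < n2 (h n - x).

Let residue n (g : nat -> V) := h n - \sum_(k < n) dot (h n) (g k) *: g k.

(** [gs n] is a table of the first n vectors, so that each step of a structural recursion has all
    earlier ones at hand; the sequence itself is read off the diagonal. *)
Fixpoint gs (n : nat) : nat -> V :=
  if n is m.+1 then fun k => if (k < m)%N then gs m k else
    (Num.sqrt (n2 (residue m (gs m))))^-1%:C *: residue m (gs m)
  else fun=> 0.

Let e n := gs n.+1 n.

Lemma gs_stable n k : (k < n)%N -> gs n k = e k.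
Proof.
elim: n => // n IH; rewrite ltnS leq_eqVlt => /predU1P[->//|kn] /=.
by rewrite kn IH.
Qed.

Lemma gs_step n : e n = (Num.sqrt (n2 (residue n e)))^-1%:C *: residue n e.
Proof.
rewrite {1}/e /= ltnn; suff -> : residue n (gs n) = residue n e by [].
by congr (_ - _); apply: eq_bigr => k _; rewrite gs_stable.
Qed.

Lemma gs_mem n : S (e n).
Proof.
elim/ltn_ind: n => n IH; rewrite gs_step; apply: phZ; apply: phB => //.
apply: ph_sum => k _; apply: phZ; apply: IH; exact: ltn_ord.
Qed.

Lemma gs_spn n : spn h n.+1 (e n).
Proof.
elim/ltn_ind: n => n IH; rewrite gs_step; apply: spnZ.
rewrite /residue addrC -scaleN1r; apply: spn_lin; last exact: spn_mem.
apply: (@spn_sum _ _ _ (fun k => dot (h n) (e k)) e) => i ni.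
by apply: spn_mono (IH i ni); rewrite ltnW.
Qed.

Lemma gs_residue_gt0 n : 0 < n2 (residue n e).
Proof.
apply: hfree; apply: (@spn_sum _ _ _ (fun k => dot (h n) (e k)) e) => i ni.
by apply: spn_mono (gs_spn i).
Qed.

Lemma gs_residueS n : S (residue n e).
Proof. by apply: phB => //; apply: ph_sum => k _; apply: phZ; exact: gs_mem. Qed.

Lemma gs_orthonormal n i j : (i < n)%N -> (j < n)%N -> dot (e i) (e j) = (i == j)%:R.
Proof.
elim: n i j => // n IH i j.
have key k : (k < n)%N -> dot (e n) (e k) = 0.
  have Se := gs_mem; move=> kn; rewrite gs_step dotZl//; last exact: gs_residueS.
  rewrite dotBl//; last by apply: ph_sum => l _; exact: phZ.
  rewrite dot_suml// (bigD1 (Ordinal kn))//= IH// eqxx mulr1 big1 ?addr0 ?subrr ?mulr0//.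
  by move=> l lk; rewrite IH// (_ : (l == k :> nat) = false) ?mulr0//; apply: negbTE; exact: lk.
rewrite !ltnS leq_eqVlt => /predU1P[->|hi]; rewrite leq_eqVlt => /predU1P[->|hj].
- have r0 := gs_residue_gt0 n; rewrite eqxx gs_step dot_n2 ?n2Z//; [|exact: gs_residueS|apply: phZ; exact: gs_residueS].
  rewrite normc_real ger0_norm ?invr_ge0 ?sqrtr_ge0// exprVn sqr_sqrtr ?ltW//.
  by rewrite mulVf// gt_eqF.
- by rewrite key// gtn_eqF.
- by rewrite dotC ?key ?cj0 ?ltn_eqF//; exact: gs_mem.
- exact: IH.
Qed.

Lemma gram_schmidt : exists e : nat -> V, [/\ forall i, S (e i),
  forall i j, dot (e i) (e j) = (i == j)%:R & forall n x, spn h n x -> spn e n x].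
Proof.
exists e; split => [|i j|n x]; first exact: gs_mem.
  by apply: (@gs_orthonormal (maxn i j).+1); rewrite ltnS ?leq_maxl ?leq_maxr.
move=> [c ->]; apply: spn_sum => i ni.
have -> : h i = (Num.sqrt (n2 (residue i e)))%:C *: e i + \sum_(k < i) dot (h i) (e k) *: e k.
  rewrite gs_step scalerA.
  have -> : (Num.sqrt (n2 (residue i e)))%:C * (Num.sqrt (n2 (residue i e)))^-1%:C = 1 :> C.
    by rewrite -(rmorphM (real_complex R)) mulfV// gt_eqF// sqrtr_gt0; exact: gs_residue_gt0.
  by rewrite scale1r subrK.
apply: spn_lin; first exact: spn_mem.
apply: (@spn_sum _ _ _ (fun k => dot (h i) (e k)) e) => k ki.
by apply: spn_mem; exact: ltn_trans ki ni.
Qed.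

End GramSchmidt.

End Prehilbert.

(** * Interpolation by bounded analytic functions *)

Section BlaschkeFactors.
Variable R : realType.
Local Notation C := R[i].

Lemma prod_le1 (I : Type) (s : seq I) (P : pred I) (F : I -> R) :
  (forall i, P i -> 0 <= F i <= 1) -> \prod_(i <- s | P i) F i <= 1.
Proof.
move=> h; suff /andP[] : 0 <= \prod_(i <- s | P i) F i <= 1 by [].
elim/big_rec: _ => [|i x /h/andP[F0 F1] /andP[x0 x1]]; first by rewrite ler01 lexx.
by rewrite mulr_ge0//= mulr_ile1.
Qed.

Definition upper_analytic (f : C -> C) : Prop :=
  forall z, upper z -> derivable (f : C^o -> C^o) z 1.

Lemma upper_analytic_prod (I : Type) (s : seq I) (P : pred I) (f : I -> C -> C) :
  (forall i, P i -> upper_analytic (f i)) ->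
  upper_analytic (fun z => \prod_(i <- s | P i) f i z).
Proof.
move=> h z uz; elim: s => [|i s IH].
  rewrite (_ : (fun z => _) = fun=> 1); first exact: derivable_cst_c.
  by apply/funext => w; rewrite big_nil.
case Pi : (P i); last first.
  by rewrite (_ : (fun z => _) = fun z => \prod_(i <- s | P i) f i z)//;
    apply/funext => w; rewrite big_cons Pi.
rewrite (_ : (fun z => _) = fun z => f i z * \prod_(i <- s | P i) f i z).
  by apply: derivableM_c; [exact: (h i Pi z uz)|exact: IH].
by apply/funext => w; rewrite big_cons Pi.
Qed.

Definition blaschke (a z : C) : C := (z - a) / (z - Num.conj a).

Lemma upper_analytic_inv_conj a : upper a ->
  upper_analytic (fun z => (z - Num.conj a)^-1).
Proof.
move=> ua z uz; apply: derivableV_c; first exact: upper_sub_conj.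
exact: derivable_subr_c.
Qed.

Lemma upper_analytic_blaschke a : upper a -> upper_analytic (blaschke a).
Proof.
move=> ua z uz; apply: derivableM_c; last exact: upper_analytic_inv_conj.
exact: derivable_subr_c.
Qed.

(** From |z - conj a|^2 - |z - a|^2 = 4 Im z Im a. *)
Lemma normc_blaschke2 a z : upper a -> upper z ->
  normc (blaschke a z) ^+ 2 = 1 - 4 * im z * im a / normc (z - Num.conj a) ^+ 2.
Proof.
move=> ua uz; rewrite normcM_eq normcV_eq.
have : normc (z - Num.conj a) != 0 by rewrite normc_eq0 upper_sub_conj.
rewrite -sqrf_eq0 expr_div_n !normc2 !(reB, imB, reJ, imJ) => h.
by field.
Qed.

Lemma blaschke_le1 a z : upper a -> upper z -> normc (blaschke a z) <= 1.
Proof.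
move=> ua uz; rewrite -(@ler_pXn2r _ 2) ?nnegrE ?normc_ge0// expr1n normc_blaschke2//.
by rewrite gerBl divr_ge0 ?sqr_ge0// !mulr_ge0// ltW.
Qed.

(** Reflection in the real line inverts the modulus. The case z = a is set apart because the factor
    at conj a is then a division by zero. *)
Lemma blaschke_conj a z : upper a -> upper z ->
  normc (blaschke a (Num.conj z)) * normc (blaschke a z) = 1 \/ z = a.
Proof.
move=> ua uz; have [->|za] := eqVneq z a; [by right|left].
have h1 : normc (z - a) != 0 by rewrite normc_eq0 subr_eq0.
have h2 : normc (z - Num.conj a) != 0 by rewrite normc_eq0 upper_sub_conj.
rewrite !normcM_eq !normcV_eq -[normc (Num.conj z - a)]normc_conj cjB conjK.
have -> : normc (Num.conj z - Num.conj a) = normc (z - a) by rewrite -cjB normc_conj.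
by field; rewrite h1 h2.
Qed.

(* Since [re (jfactor a z) >= 1 + jweight a z], the products of the inverses of
   [jfactor] dominate a telescoping sum of the weights [jweight]. *)
Definition jfactor (a z : C) : C := 1 + 'i * (im a)%:C / (z - Num.conj a).
Definition jweight (a z : C) : R := (im a / normc (z - Num.conj a)) ^+ 2.

Lemma jfactor_re a z : upper a -> upper z ->
  re (jfactor a z) = 1 + im a * (im z + im a) / normc (z - Num.conj a) ^+ 2.
Proof.
move=> ua uz; rewrite reD [X in _ + X]reM reV imV !(reM, imM, reB, imB, reJ, imJ)/=; ring.
Qed.

Lemma jweight_le a z : upper a -> upper z -> 1 + jweight a z <= normc (jfactor a z).
Proof.
move=> ua uz; apply: le_trans (le_trans (ler_norm _) (normc_re _)).
rewrite jfactor_re// lerD2l /jweight expr_div_n ler_wpM2r ?invr_ge0 ?sqr_ge0//.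
move: ua uz; rewrite /upper; nra.
Qed.

Lemma jfactor_neq0 a z : upper a -> upper z -> jfactor a z != 0.
Proof.
move=> ua uz; rewrite -normc_gt0; apply: lt_le_trans (jweight_le ua uz).
by rewrite ltr_pwDl// sqr_ge0.
Qed.

Lemma upper_analytic_jfactor a : upper a -> upper_analytic (jfactor a).
Proof.
move=> ua z uz; apply: derivableD_c; first exact: derivable_cst_c.
by apply: derivableM_c; [exact: derivable_cst_c|exact: upper_analytic_inv_conj].
Qed.

(** Put x = |blaschke|^2 and N = |z - conj a|^2, so that 1 - x = 4 Im z Im a / N. Since Im a <= Im
    z, the excess |jfactor|^2 - 1 = (2 Im a Im z + 3 (Im a)^2) / N is at most 5/4 (1 - x), and (1 +
    5/4 (1 - x)) x^2 <= 1 on [0, 1]. *)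
Lemma jfactor_blaschke a z : upper a -> upper z -> im a <= im z ->
  normc (jfactor a z) * normc (blaschke a z) ^+ 2 <= 1.
Proof.
move=> ua uz az; rewrite -(@ler_pXn2r _ 2) ?nnegrE ?mulr_ge0 ?sqr_ge0 ?normc_ge0//.
rewrite expr1n exprMn.
have bl := normc_blaschke2 ua uz; have b1 := blaschke_le1 ua uz.
have b0 := normc_ge0 (blaschke a z).
set x := normc (blaschke a z) ^+ 2 in bl *.
have x0 : 0 <= x by rewrite sqr_ge0.
have x1 : x <= 1 by rewrite expr_le1.
have N0 : normc (z - Num.conj a) ^+ 2 != 0 by rewrite sqrf_eq0 normc_eq0 upper_sub_conj.
have J : normc (jfactor a z) ^+ 2 <= 1 + 5 / 4 * (1 - x).
  rewrite bl normc2 jfactor_re//.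
  have -> : im (jfactor a z) = im a * (re z - re a) / normc (z - Num.conj a) ^+ 2.
    by rewrite imD [X in _ + X]imM reV imV !(reM, imM, reB, imB, reJ, imJ)/=; ring.
  have NE : normc (z - Num.conj a) ^+ 2 = (re z - re a) ^+ 2 + (im z + im a) ^+ 2.
    by rewrite normc2 !(reB, imB, reJ, imJ) opprK.
  set N := normc _ ^+ 2 in NE N0 *.
  have -> : (1 + im a * (im z + im a) / N) ^+ 2 + (im a * (re z - re a) / N) ^+ 2 =
    1 + (2 * im a * (im z + im a) + im a ^+ 2 / N * N) / N.
    have E : (re z - re a) ^+ 2 = N - (im z + im a) ^+ 2 by rewrite NE addrK.
    have -> : (im a * (re z - re a) / N) ^+ 2 = im a ^+ 2 * (re z - re a) ^+ 2 / N ^+ 2 by field.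
    by rewrite E; field.
  have -> : 5 / 4 * (1 - (1 - 4 * im z * im a / N)) = (5 * im z * im a) / N by field.
  rewrite lerD2l divfK// ler_wpM2r ?invr_ge0 ?sqr_ge0//.
  move: ua uz az; rewrite /upper; nra.
apply: le_trans (ler_wpM2r (sqr_ge0 _) J) _.
rewrite -subr_ge0.
have -> : 1 - (1 + 5 / 4 * (1 - x)) * x ^+ 2 = (1 - x) * (1 + x - 5 / 4 * x ^+ 2) by ring.
by rewrite mulr_ge0 ?subr_ge0//; nra.
Qed.

Lemma jfactorxx a : upper a -> normc (jfactor a a) = 3 / 2.
Proof.
move=> ua; rewrite (_ : jfactor a a = (3 / 2)%:C).
  by rewrite normc_real ger0_norm.
apply: complex_ext; rewrite ?(jfactor_re ua ua) ?imD ?imM ?reV ?imV.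
  rewrite normc2 !(reB, imB, reJ, imJ) /= subrr expr0n add0r opprK; field.
  by rewrite gt_eqF// addr_gt0.
by rewrite !(reM, imM, reB, imB, reJ, imJ)/=; ring.
Qed.

Lemma jsquare_bound a z : upper a -> upper z ->
  normc ((2 * 'i * (im a)%:C / (z - Num.conj a)) ^+ 2) = 4 * jweight a z.
Proof.
move=> ua uz; rewrite normcX_eq !normcM_eq normcV_eq normc_i normc_real gtr0_norm//.
have -> : normc (2 : C) = 2 by have := normc_real (2 : R); rewrite ger0_norm// => <-; congr normc; apply: complex_ext; rewrite ?reD ?imD/= ?addr0.
by rewrite mulr1 -mulrA exprMn /jweight; congr (_ * _); ring.
Qed.

Lemma jsquarexx (a : C) : upper a -> 2 * 'i * (im a)%:C / (a - Num.conj a) = 1.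
Proof.
move=> ua; have := upper_sub_conj ua ua => h.
rewrite (_ : 2 * 'i * (im a)%:C = a - Num.conj a) ?divff//.
by apply: complex_ext; rewrite !(reM, imM, reB, imB, reJ, imJ)/=; ring.
Qed.

End BlaschkeFactors.

(** * Jones' interpolation at finitely many nodes *)

Section Interpolation.
Variables (R : realType) (w : nat -> R[i]) (s : seq nat) (delta : R).
Local Notation C := R[i].
Hypotheses (uw : forall k, upper (w k)) (us : uniq s) (delta0 : 0 < delta).
Hypothesis sep : forall j, j \in s ->
  delta <= \prod_(k <- s | k != j) normc (blaschke (w k) (w j)).

Lemma sep_sub x t : x \in s -> uniq t -> {subset t <= s} -> x \notin t ->
  delta <= \prod_(k <- t) normc (blaschke (w k) (w x)).
Proof.
move=> xs ut ts xt; apply: le_trans (sep xs) _.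
rewrite (bigID (fun k => k \in t))/=.
have -> : \prod_(k <- t) normc (blaschke (w k) (w x)) =
    \prod_(k <- s | (k != x) && (k \in t)) normc (blaschke (w k) (w x)).
  rewrite -[RHS]big_filter; apply: perm_big; apply: uniq_perm => // [|k].
    exact: filter_uniq.
  rewrite mem_filter; case kt : (k \in t); rewrite ?andbF//= (ts _ kt) !andbT.
  by apply/esym; apply: contraNneq xt => <-.
rewrite ler_piMr ?prodr_ge0// => [k _|]; first exact: normc_ge0.
by apply: prod_le1 => k _; rewrite normc_ge0 blaschke_le1.
Qed.

(** By [jfactor_blaschke] the product of all |jfactor| |blaschke|^2 is at most 1, and by separation
    the Blaschke part of it is at least delta^2. *)
Lemma jfactor_prod x t : x \in s -> uniq t -> {subset t <= s} -> x \notin t ->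
  (forall k, k \in t -> im (w k) <= im (w x)) ->
  \prod_(k <- t) normc (jfactor (w k) (w x)) <= (delta ^+ 2)^-1.
Proof.
move=> xs ut ts xt tx; have d2 : 0 < delta ^+ 2 by rewrite exprn_gt0.
have h := sep_sub xs ut ts xt.
rewrite -[leRHS]mul1r ler_pdivlMr//.
apply: (@le_trans _ _ (\prod_(k <- t) (normc (jfactor (w k) (w x)) * normc (blaschke (w k) (w x)) ^+ 2))).
  rewrite big_split/= ler_wpM2l ?prodr_ge0// => [k _|]; first exact: normc_ge0.
  by rewrite prodrXl ler_pXn2r ?nnegrE ?(ltW delta0)// (le_trans (ltW delta0) h).
rewrite big_seq; apply: prod_le1 => k kt.
by rewrite mulr_ge0 ?sqr_ge0 ?normc_ge0//= jfactor_blaschke// tx.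
Qed.

(* Jones' explicit solution of the interpolation problem: ordering the nodes by
   height makes [sum_j r_j prod_(k <= j) (1 + r_k)^-1] telescope. *)
Lemma jones_sum (eps : nat -> C) (t : seq nat) : (forall k, normc (eps k) <= 1) ->
  uniq t -> {subset t <= s} -> sorted (fun a b => im (w b) <= im (w a)) t ->
  exists phi : C -> C, [/\ upper_analytic phi,
    forall z, upper z -> normc (phi z) <=
      6 / delta ^+ 3 * (1 - \prod_(k <- t) (1 + jweight (w k) z)^-1) &
    forall j, j \in s -> phi (w j) = if j \in t then eps j else 0].
Proof.
move=> eps1; elim: t => [|x t IH] /=.
  move=> _ _ _; exists (fun=> 0); split => [z _|z _|//]; first exact: derivable_cst_c.
  by rewrite big_nil subrr mulr0 normc_0.
move=> /andP[xt ut] ts st.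
have xs : x \in s by apply: ts; rewrite mem_head.
have ts' : {subset t <= s} by move=> k kt; apply: ts; rewrite inE kt orbT.
have [phi [p1 p2 p3]] := IH ut ts' (path_sorted st).
(* The head of the sorted list is the highest of the nodes listed. *)
have tx : forall k, k \in t -> im (w k) <= im (w x).
  apply/allP; apply: order_path_min st => a b c ab bc; exact: le_trans ab.
pose D := \prod_(k <- s | k != x) blaschke (w k) (w x).
have D0 : delta <= normc D by rewrite normc_prod sep.
have Dn : D != 0 by rewrite -normc_gt0 (lt_le_trans delta0).
pose E := \prod_(k <- x :: t) jfactor (w k) (w x).
(* The Blaschke product makes F vanish at the other nodes, the square brings in the weight 4
   [jweight], and the inverse factors make the sum telescope. D and E normalize the value at w x to
   eps x. *)
pose F z := eps x * (D^-1 * \prod_(k <- s | k != x) blaschke (w k) z) *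
  (2 * 'i * (im (w x))%:C / (z - Num.conj (w x))) ^+ 2 *
  (E * \prod_(k <- x :: t) (jfactor (w k) z)^-1).
have aF : upper_analytic F.
  move=> z uz; apply: derivableM_c; [apply: derivableM_c; [apply: derivableM_c|]|].
  - exact: derivable_cst_c.
  - apply: derivableM_c; first exact: derivable_cst_c.
    apply: (upper_analytic_prod _ uz) => k _; exact: upper_analytic_blaschke.
  - have h : derivable ((fun z => 2 * 'i * (im (w x))%:C / (z - Num.conj (w x))) : C^o -> C^o) z 1.
      apply: derivableM_c; first exact: derivable_cst_c.
      exact: upper_analytic_inv_conj.
    exact: derivableM_c.
  - apply: derivableM_c; first exact: derivable_cst_c.
    apply: (upper_analytic_prod _ uz) => k _ z' uz'; apply: derivableV_c.
      exact: jfactor_neq0.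
    exact: upper_analytic_jfactor.
exists (fun z => F z + phi z); split => [z uz|z uz|j js].
- by apply: derivableD_c; [exact: aF|exact: p1].
- apply: le_trans (normcD_le _ _) _.
  set P := \prod_(k <- t) (1 + jweight (w k) z)^-1.
  have r0 k : 0 < 1 + jweight (w k) z by rewrite ltr_pwDl// sqr_ge0.
  have P0 : 0 <= P by apply: prodr_ge0 => k _; rewrite invr_ge0 ltW.
  have hE : normc E <= 3 / 2 / delta ^+ 2.
    rewrite normc_prod big_cons jfactorxx// ler_pM2l ?divr_gt0//.
    exact: jfactor_prod.
  have hJ : normc (\prod_(k <- x :: t) (jfactor (w k) z)^-1) <= (1 + jweight (w x) z)^-1 * P.
    rewrite normc_prod big_cons; apply: ler_pM; rewrite ?normc_ge0//.
    - by apply: prodr_ge0 => k _; exact: normc_ge0.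
    - by rewrite normcV_eq lef_pV2 ?posrE ?jweight_le// normc_gt0 jfactor_neq0.
    - apply: ler_prod => k _; rewrite normc_ge0/= normcV_eq lef_pV2 ?posrE ?jweight_le//.
      by rewrite normc_gt0 jfactor_neq0.
  have hB : normc (\prod_(k <- s | k != x) blaschke (w k) z) <= 1.
    rewrite normc_prod; apply: prod_le1 => k _.
    by rewrite normc_ge0 blaschke_le1.
  (* 1 / delta from D, 4 from the square and (3/2) / delta^2 from E multiply to 6 / delta^3. *)
  have hF : normc (F z) <= 6 / delta ^+ 3 * (jweight (w x) z * ((1 + jweight (w x) z)^-1 * P)).
    rewrite /F [normc (_ * (E * _))]normcM_eq [normc (_ * _ ^+ 2)]normcM_eq.
    rewrite [normc (eps x * _)]normcM_eq [normc (D^-1 * _)]normcM_eq [normc (E * _)]normcM_eq.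
    rewrite jsquare_bound// normcV_eq.
    have -> : 6 / delta ^+ 3 * (jweight (w x) z * ((1 + jweight (w x) z)^-1 * P)) =
       1 * (delta^-1 * 1) * (4 * jweight (w x) z) *
       (3 / 2 / delta ^+ 2 * ((1 + jweight (w x) z)^-1 * P)).
      by field; rewrite !gt_eqF.
    have j0 : 0 <= jweight (w x) z by exact: sqr_ge0.
    have jj : 0 <= 4 * jweight (w x) z by exact: mulr_ge0.
    set b := normc (\prod_(k <- s | k != x) blaschke (w k) z) in hB *.
    have b0 : 0 <= b by exact: normc_ge0.
    have n0 : 0 <= normc (eps x) * ((normc D)^-1 * b).
      by rewrite mulr_ge0 ?normc_ge0// mulr_ge0// invr_ge0 normc_ge0.
    have n1 : normc (eps x) * ((normc D)^-1 * b) <= 1 * (delta^-1 * 1).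
      apply: ler_pM; [exact: normc_ge0| |exact: eps1|].
        by rewrite mulr_ge0// invr_ge0 normc_ge0.
      apply: ler_pM => //; first by rewrite invr_ge0 normc_ge0.
      by rewrite lef_pV2 ?posrE// (lt_le_trans delta0).
    apply: ler_pM; [exact: mulr_ge0|by rewrite mulr_ge0 ?normc_ge0|exact: ler_wpM2r|].
    by apply: ler_pM; rewrite ?normc_ge0.
  apply: le_trans (lerD hF (p2 z uz)) _.
  rewrite -mulrDr ler_wpM2l ?divr_ge0 ?exprn_ge0 ?(ltW delta0)// big_cons -/P.
  (* Telescoping, with r the weight at x: r P / (1 + r) + (1 - P) = 1 - P / (1 + r). *)
  rewrite le_eqVlt; apply/orP; left; apply/eqP; field.
  by rewrite gt_eqF.
- rewrite p3// inE; case: eqVneq => [->|jx].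
    rewrite (negbTE xt) addr0 /F jsquarexx// expr1n mulr1 -/D mulVf// mulr1.
    rewrite /E -big_split/= big1 ?mulr1// => k _; rewrite divff//.
    exact: jfactor_neq0.
  rewrite /F /= (_ : \prod_(k <- s | k != x) blaschke (w k) (w j) = 0) ?mulr0 ?mul0r ?add0r//.
  rewrite (big_rem j)//= jx /blaschke subrr !mul0r//.
Qed.

Lemma jones (eps : nat -> C) : (forall k, normc (eps k) <= 1) ->
  exists phi : C -> C, [/\ upper_analytic phi,
    forall z, upper z -> normc (phi z) <= 6 / delta ^+ 3 &
    forall j, j \in s -> phi (w j) = eps j].
Proof.
move=> eps1; pose r a b := im (w b) <= im (w a).
have [|||phi [p1 p2 p3]] := @jones_sum eps (sort r s) eps1.
- by rewrite sort_uniq.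
- by move=> k; rewrite mem_sort.
- by apply: sort_sorted => a b; exact: le_total.
exists phi; split => // [z uz|j js]; last by rewrite p3// mem_sort js.
apply: le_trans (p2 z uz) _; rewrite ler_piMr ?divr_ge0 ?exprn_ge0 ?(ltW delta0)//.
rewrite gerBl; apply: prodr_ge0 => k _; rewrite invr_ge0 addr_ge0// sqr_ge0//.
Qed.

End Interpolation.

Section Signs.
Variables (R : realType) (V : lmodType R[i]) (S : set V) (dot : V -> V -> R[i]).
Hypothesis ph : prehilbert S dot.

(** A greedy choice: by the parallelogram identity one of y + x_n and y - x_n has squared norm at
    most n2 y + n2 x_n, and the other one at least that. *)
Lemma signs (le : bool) (n : nat) (x : nat -> V) : (forall i, S (x i)) ->
  exists eps : nat -> R[i], (forall i, eps i = 1 \/ eps i = -1) /\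
    if le then n2 dot (\sum_(i < n) eps i *: x i) <= \sum_(i < n) n2 dot (x i)
    else \sum_(i < n) n2 dot (x i) <= n2 dot (\sum_(i < n) eps i *: x i).
Proof.
move=> Sx; elim: n => [|n [eps [e1 IH]]].
  by exists (fun=> 1); split; [left|rewrite !big_ord0 (n2_0 ph) if_same].
pose y := \sum_(i < n) eps i *: x i.
have Sy : S y by apply: (ph_sum ph) => i _; exact: (phZ ph).
pose ext (c : R[i]) i := if (i < n)%N then eps i else c.
have extE (c : R[i]) : \sum_(i < n.+1) ext c i *: x i = y + c *: x n.
  rewrite big_ord_recr/= /ext ltnn; congr (_ + _); apply: eq_bigr => i _.
  by rewrite ltn_ord.
have ext1 (c : R[i]) : c = 1 \/ c = -1 -> forall i, ext c i = 1 \/ ext c i = -1.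
  by move=> hc i; rewrite /ext; case: ifP.
have pl := parallelogram ph Sy (Sx n); rewrite -/y in IH.
have [h|h] := leP (n2 dot (y - x n)) (n2 dot (y + x n)); case: le IH => IH.
- exists (ext (-1)); split; first by apply: ext1; right.
  by rewrite extE scaleN1r big_ord_recr/=; lra.
- exists (ext 1); split; first by apply: ext1; left.
  by rewrite extE scale1r big_ord_recr/=; lra.
- exists (ext 1); split; first by apply: ext1; left.
  by rewrite extE scale1r big_ord_recr/=; lra.
- exists (ext (-1)); split; first by apply: ext1; right.
  by rewrite extE scaleN1r big_ord_recr/=; lra.
Qed.

End Signs.

Section HardyPrehilbert.
Variable R : realType.
Local Notation C := R[i].

Lemma hardy_prehilbert : prehilbert (@hardy2 R) (@hardy_dot R).
Proof.
split; first by split; [exact: hardy2_0|move=> c x y; exact: hardy2_lin].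
- exact: hdot_linl.
- exact: hdotC.
- exact: hnorm2_ge0.
Qed.
Let ph := hardy_prehilbert.

Lemma hnorm2_kernel (w : C) : upper w -> hnorm2 (hkernel w) = (2 * im w)^-1.
Proof.
move=> uw; have uw' : 0 < im w by [].
rewrite /hnorm2 hdot_kernel//; last exact: hardy2_kernel.
rewrite /hkernel uw' reM reV imV normc2 !(reB, imB, reJ, imJ)/= subrr opprK.
have w2 : im w + im w != 0 by rewrite gt_eqF// addr_gt0.
rewrite expr0n add0r (_ : 2 * im w = im w + im w); last by ring.
by field.
Qed.

Lemma hardy_sum_mem (n : nat) (c : nat -> C) (f : nat -> C -> C^o) :
  (forall i, hardy2 (f i)) -> hardy2 (\sum_(i < n) c i *: f i).
Proof. by move=> h; apply: (ph_sum ph) => i _; exact: (phZ ph). Qed.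

(* The adjoint of multiplication by [phi] maps the kernel at [w] to
   [conj (phi w)] times itself. *)
Lemma multiplier_adjoint (phi : C -> C) (M : R) (w : nat -> C) (n : nat) (c : nat -> C) :
  0 <= M -> upper_analytic phi -> (forall z, upper z -> normc (phi z) <= M) ->
  (forall k, upper (w k)) ->
  hnorm2 (\sum_(i < n) (Num.conj (phi (w i)) * c i) *: hkernel (w i)) <=
  M ^+ 2 * hnorm2 (\sum_(i < n) c i *: hkernel (w i)).
Proof.
move=> M0 pa pM uw.
have aux (P G : R) : 0 <= P -> 0 <= G -> P ^+ 2 <= M ^+ 2 * P * G -> P <= M ^+ 2 * G.
  rewrite le_eqVlt => /predU1P[<-|np] ng h2; first by rewrite mulr_ge0// sqr_ge0.
  by rewrite -(ler_pM2l np) -expr2 mulrCA mulrA.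
have hk i := hardy2_kernel (uw i).
set g := \sum_(i < n) c i *: _; set p := \sum_(i < n) _.
have hg : hardy2 g by exact: (hardy_sum_mem n c hk).
have hp : hardy2 p by exact: (hardy_sum_mem n (fun i => Num.conj (phi (w i)) * c i) hk).
have [hpp hpn] := hardy2_mul M0 pa pM hp.
(* Kernels evaluate, so both sides are the sum of phi (w_i) conj (c_i) p (w_i). *)
have E : hardy_dot p p = hardy_dot (fun z => phi z * p z) g.
  rewrite {2}/p (dot_sumr ph); [|exact: hk|exact: hp].
  rewrite /g (dot_sumr ph); [|exact: hk|exact: hpp].
  apply: eq_bigr => i _.
  by rewrite !hdot_kernel// cjM conjK mulrAC mulrC.
have := cauchy_schwarz ph hpp hg; rewrite -E (dot_n2 ph hp) normc_real.
rewrite (ger0_norm (n2_ge0 ph hp)) => h.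
have np := hnorm2_ge0 hp; have ng := hnorm2_ge0 hg.
have h2 : hnorm2 p ^+ 2 <= M ^+ 2 * hnorm2 p * hnorm2 g.
  apply: le_trans h _; rewrite ler_wpM2r//.
exact: aux np ng h2.
Qed.

Lemma model_eigenvector_kernel (w : C) : upper w ->
  model_eigenvector (Num.conj w) = (- 'i * (Num.sqrt (2 * im w))%:C) *: hkernel w.
Proof.
move=> uw; apply/funext => z; rewrite /model_eigenvector [RHS](_ : _ =
  - 'i * (Num.sqrt (2 * im w))%:C * hkernel w z)// /hkernel.
case: ifP => _; last by rewrite mulr0.
rewrite imJ mulrN mulNr opprK mulrA; congr (_ / _).
by rewrite mulrAC mulNr sqr_ic opprK mul1r.
Qed.

Lemma hardy2_eigenvector (w : C) : upper w -> hardy2 (model_eigenvector (Num.conj w)).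
Proof. by move=> uw; rewrite model_eigenvector_kernel//; apply: (phZ ph); exact: hardy2_kernel. Qed.

Lemma hnorm2_eigenvector (w : C) : upper w -> hnorm2 (model_eigenvector (Num.conj w)) = 1.
Proof.
move=> uw; have uw' : 0 < im w by []; rewrite model_eigenvector_kernel//.
rewrite [LHS](n2Z ph); last exact: hardy2_kernel.
rewrite [n2 _ _]hnorm2_kernel// normcM_eq normc_opp normc_i mul1r normc_real.
rewrite real_normK ?num_real// sqr_sqrtr ?mulr_ge0 ?ltW// mulfV// gt_eqF//.
exact: mulr_gt0.
Qed.

(** * Two-sided Riesz bounds from separation *)

Section RieszBounds.
Variables (w : nat -> C) (delta : R).
Hypotheses (uw : forall k, upper (w k)) (delta0 : 0 < delta).
Hypothesis sep : forall n j, (j < n)%N ->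
  delta <= \prod_(0 <= k < n | k != j) normc (blaschke (w k) (w j)).
Local Notation f := (fun j => model_eigenvector (Num.conj (w j))).

Lemma unconditional (n : nat) (c eps : nat -> C) :
  (forall i, eps i = 1 \/ eps i = -1) ->
  hnorm2 (\sum_(i < n) (eps i * c i) *: f i) <=
  (6 / delta ^+ 3) ^+ 2 * hnorm2 (\sum_(i < n) c i *: f i).
Proof.
move=> he; have e1 k : normc (eps k) <= 1.
  by case: (he k) => ->; rewrite ?normc_opp normc_1.
have hs j : j \in index_iota 0 n -> delta <= \prod_(k <- index_iota 0 n | k != j) normc (blaschke (w k) (w j)).
  by rewrite mem_index_iota => /andP[_ jn]; exact: sep.
have [phi [p1 p2 p3]] := jones uw (iota_uniq _ _) delta0 hs e1.
have M0 : 0 <= 6 / delta ^+ 3 by rewrite divr_ge0// exprn_ge0// ltW.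
have := multiplier_adjoint n (fun i => c i * (- 'i * (Num.sqrt (2 * im (w i)))%:C)) M0 p1 p2 uw.
rewrite (eq_bigr (fun i : 'I_n => (eps i * c i) *: f i)); last first.
  move=> i _; rewrite p3 ?mem_index_iota ?ltn_ord// model_eigenvector_kernel// scalerA mulrA.
  congr (_ * _ *: _); case: (he i) => ->; by rewrite ?cjN cj1.
suff -> : \sum_(i < n) (c i * (- 'i * (Num.sqrt (2 * im (w i)))%:C)) *: hkernel (w i) =
  \sum_(i < n) c i *: f i by [].
by apply: eq_bigr => i _; rewrite (model_eigenvector_kernel (uw i)) scalerA.
Qed.

Lemma sum_n2_eigenvectors (n : nat) (c : nat -> C) :
  \sum_(i < n) n2 (@hardy_dot R) (c i *: f i) = \sum_(i < n) normc (c i) ^+ 2.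
Proof.
apply: eq_bigr => i _; rewrite (n2Z ph); last exact: hardy2_eigenvector.
by rewrite [n2 _ _]hnorm2_eigenvector// mulr1.
Qed.

(** Some choice of signs makes the norm at least as large as the sum of squares; [unconditional]
    then removes the signs. *)
Lemma riesz_lower (n : nat) (c : nat -> C) :
  \sum_(i < n) normc (c i) ^+ 2 <=
  (6 / delta ^+ 3) ^+ 2 * hnorm2 (\sum_(i < n) c i *: f i).
Proof.
have Sx i : hardy2 (c i *: f i) by apply: (phZ ph); exact: hardy2_eigenvector.
have [eps [e1 h]] := signs ph false n Sx.
rewrite -sum_n2_eigenvectors; apply: le_trans h _.
rewrite (eq_bigr (fun i : 'I_n => (eps i * c i) *: f i)); last by move=> i _; rewrite scalerA.
exact: unconditional.
Qed.

(** Some choice of signs makes the norm at most the sum of squares; applying the same signs a second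
    time restores the coefficients, at the cost of the constant. *)
Lemma riesz_upper (n : nat) (c : nat -> C) :
  hnorm2 (\sum_(i < n) c i *: f i) <=
  (6 / delta ^+ 3) ^+ 2 * \sum_(i < n) normc (c i) ^+ 2.
Proof.
have Sx i : hardy2 (c i *: f i) by apply: (phZ ph); exact: hardy2_eigenvector.
have [eps [e1 h]] := signs ph true n Sx.
have := unconditional n (fun i => eps i * c i) e1.
rewrite (eq_bigr (fun i : 'I_n => c i *: f i)); last first.
  by move=> i _; rewrite mulrA; case: (e1 i) => ->; rewrite ?mulrNN !mul1r.
move=> h1; apply: le_trans h1 _; rewrite ler_wpM2l ?sqr_ge0//.
rewrite -sum_n2_eigenvectors; apply: le_trans h; rewrite le_eqVlt; apply/orP; left.
apply/eqP; congr (hnorm2 _); apply: eq_bigr => i _; by rewrite scalerA.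
Qed.

End RieszBounds.

(** * Partial fractions and test vectors for the lower bound *)

Section PartialFractions.
Variable w : nat -> C.
Hypotheses (uw : forall k, upper (w k)) (winj : injective w).
Local Notation f := (fun j => model_eigenvector (Num.conj (w j))).

Lemma conj_node_neq k m : k != m -> Num.conj (w m) - Num.conj (w k) != 0.
Proof.
move=> km; rewrite subr_eq0; apply: contraNneq km => /(congr1 (fun z => Num.conj z)).
by rewrite !conjK => /winj ->.
Qed.

(* Only the coefficient at [j] is needed explicitly: it is the product of the
   residue factors, i.e. the Blaschke product at the reflected node. *)
Lemma partial_fractions (j : nat) (t : seq nat) : uniq t -> j \notin t ->
  exists c : nat -> C, c j = \prod_(k <- t) blaschke (w k) (Num.conj (w j)) /\
    forall z, upper z -> (\prod_(k <- t) blaschke (w k) z) / (z - Num.conj (w j)) =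
      \sum_(m <- j :: t) c m / (z - Num.conj (w m)).
Proof.
elim: t => [|x t IH] /=.
  by move=> _ _; exists (fun=> 1); split => [|z _]; rewrite ?big_nil// big_cons !big_nil addr0.
move=> /andP[xt ut]; rewrite inE negb_or => /andP[jx jt].
have [c [cj H]] := IH ut jt.
(* Multiplying 1 / (z - conj w_m) by the factor of w_x multiplies the old coefficient by the value
   of that factor at conj w_m and creates the pole conj w_x with residue (conj w_x - w_x) / (conj
   w_x - conj w_m). *)
exists (fun m => if m == x then \sum_(m <- j :: t) c m *
    ((Num.conj (w x) - w x) / (Num.conj (w x) - Num.conj (w m)))
  else c m * blaschke (w x) (Num.conj (w m))); split.
  by rewrite (negbTE jx) big_cons cj mulrC.
move=> z uz; rewrite big_cons -mulrA H//.
have nx m : m \in j :: t -> m != x.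
  by rewrite inE => /predU1P[->//|mt]; apply: contraNneq xt => <-.
have -> (F : nat -> C) : \sum_(m <- [:: j, x & t]) F m = F x + \sum_(m <- j :: t) F m.
  by rewrite !big_cons addrCA.
rewrite eqxx mulr_sumr mulr_suml -big_split/= [LHS]big_seq [RHS]big_seq.
apply: eq_bigr => m /nx mx; rewrite (negbTE mx).
have h1 := upper_sub_conj uz (uw m); have h2 := upper_sub_conj uz (uw x).
have h3 := conj_node_neq mx.
have h4 : Num.conj (w m) - Num.conj (w x) != 0 by rewrite conj_node_neq// eq_sym.
by rewrite /blaschke; field; rewrite h1 h2 h3 h4.
Qed.

Lemma dual_combination (n j : nat) : (j < n)%N -> exists c : nat -> C,
  normc (c j) * \prod_(0 <= k < n | k != j) normc (blaschke (w k) (w j)) = 1 /\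
  hnorm2 (\sum_(m < n) c m *: f m) <= 1.
Proof.
move=> jn; pose t := [seq k <- index_iota 0 n | k != j].
have ut : uniq t by rewrite filter_uniq// iota_uniq.
have jt : j \notin t by rewrite mem_filter eqxx.
have [c [cj H]] := partial_fractions ut jt.
pose r m : C := (Num.sqrt (2 * im (w m)))%:C.
have r0 m : r m != 0.
  rewrite -normc_gt0 normc_real normr_gt0 gt_eqF// sqrtr_gt0.
  by rewrite mulr_gt0//; exact: uw.
have rE m z : upper z -> f m z = r m / (z - Num.conj (w m)).
  by rewrite /model_eigenvector /upper => ->; rewrite imJ mulrN mulNr opprK.
(* The eigenvectors are r_m / (z - conj w_m), so the coefficients are rescaled; at m = j the two
   factors cancel. *)
exists (fun m => r j * c m / r m); split.
  rewrite mulrAC divff// mul1r cj normc_prod big_filter -big_split/= big1// => k kj.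
  by case: (blaschke_conj (uw k) (uw j)) => // /winj jk; rewrite jk eqxx in kj.
pose phi z := \prod_(k <- t) blaschke (w k) z.
have pa : upper_analytic phi.
  by apply: upper_analytic_prod => k _; exact: upper_analytic_blaschke.
have p1 z : upper z -> normc (phi z) <= 1.
  move=> uz; rewrite normc_prod; apply: prod_le1 => k _.
  by rewrite normc_ge0 blaschke_le1.
have [_ h] := hardy2_mul ler01 pa p1 (hardy2_eigenvector (uw j)).
rewrite expr1n mul1r (hnorm2_eigenvector (uw j)) in h.
suff -> : \sum_(m < n) (r j * c m / r m) *: f m = (fun z => phi z * f j z) by [].
apply/funext => z; rewrite fct_sumE; apply/esym.
have [uz|uz] := pselect (upper z); last first.
  have f0 m : f m z = 0 by rewrite /model_eigenvector; move/negP: uz => /negbTE ->.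
  rewrite f0 mulr0 big1// => m _.
  by rewrite [LHS](_ : _ = r j * c m / r m * f m z)// f0 mulr0.
rewrite rE// mulrCA H// mulr_sumr.
have pt : perm_eq (j :: t) (index_iota 0 n).
  apply: uniq_perm; [by rewrite /= jt|exact: iota_uniq|move=> k].
  rewrite inE mem_filter; case: eqVneq => [->|//]; by rewrite mem_index_iota jn.
rewrite (perm_big _ pt)/= big_mkord; apply: eq_bigr => m _.
rewrite [RHS](_ : _ = r j * c m / r m * f m z)// rE//.
move: (r0 m) (upper_sub_conj uz (uw m)); move: (r m) (r j) (z - _) => a b d a0 d0.
by field; rewrite a0 d0.
Qed.

End PartialFractions.

End HardyPrehilbert.

(** * Symmetric operators and boundary triplets *)

Section HilbertSpace.
Variables (R : realType) (H : completeNormedModType R[i]).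
Variable ip : {dot H for Num.conj}.
Hypothesis ip_norm : norm_from_dot ip.
Local Notation C := R[i].
Local Notation N := (n2 ip).
Implicit Types (x y : H).

Lemma ip_prehilbert : prehilbert setT ip.
Proof.
split=> [//|c x y z _ _ _|x y _ _|x _].
- by rewrite linearDl linearZl_LR.
- by rewrite hermC expr0 mul1r.
- have : 0 <= ip x x by rewrite -ip_norm exprn_ge0.
  by rewrite lecE => /andP[].
Qed.
Let ph := ip_prehilbert.

Lemma N_ge0 x : 0 <= N x. Proof. exact: (n2_ge0 ph). Qed.

Lemma norm_n2 x : `|x| = (Num.sqrt (N x))%:C.
Proof.
apply/eqP; rewrite -(@eqrXn2 _ 2)//; last by rewrite lecR sqrtr_ge0.
rewrite ip_norm (dot_n2 ph)// -(rmorphXn (real_complex R))/= sqr_sqrtr//.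
exact: N_ge0.
Qed.

Lemma ip_definite x : N x = 0 -> x = 0.
Proof. by move=> h; apply/eqP; rewrite -normr_eq0 norm_n2 h sqrtr0. Qed.

Lemma norm_le_n2 x (r : R) : 0 <= r -> (`|x| <= r%:C) = (N x <= r ^+ 2).
Proof.
move=> r0; rewrite norm_n2 lecR -[RHS](@ler_sqrt _ (N x))//; last by rewrite sqr_ge0.
by rewrite sqrtr_sqr ger0_norm.
Qed.

Lemma norm_lt_n2 x (r : R) : 0 <= r -> (`|x| < r%:C) = (N x < r ^+ 2).
Proof.
move=> r0; have [->|r1] := eqVneq r 0.
  by rewrite norm_n2 ltcR expr0n/= !ltNge sqrtr_ge0 N_ge0.
rewrite norm_n2 ltcR -[RHS](@ltr_sqrt _ (N x))//; last by rewrite exprn_gt0// lt0r r1.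
by rewrite sqrtr_sqr ger0_norm.
Qed.

Lemma ip_complete : dcomplete ip setT.
Proof.
move=> u _ cu.
have : cauchy (u @ \oo).
  apply: cauchy_exP => _ /pos_complexP[r r0 ->].
  have r2 : 0 < (r / 2) ^+ 2 by rewrite exprn_gt0// divr_gt0.
  have [M HM] := cu _ r2; exists (u M); exists M => // n /= Mn.
  rewrite -ball_normE/= norm_lt_n2 ?ltW//; apply: le_lt_trans (HM M n (leqnn _) Mn) _.
  by rewrite ltr_pXn2r ?nnegrE ?divr_ge0 ?(ltW r0)// gtr_pMr// invf_lt1// ltr1n.
move=> /cauchy_cvg /cvg_ex[p up]; exists p => // e e0.
have se : 0 < Num.sqrt e by rewrite sqrtr_gt0.
move/cvgrPdist_le: up => /(_ (Num.sqrt e)%:C); rewrite pos_realc => /(_ se)[M _ HM].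
exists M => n Mn; rewrite (n2_distC ph)//.
by have := HM n Mn; rewrite /= norm_le_n2 ?sqrtr_ge0// sqr_sqrtr// ltW.
Qed.

Lemma dense_n2 (S : set H) : dense S ->
  forall x (e : R), 0 < e -> exists2 y, S y & N (x - y) <= e.
Proof.
move=> dS x e e0; have se : 0 < Num.sqrt e by rewrite sqrtr_gt0.
have [||y [xy Sy]] := dS (ball x (Num.sqrt e)%:C).
- by exists x; apply: ballxx; rewrite pos_realc.
- exact: ball_open.
exists y => //; move: xy; rewrite -ball_normE/= norm_lt_n2 ?(ltW se)//.
by rewrite sqr_sqrtr ?(ltW e0)// => /ltW.
Qed.

Lemma dcvg_ip (u : nat -> H) p y (e : R) : dcvg ip u p -> 0 < e ->
  exists M, forall n, (M <= n)%N -> normc (ip (u n - p) y) <= e.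
Proof.
move=> up e0; have y1 : 0 < N y + 1 by rewrite ltr_wpDl// N_ge0.
have [M HM] := up _ (divr_gt0 (exprn_gt0 2 e0) y1); exists M => n Mn.
rewrite -(@ler_pXn2r _ 2) ?nnegrE ?normc_ge0 ?(ltW e0)//.
apply: le_trans (cauchy_schwarz ph _ _) _ => //.
apply: le_trans (ler_wpM2r (N_ge0 y) (HM n Mn)) _.
by rewrite mulrAC ler_pdivrMr// ler_wpM2l ?sqr_ge0// lerDl.
Qed.

Lemma cform_linl (c : C) (a b d : H * H) :
  cform ip (c *: a + b) d = c * cform ip a d + cform ip b d.
Proof. by rewrite /cform/= !linearDl !linearZl_LR/=; ring. Qed.

Lemma symp_orth_lin (S : set (H * H)) (c : C) a b :
  symp_orth ip S a -> symp_orth ip S b -> symp_orth ip S (c *: a + b).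
Proof. by move=> ha hb d Sd; rewrite cform_linl ha// hb// mulr0 addr0. Qed.

(** * Resolvents of mutually adjoint dissipative and accumulative relations *)

Section HalfPlane.
Variables (S1 S2 : set (H * H)) (sg : R) (z : C).
Hypotheses (S10 : S1 0) (S1L : forall c a b, S1 a -> S1 b -> S1 (c *: a + b)).
Hypotheses (o12 : symp_orth ip S1 `<=` S2) (o21 : symp_orth ip S2 `<=` S1).
Hypothesis S12 : S1 `<=` symp_orth ip S2.
Hypothesis pos1 : forall a, S1 a -> 0 <= sg * im (ip a.2 a.1).
Hypothesis neg2 : forall a, S2 a -> sg * im (ip a.2 a.1) <= 0.
Hypotheses (sg2 : sg ^+ 2 = 1) (zsg : sg * im z < 0).

(** Pairing a.2 - z a.1 with a.1, sg times the imaginary part is a sum of two nonnegative terms;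
    dropping the first one and using Cauchy-Schwarz leaves |Im z| times the norm of a.1. The sign
    [sg] lets one proof serve both half-planes. *)
Lemma resolvent_bound a : S1 a -> im z ^+ 2 * N a.1 <= N (a.2 - z *: a.1).
Proof.
move=> /pos1 p; set h := a.2 - z *: a.1.
have E : im (ip h a.1) = im (ip a.2 a.1) - im z * N a.1.
  rewrite linearBl linearZl_LR/= imB imM.
  by rewrite (dot_n2 ph)//= mulr0 add0r.
have h1 : - (sg * im z) * N a.1 <= sg * im (ip h a.1) by rewrite E; lra.
have h2 : (- (sg * im z) * N a.1) ^+ 2 <= N h * N a.1.
  apply: (@le_trans _ _ ((sg * im (ip h a.1)) ^+ 2)).
    rewrite ler_pXn2r ?nnegrE//; first by rewrite mulr_ge0 ?N_ge0// oppr_ge0 ltW.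
    by apply: le_trans h1; rewrite mulr_ge0 ?N_ge0// oppr_ge0 ltW.
  apply: le_trans (cauchy_schwarz ph (x := h) (y := a.1) I I).
  by rewrite exprMn sg2 mul1r normc2 lerDr sqr_ge0.
have := N_ge0 a.1; rewrite le_eqVlt => /predU1P[<-|n0].
  by rewrite mulr0 N_ge0.
rewrite -(ler_pM2r n0); apply: le_trans h2.
by rewrite exprMn sqrrN exprMn sg2 mul1r expr2 mulrA.
Qed.

(* An element orthogonal to the range of [S1 - z] is an eigenvector of the
   symplectic complement of [S1] for [conj z], which the sign condition excludes. *)
Lemma resolvent_surj h : exists2 a, S1 a & a.2 - z *: a.1 = h.
Proof.
have z0 : 0 < im z ^+ 2.
  by rewrite lt0r sqr_ge0 sqrf_eq0 andbT; apply: contraTneq zsg => ->; rewrite mulr0 ltxx.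
pose K := [set g : H | exists2 a, S1 a & a.2 - z *: a.1 = g].
have KL c x y : K x -> K y -> K (c *: x + y).
  move=> [a Sa <-] [b Sb <-]; exists (c *: a + b); first exact: S1L.
  by rewrite /= scalerDr !scalerBr !scalerA [z * c]mulrC opprD addrACA.
have K0 : K 0 by exists 0 => //=; rewrite scaler0 subrr.
(* By [resolvent_bound] the first components form a Cauchy sequence as well. The limit pair
   satisfies the orthogonality relations to S2, hence lies in S1. *)
have cK : dcomplete ip K.
  move=> u uK cu; have [p _ up] := ip_complete (fun=> I) cu.
  have /choice[a Ha] : forall n, exists a, S1 a /\ a.2 - z *: a.1 = u n.
    by move=> n; have [a Sa h0] := uK n; exists a.
  have [|b _ ab] := @ip_complete (fun n => (a n).1) (fun=> I).
    move=> e e0; have [M HM] := cu _ (mulr_gt0 z0 e0); exists M => n m Mn Mm.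
    rewrite -(ler_pM2l z0); apply: le_trans (HM n m Mn Mm).
    have Sd : S1 (a n - a m).
      by rewrite addrC -scaleN1r; apply: S1L; [exact: (Ha m).1|exact: (Ha n).1].
    apply: le_trans (resolvent_bound Sd) _; rewrite -(Ha n).2 -(Ha m).2 /=.
    by rewrite scalerBr !opprD !opprK addrACA.
  exists p => //; exists (b, p + z *: b); last by rewrite /= addrK.
  apply: o21 => y Sy; apply/eqP; rewrite -normc_eq0 eq_le normc_ge0 andbT.
  apply/ler_addgt0Pr => e e0; rewrite add0r.
  have e3 : 0 < e / 3 by rewrite divr_gt0.
  have z1 : 0 < normc z + 1 by rewrite ltr_wpDl// normc_ge0.
  have [M1 H1] := dcvg_ip y.1 up e3.
  have [M2 H2] := dcvg_ip y.1 ab (divr_gt0 e3 z1).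
  have [M3 H3] := dcvg_ip y.2 ab e3.
  pose n := maxn M1 (maxn M2 M3).
  have {}H1 := H1 n (leq_maxl _ _).
  have {}H2 : normc (ip ((a n).1 - b) y.1) <= e / 3 / (normc z + 1).
    by apply: H2; rewrite !leq_max leqnn orbT.
  have {}H3 : normc (ip ((a n).1 - b) y.2) <= e / 3.
    by apply: H3; rewrite !leq_max leqnn !orbT.
  have := S12 (Ha n).1 Sy; rewrite /cform.
  have -> : (a n).2 = u n + z *: (a n).1 by rewrite -(Ha n).2 subrK.
  rewrite linearDl linearZl_LR /= linearDl linearZl_LR /=.
  move: H1 H2 H3; rewrite !linearBl/=.
  move: (ip (u n) y.1) (ip p y.1) (ip (a n).1 y.1) (ip b y.1) (ip (a n).1 y.2) (ip b y.2).
  move=> A1 A2 A3 A4 A5 A6 H1 H2 H3 E.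
  have -> : A2 + z * A4 - A6 = - (A1 - A2) - z * (A3 - A4) + (A5 - A6).
    by rewrite -[LHS]subr0 -E; ring.
  have h4 := normcD_le (- (A1 - A2) - z * (A3 - A4)) (A5 - A6).
  have h5 := normcB_le (- (A1 - A2)) (z * (A3 - A4)).
  rewrite normc_opp normcM_eq in h5.
  have h6 : normc z * normc (A3 - A4) <= e / 3.
    apply: (@le_trans _ _ ((normc z + 1) * (e / 3 / (normc z + 1)))).
      by apply: ler_pM; rewrite ?normc_ge0 ?lerDl.
    by rewrite mulrC divfK// gt_eqF.
  lra.
have [p Kp hp] := projection ph (K := K) (f := h) (fun _ _ => I) KL K0 cK I.
suff : h - p = 0 by move/eqP; rewrite subr_eq0 => /eqP ->.
set g := h - p in hp *.
have Sg : S2 (g, Num.conj z *: g).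
  apply: o12 => b Sb; rewrite /cform/= linearZl_LR/=.
  have := hp (b.2 - z *: b.1); rewrite linearBr/= linearZr_LR/= => h0.
  have {}h0 : ip g b.2 - Num.conj z * ip g b.1 = 0 by apply: h0; exists b.
  by rewrite -opprB h0 oppr0.
have := neg2 Sg; rewrite /= linearZl_LR/= imM imJ (dot_n2 ph)//= mulr0 add0r.
have := N_ge0 g; rewrite le_eqVlt => /predU1P[/esym /ip_definite//|g0].
rewrite mulNr mulrN mulrA oppr_le0 pmulr_lge0// leNgt zsg//.
Qed.

End HalfPlane.

End HilbertSpace.

Lemma zmod_cancel (V : zmodType) (s p q a b : V) :
  s - p - (q + a) - (s - (p + q) - (a + b)) = b.
Proof.
have -> : s - (p + q) - (a + b) = (s - p - (q + a)) - b by rewrite !opprD !addrA.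
by rewrite opprB addrC subrK.
Qed.

(** * The extensions of T cut out by the boundary maps *)

Section BoundaryTriplet.
Variables (R : realType) (H : completeNormedModType R[i]).
Variables (ip : {dot H for Num.conj}) (T : partial_op H) (Gp Gm : H * H -> R[i]^o).
Local Notation C := R[i].
Local Notation N := (n2 ip).
Hypothesis ip_norm : norm_from_dot ip.
Hypothesis Tsym : symmetric_op ip T.
Hypothesis Treg : regular_op T.
Hypothesis triplet : boundary_triplet ip T Gp Gm.
Local Notation D := (symp_orth ip (graph T)).
Let ph := ip_prehilbert ip_norm.

Lemma graph_adjoint : graph T `<=` D.
Proof.
move=> a [a1 a2] b [b1 b2]; rewrite /cform a2 b2.
by apply/eqP; rewrite subr_eq0; apply/eqP; exact: Tsym.
Qed.

Lemma adjoint_lin (c : C) a b : D a -> D b -> D (c *: a + b).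
Proof. exact: symp_orth_lin. Qed.

Lemma adjoint0 : D 0.
Proof. by move=> b _; rewrite /cform/= !linear0l subrr. Qed.

Lemma Gp_lin (c : C) a b : D a -> D b -> Gp (c *: a + b) = c * Gp a + Gp b.
Proof. by have [[h _] _ _ _ _] := triplet; exact: h. Qed.

Lemma Gm_lin (c : C) a b : D a -> D b -> Gm (c *: a + b) = c * Gm a + Gm b.
Proof. by have [[_ h] _ _ _ _] := triplet; exact: h. Qed.

Lemma green a b : D a -> D b ->
  cform ip a b = 'i * Gp a * Num.conj (Gp b) - 'i * Gm a * Num.conj (Gm b).
Proof. by have [_ _ _ _ h] := triplet; exact: h. Qed.

Lemma Gp0 : Gp 0 = 0.
Proof.
have := Gp_lin 1 adjoint0 adjoint0; rewrite scaler0 addr0 mul1r => h.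
by apply: (addrI (Gp 0)); rewrite addr0 -h.
Qed.

Lemma Gm0 : Gm 0 = 0.
Proof.
have := Gm_lin 1 adjoint0 adjoint0; rewrite scaler0 addr0 mul1r => h.
by apply: (addrI (Gm 0)); rewrite addr0 -h.
Qed.

(** Green's identity for a with itself, where the symplectic form is 2 i Im (a.2, a.1). *)
Lemma im_form a : D a -> 2 * im (ip a.2 a.1) = normc (Gp a) ^+ 2 - normc (Gm a) ^+ 2.
Proof.
move=> Da; have := green Da Da; rewrite /cform (dotC ph (x := a.2) (y := a.1) I I).
rewrite -!mulrA !mul_conj => /(congr1 (@complex.Im R)).
rewrite !imB imJ !imM/= !mul0r !add0r !mul1r; lra.
Qed.

(** The dissipative counterpart of [T_infty]; the two are symplectic complements of each other, that
    is, mutually adjoint. *)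
Definition T_minus : set (H * H) := [set a | D a /\ Gm a = 0].
Local Notation T_plus := (T_infty ip T Gp).

Lemma graph_minus : graph T `<=` T_minus.
Proof.
by move=> a Ta; split; [exact: graph_adjoint|have [_ h _ _ _] := triplet; exact: (h a Ta).2].
Qed.

Lemma graph_plus : graph T `<=` T_plus.
Proof.
by move=> a Ta; split; [exact: graph_adjoint|have [_ h _ _ _] := triplet; exact: (h a Ta).1].
Qed.

Lemma minus_lin (c : C) a b : T_minus a -> T_minus b -> T_minus (c *: a + b).
Proof.
move=> [Da a0] [Db b0]; split; first exact: adjoint_lin.
by rewrite Gm_lin// a0 b0 mulr0 addr0.
Qed.

Lemma plus_lin (c : C) a b : T_plus a -> T_plus b -> T_plus (c *: a + b).
Proof.
move=> [Da a0] [Db b0]; split; first exact: adjoint_lin.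
by rewrite Gp_lin// a0 b0 mulr0 addr0.
Qed.

Lemma minus0 : T_minus 0. Proof. by split; [exact: adjoint0|exact: Gm0]. Qed.
Lemma plus0 : T_plus 0. Proof. by split; [exact: adjoint0|exact: Gp0]. Qed.

(** The boundary maps are jointly onto, and testing against an element with Gp = 1 and Gm = 0
    isolates Gp x in Green's identity. *)
Lemma minus_plus : symp_orth ip T_minus `<=` T_plus.
Proof.
move=> x hx; have Dx : D x by move=> a /graph_minus; exact: hx.
split => //; have [_ _ _ h _] := triplet; have [a [Da a1 a0]] := h 1 0.
have /eqP := hx a (conj Da a0); rewrite green// a1 a0 cj1 cj0 mulr0 subr0 mulr1.
by rewrite mulf_eq0 (negbTE (ic_neq0 _))/= => /eqP.
Qed.

Lemma plus_minus : symp_orth ip T_plus `<=` T_minus.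
Proof.
move=> x hx; have Dx : D x by move=> a /graph_plus; exact: hx.
split => //; have [_ _ _ h _] := triplet; have [a [Da a1 a0]] := h 0 1.
have /eqP := hx a (conj Da a1); rewrite green// a1 a0 cj1 cj0 mulr0 sub0r mulr1.
by rewrite oppr_eq0 mulf_eq0 (negbTE (ic_neq0 _))/= => /eqP.
Qed.

Lemma minus_orth : T_minus `<=` symp_orth ip T_plus.
Proof. by move=> a [Da a0] b [Db b0]; rewrite green// a0 b0 cj0 !mulr0 mul0r subr0. Qed.

Lemma plus_orth : T_plus `<=` symp_orth ip T_minus.
Proof. by move=> a [Da a0] b [Db b0]; rewrite green// a0 b0 cj0 !mulr0 mul0r subr0. Qed.

Lemma im_minus a : T_minus a -> 0 <= 1 * im (ip a.2 a.1).
Proof.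
by move=> [Da a0]; have := im_form Da; rewrite a0 normc_0; have := sqr_ge0 (normc (Gp a)); lra.
Qed.

Lemma im_plus a : T_plus a -> 1 * im (ip a.2 a.1) <= 0.
Proof.
by move=> [Da a0]; have := im_form Da; rewrite a0 normc_0; have := sqr_ge0 (normc (Gm a)); lra.
Qed.

Lemma im_plusN a : T_plus a -> 0 <= -1 * im (ip a.2 a.1).
Proof. by move=> /im_plus; lra. Qed.

Lemma im_minusN a : T_minus a -> -1 * im (ip a.2 a.1) <= 0.
Proof. by move=> /im_minus; lra. Qed.

Lemma minus_bound (z : C) a : im z < 0 -> T_minus a ->
  im z ^+ 2 * N a.1 <= N (a.2 - z *: a.1).
Proof.
move=> z0; apply: (resolvent_bound ip_norm im_minus (expr1n _ 2)).
by rewrite mul1r.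
Qed.

Lemma minus_surj (z : C) h : im z < 0 -> exists2 a, T_minus a & a.2 - z *: a.1 = h.
Proof.
move=> z0; apply: (resolvent_surj ip_norm minus0 minus_lin minus_plus plus_minus
  minus_orth im_minus im_plus (expr1n _ 2)).
by rewrite mul1r.
Qed.

Lemma plus_surj (z : C) h : 0 < im z -> exists2 a, T_plus a & a.2 - z *: a.1 = h.
Proof.
move=> z0; apply: (resolvent_surj ip_norm plus0 plus_lin plus_minus minus_plus
  plus_orth im_plusN im_minusN).
  by rewrite sqrrN expr1n.
by rewrite mulN1r oppr_lt0.
Qed.

(** An element with Gm = 1 is corrected by one of [T_minus], found by solving the resolvent
    equation. The condition on z stands inside the existential, so that choice yields a function v
    defined for every z. *)
Lemma defect_minus (z : C) : exists a, im z < 0 -> W_space ip T z a /\ Gm a = 1.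
Proof.
have [z0|z0] := boolP (im z < 0); last by exists 0.
have [_ _ _ h _] := triplet; have [a [Da _ a1]] := h 0 1.
have [b [Db b0] ab] := minus_surj (a.2 - z *: a.1) z0.
exists (-1 *: b + a); split; last by rewrite Gm_lin// b0 mulr0 add0r.
split; first exact: adjoint_lin.
rewrite /= !scaleN1r scalerDr scalerN.
have -> : a.2 = b.2 - z *: b.1 + z *: a.1 by rewrite ab subrK.
by rewrite !addrA addNr add0r.
Qed.

Lemma defect_plus (z : C) : 0 < im z -> exists a, W_space ip T z a /\ Gp a = 1.
Proof.
move=> z0; have [_ _ _ h _] := triplet; have [a [Da a1 _]] := h 1 0.
have [b [Db b0] ab] := plus_surj (a.2 - z *: a.1) z0.
exists (-1 *: b + a); split; last by rewrite Gp_lin// b0 mulr0 add0r.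
split; first exact: adjoint_lin.
rewrite /= !scaleN1r scalerDr scalerN.
have -> : a.2 = b.2 - z *: b.1 + z *: a.1 by rewrite ab subrK.
by rewrite !addrA addNr add0r.
Qed.

(** * Defect vectors, the Weyl function and the model map *)

Section Model.
Variable v : C -> H * H.
Hypothesis vP : forall z, im z < 0 -> W_space ip T z (v z) /\ Gm (v z) = 1.

Definition char_fun (z : C) : C := Num.conj (Gp (v (Num.conj z))).

Lemma conj_lower (z : C) : upper z -> im (Num.conj z) < 0.
Proof. by rewrite imJ oppr_lt0. Qed.

(** The symplectic form vanishes between the defect spaces at z and at conj z, so Green's identity
    becomes Gm a conj (Gm v) = Gp a conj (Gp v), with Gm v = 1. Uniqueness of the factor follows
    from an element with Gp = 1, given by [defect_plus]. *)
Lemma weylE (z : C) : upper z -> weyl ip T Gp Gm z = char_fun z.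
Proof.
move=> uz; have [[Dv Wv] v1] := vP (conj_lower uz).
have key a : W_space ip T z a -> Gm a = char_fun z * Gp a.
  move=> [Da Wa]; have := green Da Dv; rewrite /cform Wa Wv linearZl_LR linearZr_LR/= conjK subrr v1.
  rewrite cj1 mulr1 -mulrA -mulrBr => /esym/eqP; rewrite mulf_eq0 (negbTE (ic_neq0 _))/=.
  by rewrite subr_eq0 => /eqP <-; rewrite mulrC.
have [u [Wu u1]] := defect_plus uz.
rewrite /weyl; apply: xget_subset1; first exact: key.
by move=> b b' /= hb hb'; have := hb u Wu; rewrite (hb' u Wu) u1 !mulr1.
Qed.

Lemma defect_gram (z w : C) : upper z -> upper w ->
  ip (v (Num.conj w)).1 (v (Num.conj z)).1 =
  'i * (1 - char_fun z * Num.conj (char_fun w)) / (z - Num.conj w).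
Proof.
move=> uz uw; have [[Dv Wv] v1] := vP (conj_lower uz); have [[Dw Ww] w1] := vP (conj_lower uw).
have h := upper_sub_conj uz uw; have := green Dw Dv.
rewrite /cform Wv Ww linearZl_LR linearZr_LR/= conjK v1 w1 cj1 /char_fun conjK.
move: (ip _ _) (Gp _) (Num.conj (Gp _)) => A B B' E.
apply: (mulIf h); rewrite divfK//.
have -> : A * (z - Num.conj w) = - (Num.conj w * A - z * A) by ring.
by rewrite E; ring.
Qed.

Lemma char_fun_le1 (z : C) : upper z -> normc (char_fun z) <= 1.
Proof.
move=> uz; have uz' : 0 < im z by [].
have [[Dv Wv] v1] := vP (conj_lower uz); have := im_form Dv.
rewrite Wv linearZl_LR/= imM imJ (dot_n2 ph)//= mulr0 add0r v1 normc_1 expr1n.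
rewrite /char_fun normc_conj => h; rewrite -(@ler_pXn2r _ 2) ?nnegrE ?normc_ge0// expr1n.
have := mulr_ge0 (ltW uz') (N_ge0 ip_norm (v (Num.conj z)).1); lra.
Qed.

Definition model_map (x : H) : C -> C^o :=
  fun z => if 0 < im z then ip x (v (Num.conj z)).1 else 0.

Lemma model_mapE x (z : C) : upper z -> model_map x z = ip x (v (Num.conj z)).1.
Proof. by rewrite /model_map /upper => ->. Qed.

(** The vector p = (T_minus - z)^-1 v_z is the derivative of the defect vector: the remainder lies
    in [T_minus], and T_minus - (z + h) sends it to h^2 p, so [minus_bound] makes it quadratic in
    h. *)
Lemma defect_diff (z : C) : im z < 0 -> exists p : H, forall h : C, im (z + h) < 0 ->
  im (z + h) ^+ 2 * N ((v (z + h)).1 - (v z).1 - h *: p) <= normc h ^+ 4 * N p.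
Proof.
move=> z0; have [p Sp Ep] := minus_surj (v z).1 z0.
exists p.1 => h zh; have [[Dv Wv] v1] := vP z0; have [[Dw Ww] w1] := vP zh.
pose d := v (z + h) - v z - h *: p.
have Sd : T_minus d.
  have Sv : T_minus (-1 *: v z + v (z + h)).
    by split; [exact: adjoint_lin|rewrite Gm_lin// v1 w1 mulN1r addNr].
  by rewrite /d -scaleNr addrC; apply: minus_lin => //; rewrite addrC -scaleN1r.
have := minus_bound zh Sd; rewrite /d /=.
have -> : (v (z + h)).2 - (v z).2 - h *: p.2 - (z + h) *: ((v (z + h)).1 - (v z).1 - h *: p.1) =
   (h ^+ 2) *: p.1.
  have E2 : p.2 = (v z).1 + z *: p.1 by rewrite -Ep subrK.
  rewrite Ww Wv E2 !scalerBr (scalerDl (v z).1) scalerDr !scalerA mulrDl [h * z]mulrC -expr2 !scalerDl.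
  exact: zmod_cancel.
by rewrite (n2Z ph)// normcX_eq -exprM.
Qed.

Lemma upper_analytic_model x : upper_analytic (model_map x).
Proof.
move=> z uz; have uz' : 0 < im z by []; apply/derivable_cdiff.
have [p Hp] := defect_diff (conj_lower uz); exists (ip x p).
(* Cauchy-Schwarz together with Im (z + h) >= Im z / 2 bounds the remainder by K |h|^2. *)
pose K := Num.sqrt (N x * N p) * 2 / im z.
have K0 : 0 <= K by rewrite divr_ge0 ?mulr_ge0 ?sqrtr_ge0// ltW.
move=> e e0; have [d d0 Hd] := near_upper uz.
have K1 : 0 < K + 1 by rewrite ltr_wpDl.
exists (Num.min (Num.min d (im z / 2)) (e / (K + 1))).
  by rewrite !lt_min d0 !divr_gt0.
move=> h; rewrite !le_min => /andP[/andP[hd hz] he].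
have uzh := Hd h hd; rewrite !model_mapE//.
have imh : im z / 2 <= im (z + h).
  by rewrite imD; have := le_trans (normc_im h) hz; rewrite ler_norml => /andP[]; lra.
have zh : Num.conj z + Num.conj h = Num.conj (z + h) by rewrite cjD.
have := Hp (Num.conj h); rewrite zh => /(_ (conj_lower uzh)).
set q := _ - _ - _; rewrite imJ sqrrN normc_conj => hq.
have -> : ip x (v (Num.conj (z + h))).1 - ip x (v (Num.conj z)).1 - ip x p * h = ip x q.
  by rewrite /q !linearBr/= linearZr_LR/= conjK mulrC.
have im2 : (im z / 2) ^+ 2 <= im (z + h) ^+ 2.
  by rewrite ler_pXn2r ?nnegrE//; [rewrite divr_ge0// ltW|apply: le_trans imh; rewrite divr_ge0// ltW].
have h2 : (im z / 2) ^+ 2 * N q <= normc h ^+ 4 * N p.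
  by apply: le_trans hq; rewrite ler_wpM2r// N_ge0.
have h3 : normc (ip x q) <= K * normc h ^+ 2.
  rewrite -(@ler_pXn2r _ 2) ?nnegrE ?normc_ge0 ?(mulr_ge0 K0 (sqr_ge0 (normc h)))//.
  apply: le_trans (cauchy_schwarz ph (x := x) (y := q) I I) _.
  rewrite exprMn /K !exprMn sqr_sqrtr ?mulr_ge0 ?N_ge0//.
  have -> : N x * N p * 2 ^+ 2 * (im z)^-1 ^+ 2 * (normc h ^+ 2) ^+ 2 =
     N x * (normc h ^+ 4 * N p / (im z / 2) ^+ 2) by field; rewrite gt_eqF.
  rewrite ler_wpM2l ?N_ge0// ler_pdivlMr ?exprn_gt0 ?divr_gt0//.
  by rewrite mulrC.
apply: le_trans h3 _; rewrite expr2 mulrA ler_wpM2r ?normc_ge0//.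
apply: (@le_trans _ _ ((K + 1) * (e / (K + 1)))).
  by apply: ler_pM; rewrite ?normc_ge0// lerDl.
by rewrite mulrC divfK// gt_eqF.
Qed.

(** For a fixed element a with Gp = 1 and Gm = 0, Green's identity against the defect vectors
    expresses i B(z) as the value at z of the model map of a.2, minus z times that of a.1. *)
Lemma upper_analytic_weyl : upper_analytic (weyl ip T Gp Gm).
Proof.
move=> z uz; have [_ _ _ h _] := triplet; have [a [Da a1 a0]] := h 1 0.
have [d d0 Hd] := near_upper uz.
apply: (@derivable_near_c _ (fun z => - 'i * (model_map a.2 z + (- 1) * (z * model_map a.1 z))) _ z d d0).
  move=> k /Hd uzk; rewrite weylE// !model_mapE//.
  have [[Dv Wv] v1] := vP (conj_lower uzk); have := green Da Dv.
  rewrite /cform Wv linearZr_LR/= conjK a1 a0 mulr1 !mulr0 mul0r subr0 mulN1r => ->.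
  by rewrite mulrA mulNr sqr_ic opprK mul1r.
apply: derivableM_c; first exact: derivable_cst_c.
apply: derivableD_c; first exact: upper_analytic_model.
apply: derivableM_c; first exact: derivable_cst_c.
by apply: derivableM_c; [exact: derivable_id_c|exact: upper_analytic_model].
Qed.

(** If Gm vanished too, x would be an eigenvector of T, against regularity. So Gm is nonzero and
    [im_form] puts z in the lower half-plane; subtracting the multiple of v_z with the same Gm
    leaves an eigenelement of [T_minus] there, which must be zero. *)
Lemma eigenvector_defect z x : x != 0 -> T_plus (x, z *: x) ->
  [/\ im z < 0, Gp (v z) = 0 & exists c : C, x = c *: (v z).1].
Proof.
move=> x0 [Da a0]; have nx : 0 < N x.
  by rewrite lt0r N_ge0// andbT; apply: contra_neq x0 => /(ip_definite ip_norm).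
have := im_form Da; rewrite /= linearZl_LR/= imM (dot_n2 ph)//= mulr0 add0r a0 normc_0 expr0n sub0r.
have [g0|g0] := eqVneq (Gm (x, z *: x)) 0.
  have [_ _ h _ _] := triplet; have [/= Tx xz] := h _ Da a0 g0.
  have [c c0 /(_ x Tx)] := Treg z; rewrite -xz subrr normr0 pmulr_rle0// => h0.
  by move: x0; rewrite -normr_eq0 eq_le h0 normr_ge0.
have gp : 0 < normc (Gm (x, z *: x)) ^+ 2 by rewrite exprn_gt0// normc_gt0.
move=> E; have z0 : im z < 0 by rewrite -(pmulr_llt0 _ nx); lra.
have [[Dv Wv] v1] := vP z0; pose b := - Gm (x, z *: x) *: v z + (x, z *: x).
have Sb : T_minus b by split; [exact: adjoint_lin|rewrite Gm_lin// v1 mulr1 addNr].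
have b2 : b.2 = z *: b.1 by rewrite /b/= Wv scalerDr !scalerA mulrC.
have := minus_bound z0 Sb; rewrite b2 subrr (n2_0 ph) => hb.
have b1 : b.1 = 0.
  apply: (ip_definite ip_norm); apply/eqP; rewrite eq_le N_ge0// andbT.
  by rewrite -(pmulr_rle0 _ (_ : 0 < im z ^+ 2))// exprn_even_gt0//= lt_eqF.
have b0 : b = 0 by rewrite [b]surjective_pairing b2 b1 scaler0.
have aE : (x, z *: x) = Gm (x, z *: x) *: v z.
  by apply/eqP; rewrite -subr_eq0 addrC -scaleNr; apply/eqP.
split => //; last by exists (Gm (x, z *: x)); have := congr1 fst aE.
have := Gp_lin (Gm (x, z *: x)) Dv adjoint0; rewrite addr0 -aE a0 Gp0 addr0 => /esym/eqP.
by rewrite mulf_eq0 (negbTE g0)/= => /eqP.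
Qed.

(** By simplicity the generalized eigenspace is a line; it contains an eigenvector, which
    [eigenvector_defect] identifies. *)
Lemma gen_eigenspace_defect (lam : nat -> C) :
  (forall z, eigenvalue_of T_plus z <-> exists j, lam j = z) ->
  (forall j, simple_eigenvalue T_plus (lam j)) ->
  forall z x, gen_eigenspace T_plus z x -> exists j (c : C), x = c *: (v (lam j)).1.
Proof.
move=> le ls z x [n [c [c0 cn cS]]].
have [->|x0] := eqVneq x 0; first by exists 0, 0; rewrite scale0r.
have ez : eigenvalue_of T_plus z.
  (* The vector just before the first zero of the chain is an eigenvector. *)
  have ex0 : exists k, c k == 0 by exists n; apply/eqP.
  pose m := ex_minn ex0; have : c m == 0 /\ forall k, c k == 0 -> (m <= k)%N.
    by rewrite /m; case: ex_minnP => m' h1 h2; split.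
  move=> [cm mk]; case: m cm mk => [|m] cm mk.
    by move: cm; rewrite c0 (negbTE x0).
  have mn : (m < n)%N by apply: mk; apply/eqP.
  exists (c m); first by apply: contraTneq mn => c0'; rewrite -leqNgt; have := mk m; rewrite c0' eqxx ltnn => /(_ isT).
  by have := cS m mn; rewrite (eqP cm) addr0.
have [j jz] := (le z).1 ez; exists j; have [y y0 /esym gy] := ls j.
have [e0 e0n Te] := (le (lam j)).2 (ex_intro _ j erefl).
have ge : gen_eigenspace T_plus (lam j) e0.
  exists 1%N, (fun k => if k is 0%N then e0 else 0); split => // -[|//] _.
  by rewrite addr0.
have gx : gen_eigenspace T_plus (lam j) x by rewrite jz; exists n, c.
rewrite -gy in ge gx; have [a _ ae] := ge; have [b _ bx] := gx.
have [_ _ [k ek]] := eigenvector_defect e0n Te.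
have a0 : a != 0 by apply: contraNneq e0n => a0; rewrite -ae a0 scale0r.
exists (b / a * k); rewrite -scalerA -ek -ae scalerA divfK//.
Qed.

(** The completeness hypothesis enters the proof through this density alone. *)
Lemma defect_dense (lam : nat -> C) : complete_rel T_plus ->
  (forall z, eigenvalue_of T_plus z <-> exists j, lam j = z) ->
  (forall j, simple_eigenvalue T_plus (lam j)) ->
  forall x (e : R), 0 < e ->
    exists n, exists2 p, spn (fun j => (v (lam j)).1) n p & N (x - p) <= e.
Proof.
move=> dT le ls x e e0; have [y Sy xy] := dense_n2 ip_norm dT x e0.
suff : lspan (range (fun j => (v (lam j)).1)) y.
  by move=> /lspan_spn[n ny]; exists n, y.
have [n [c [u [hu ->]]]] := Sy.
have /choice[f Hf] : forall i : 'I_n, exists jc : nat * C, u i = jc.2 *: (v (lam jc.1)).1.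
  by move=> i; have [z _ /(gen_eigenspace_defect le ls)[j [k hk]]] := hu i; exists (j, k).
exists n, (fun i => c i * (f i).2), (fun i => (v (lam (f i).1)).1); split.
  by move=> i; exists (f i).1.
by apply: eq_bigr => i _; rewrite {1}Hf scalerA.
Qed.

(* If [lam] is small then [Gm] of a normalized eigenvector is small, since its
   square is [2 |Im lam|]; so the eigenvector is close to the domain of T, where
   regularity at 0 bounds T from below. *)
Lemma eigenvalue_bound : exists2 c : R, 0 < c &
  forall z, eigenvalue_of T_plus z -> c <= normc z.
Proof.
have [_ _ inv h _] := triplet; have [a [Da a0 a1]] := h 0 1.
have [_ /pos_complexP[r r0 ->] reg] := Treg 0.
(* With g = Gm (x, z x), the vector y = x - g a.1 lies in the domain of T and T y = z x - g a.2. The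
   estimates |x|^2 <= 2 |y|^2 + 2 |g|^2 |a.1|^2, r |y| <= |T y| and |g|^2 <= 2 |z| |x|^2 combine to
   r^2 <= (4 + K) |z| when |z| < 1. *)
pose K := 8 * N a.2 + 4 * r ^+ 2 * N a.1.
have K0 : 0 <= K.
  apply: addr_ge0; apply: mulr_ge0; rewrite ?(N_ge0 ip_norm)//.
  by rewrite mulr_ge0// sqr_ge0.
have K4 : 0 < 4 + K by rewrite ltr_wpDr.
exists (Num.min 1 (r ^+ 2 / (4 + K))).
  by rewrite lt_min ltr01 divr_gt0// exprn_gt0.
move=> z [x x0 [Dx xp]]; rewrite ge_min.
have nx : 0 < N x.
  by rewrite lt0r N_ge0// andbT; apply: contra_neq x0 => /(ip_definite ip_norm).
have := im_form Dx; rewrite /= linearZl_LR/= imM (dot_n2 ph)//= mulr0 add0r xp normc_0 expr0n sub0r.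
set g := Gm (x, z *: x) => gE.
have g2 : normc g ^+ 2 <= 2 * normc z * N x.
  have : - im z <= normc z by apply: le_trans (normc_im z); rewrite -normrN ler_norm.
  by move=> /(ler_wpM2r (ltW nx)); lra.
have := inv (- g *: a + (x, z *: x)) (adjoint_lin _ Da Dx).
rewrite Gp_lin// Gm_lin// a0 a1 xp mulr0 mulr1 addr0 addNr => /(_ erefl erefl)[/= Tx Ex].
have := reg _ Tx; rewrite -Ex scale0r subr0 !(norm_n2 ip_norm) -(rmorphM (real_complex R)) lecR.
rewrite -(@ler_pXn2r _ 2) ?nnegrE ?sqrtr_ge0//; last by rewrite mulr_ge0 ?sqrtr_ge0// ltW.
rewrite exprMn !sqr_sqrtr ?N_ge0//.
have := n2D_le ph (x := - g *: a.2) (y := z *: x) I I.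
have := n2D_le ph (x := - g *: a.1 + x) (y := g *: a.1) I I.
have e1 : - g *: a.1 + x + g *: a.1 = x by rewrite scaleNr addrAC addNr add0r.
rewrite e1 => h1 h2 h3; rewrite (n2Z ph g (x := a.1) I) in h1.
rewrite (n2Z ph (- g) (x := a.2) I) (n2Z ph z (x := x) I) normc_opp in h2.
have [z1|z1] := leP 1 (normc z); first by [].
rewrite /= ler_pdivrMr// -(ler_pM2r nx).
have zz : normc z ^+ 2 <= normc z by rewrite expr2 ler_piMr ?normc_ge0 ?ltW.
have r2 : 0 <= r ^+ 2 by exact: sqr_ge0.
have := ler_wpM2l r2 h1; have := ler_wpM2r (ltW nx) zz.
have := ler_wpM2r (N_ge0 ip_norm a.2) g2.
have := ler_wpM2l r2 (ler_wpM2r (N_ge0 ip_norm a.1) g2).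
rewrite /K; move: h2 h3; move: (N (_ + _)) (N (_ + _)) (normc g ^+ 2) (normc z ^+ 2) => A B G Z.
move: (N x) (N a.1) (N a.2) (normc z) (r ^+ 2) => X A1 A2 z' r' h2 h3 h4 h5 h6 h7.
nra.
Qed.

End Model.
End BoundaryTriplet.

(** * The functional model *)

Lemma seminorm_eq (R : realType) (V : zmodType) (g h : V -> R) (x : V) :
  (forall a b, g (a + b) <= g a + g b) -> (forall a b, h (a + b) <= h a + h b) ->
  (forall a, g (- a) = g a) -> (forall a, h (- a) = h a) ->
  (forall e : R, 0 < e -> exists p, [/\ g p = h p, g (x - p) <= e & h (x - p) <= e]) ->
  g x = h x.
Proof.
move=> gD hD gN hN ap; apply/eqP; rewrite eq_le; apply/andP; split;
  apply/ler_addgt0Pr => e e0; have [p [gh gp hp]] := ap _ (divr_gt0 e0 (ltr0n R 2)).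
- have := gD p (x - p); have := hD x (p - x).
  by rewrite addrCA subrr addr0 addrCA subrr addr0 -(hN (p - x)) opprB; lra.
- have := hD p (x - p); have := gD x (p - x).
  by rewrite addrCA subrr addr0 addrCA subrr addr0 -(gN (p - x)) opprB; lra.
Qed.

Section Polarization.
Variables (R : realType) (V W : lmodType R[i]) (S : set V) (S' : set W).
Variables (dot : V -> V -> R[i]) (dot' : W -> W -> R[i]) (F : V -> W).
Hypotheses (ph : prehilbert S dot) (ph' : prehilbert S' dot').
Hypothesis FS : forall x, S x -> S' (F x).
Hypothesis FL : forall c x y, S x -> S y -> F (c *: x + y) = c *: F x + F y.
Hypothesis Fn : forall x, S x -> n2 dot' (F x) = n2 dot x.

Lemma polarization x y : S x -> S y -> dot' (F x) (F y) = dot x y.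
Proof.
have re_eq a b : S a -> S b -> re (dot' (F a) (F b)) = re (dot a b).
  move=> Sa Sb; have := Fn (phD ph Sa Sb).
  have -> : F (a + b) = F a + F b by rewrite -[a]scale1r FL// !scale1r.
  rewrite (n2D ph')//; [rewrite (n2D ph)// !Fn//; lra|exact: FS|exact: FS].
move=> Sx Sy; apply: complex_ext; first exact: re_eq.
have Si := phZ ph 'i Sx; have := re_eq _ _ Si Sy.
have Fi : F ('i *: x) = 'i *: F x.
  have := FL 'i Sx (ph0 ph); rewrite addr0.
  have -> : F 0 = 0; last by rewrite addr0.
  have := FL 1 (ph0 ph) (ph0 ph); rewrite !scale1r addr0 => h.
  by apply: (addrI (F 0)); rewrite addr0 -h.
by rewrite Fi (dotZl ph')// ?(dotZl ph)//; [rewrite !reM/= !mul0r !mul1r; lra|exact: FS|exact: FS].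
Qed.

End Polarization.

Section FunctionalModel.
Variables (R : realType) (H : completeNormedModType R[i]).
Variables (ip : {dot H for Num.conj}) (T : partial_op H) (Gp Gm : H * H -> R[i]^o).
Variables (lam : nat -> R[i]) (v : R[i] -> H * H).
Local Notation C := R[i].
Local Notation N := (n2 ip).
Hypothesis ip_norm : norm_from_dot ip.
Hypothesis Tsym : symmetric_op ip T.
Hypothesis Treg : regular_op T.
Hypothesis triplet : boundary_triplet ip T Gp Gm.
Hypothesis Tcomplete : complete_rel (T_infty ip T Gp).
Hypothesis lamE : forall z, eigenvalue_of (T_infty ip T Gp) z <-> exists j, lam j = z.
Hypothesis lam_simple : forall j, simple_eigenvalue (T_infty ip T Gp) (lam j).
Hypothesis vP : forall z, im z < 0 -> W_space ip T z (v z) /\ Gm (v z) = 1.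
Let ph := ip_prehilbert ip_norm.
Let hph := @hardy_prehilbert R.
Local Notation B := (weyl ip T Gp Gm).
Local Notation F := (model_map ip v).
Local Notation cB := (char_fun Gp v).
Local Notation V := (fun j => (v (lam j)).1).

Lemma lam_lower j : im (lam j) < 0 /\ Gp (v (lam j)) = 0.
Proof.
have [x x0 Tx] := (lamE (lam j)).2 (ex_intro _ j erefl).
by have [] := eigenvector_defect ip_norm Treg triplet vP x0 Tx.
Qed.

Lemma node_upper j : upper (Num.conj (lam j)).
Proof. by rewrite /upper imJ oppr_gt0; exact: (lam_lower j).1. Qed.

Lemma char_node j : cB (Num.conj (lam j)) = 0.
Proof. by rewrite /char_fun conjK (lam_lower j).2 cj0. Qed.

Lemma weyl_node j : B (Num.conj (lam j)) = 0.
Proof. by rewrite (weylE ip_norm Tsym triplet vP (node_upper j)) char_node. Qed.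

Lemma weyl_le1 z : upper z -> normc (B z) <= 1.
Proof.
by move=> uz; rewrite (weylE ip_norm Tsym triplet vP uz) (char_fun_le1 ip_norm triplet vP uz).
Qed.

Lemma model_map_lin c x y : F (c *: x + y) = c *: F x + F y.
Proof.
apply/funext => z; rewrite [RHS](_ : _ = c * F x z + F y z)// /model_map.
by case: ifP => _; rewrite ?mulr0 ?addr0// linearDl linearZl_LR.
Qed.

Lemma model_mapB x y : F (x - y) = F x - F y.
Proof. by rewrite addrC -scaleN1r model_map_lin scaleN1r addrC. Qed.

Lemma model_map0 : F 0 = 0.
Proof. by rewrite -[0 in LHS](subrr 0) model_mapB subrr. Qed.

(** The characteristic function vanishes at the nodes, so in the Gram formula only the Hardy kernel
    survives. *)
Lemma model_map_defect j : F (V j) = hkernel (Num.conj (lam j)).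
Proof.
apply/funext => z; rewrite /model_map /hkernel; case: ifP => // uz.
rewrite -{1}[lam j]conjK (defect_gram triplet vP)//; last exact: node_upper.
by rewrite char_node cj0 mulr0 subr0 mulr1.
Qed.

(** On the span only Gram matrices matter, and in both spaces the (i, j) entry is the value of F (V
    i) at the node of V j. *)
Lemma model_map_spn n x : spn V n x -> hardy2 (F x) /\ hnorm2 (F x) = N x.
Proof.
move=> [c ->]; pose k j := hkernel (Num.conj (lam j)).
have hk j : hardy2 (k j) by apply: hardy2_kernel; exact: node_upper.
have -> : F (\sum_(i < n) c i *: V i) = \sum_(i < n) c i *: k i.
  elim: n => [|n IH]; last first.
    by rewrite !big_ord_recr/= addrC model_map_lin IH addrC model_map_defect.
  by rewrite !big_ord0 model_map0.
split; first exact: hardy_sum_mem.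
rewrite /hnorm2 /n2; congr (re _).
rewrite (dot_suml hph)//; last exact: hardy_sum_mem.
rewrite (dot_suml ph)//; apply: eq_bigr => i _; congr (_ * _).
rewrite (dot_sumr hph)// (dot_sumr ph)//; apply: eq_bigr => j _; congr (_ * _).
rewrite hdot_kernel//; last exact: node_upper.
by rewrite /k -model_map_defect model_mapE ?conjK//; exact: node_upper.
Qed.

Lemma approx_seq x (e : R) : 0 < e -> exists p : nat -> H,
  forall n, (exists m, spn V m (p n)) /\ N (x - p n) <= e / n.+1%:R.
Proof.
move=> e0.
have ex n : exists p, (exists m, spn V m p) /\ N (x - p) <= e / n.+1%:R; last by have [p hp] := choice ex; exists p.
have n0 : 0 < e / n.+1%:R by rewrite divr_gt0.
have [m [p sp xp]] := defect_dense ip_norm Treg triplet vP Tcomplete lamE lam_simple x n0.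
by exists p; split => //; exists m.
Qed.

(** Approximants from the span have images of known norm, and these images converge pointwise by
    Cauchy-Schwarz, so [hardy2_limit] applies. The crude factor 2 comes from n2 (x + y) <= 2 n2 x +
    2 n2 y. *)
Lemma model_map_rough x : hardy2 (F x) /\ hnorm2 (F x) <= 2 * N x.
Proof.
have key e : 0 < e -> hardy2 (F x) /\ hnorm2 (F x) <= 2 * N x + e.
  move=> e0; have [p hp] := approx_seq x (divr_gt0 e0 (ltr0n R 2)).
  have hh n : hardy2 (F (p n)) /\ hnorm2 (F (p n)) = N (p n).
    by have [[m /model_map_spn]] := hp n.
  apply: (hardy2_limit (u := fun n => F (p n))) => [n|n|z nz|z|z uz s s0].
  - exact: (hh n).1.
  - rewrite (hh n).2; have := n2D_le ph (x := x) (y := p n - x) I I.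
    rewrite addrC subrK (n2_distC ph (x := p n) (y := x) I I) => h.
    have := (hp n).2; have : e / 2 / n.+1%:R <= e / 2.
      by rewrite ler_pdivrMr// ler_peMr ?ler1n// divr_ge0// ltW.
    move=> h1 h2; have := le_trans h2 h1; lra.
  - by rewrite /model_map; move/negP: nz => /negbTE ->.
  - exact: (upper_analytic_model ip_norm Tsym triplet vP).
  - pose y := (v (Num.conj z)).1.
    have K0 : 0 < e / 2 * (N y + 1) by rewrite !mulr_gt0 ?invr_gt0// ltr_wpDl// N_ge0.
    have [m Hm] := near_inv (divr_gt0 (exprn_gt0 2 s0) K0).
    exists m => // n /= mn; rewrite !model_mapE// -/y -linearBl.
    rewrite -(@ler_pXn2r _ 2) ?nnegrE ?normc_ge0 ?(ltW s0)//.
    apply: le_trans (cauchy_schwarz ph (x := p n - x) (y := y) I I) _.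
    rewrite (n2_distC ph (x := p n) (y := x) I I).
    have y0 := N_ge0 ip_norm y.
    apply: (@le_trans _ _ (e / 2 / n.+1%:R * (N y + 1))).
      apply: ler_pM; rewrite ?N_ge0 ?lerDl//; exact: (hp n).2.
    have := Hm n mn; rewrite ler_pdivlMr//.
    by apply: le_trans; rewrite le_eqVlt; apply/orP; left; apply/eqP; ring.
have [h _] := key 1 ltr01; split => //.
by apply/ler_addgt0Pr => e e0; have [] := key e e0.
Qed.

(** The rough bound makes the norm of F x continuous in x, so the equality of norms passes from the
    span to its closure. *)
Lemma model_map_isometry x : hnorm2 (F x) = N x.
Proof.
have hF y := (model_map_rough y).1.
suff E : Num.sqrt (hnorm2 (F x)) = Num.sqrt (N x).
  by rewrite -[LHS]sqr_sqrtr ?hnorm2_ge0// E sqr_sqrtr// N_ge0.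
apply: (seminorm_eq (g := fun y => Num.sqrt (hnorm2 (F y))) (h := fun y => Num.sqrt (N y))).
- move=> a b; rewrite (_ : F (a + b) = F a + F b); first exact: (sqrt_n2D hph).
  by rewrite -[a]scale1r model_map_lin !scale1r.
- by move=> a b; exact: (sqrt_n2D ph).
- move=> a; rewrite -[- a]sub0r model_mapB model_map0 sub0r.
  exact: (congr1 Num.sqrt (n2N hph (hF a))).
- by move=> a; rewrite (n2N ph).
move=> e e0; have [q hq] := approx_seq x (divr_gt0 (exprn_gt0 2 e0) (ltr0n R 2)).
have [[m /model_map_spn[_ h2]] h3] := hq 0%N; rewrite divr1 in h3.
exists (q 0%N); split; first by rewrite h2.
- rewrite -[e]ger0_norm ?(ltW e0)// -sqrtr_sqr ler_wsqrtr//.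
  by apply: le_trans (model_map_rough _).2 _; lra.
- rewrite -[e]ger0_norm ?(ltW e0)// -sqrtr_sqr ler_wsqrtr//.
  by apply: le_trans h3 _; have := sqr_ge0 e; lra.
Qed.

Lemma model_map_dot x y : hardy_dot (F x) (F y) = ip x y.
Proof.
apply: (polarization ph hph) => // [a _|c a b _ _|a _].
- exact: (model_map_rough a).1.
- exact: model_map_lin.
- exact: model_map_isometry.
Qed.

Lemma weyl_mul g : hardy2 g -> hardy2 (fun z => B z * g z).
Proof.
move=> hg; have [] // := hardy2_mul (phi := B) ler01 _ weyl_le1 hg.
exact: (upper_analytic_weyl ip_norm Tsym triplet vP).
Qed.

Lemma model_prehilbert : prehilbert (model_space B) (@hardy_dot R).
Proof.
have sub f : model_space B f -> hardy2 f by case.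
split; first split.
- by split; [exact: hardy2_0|move=> g hg; apply: (dot0l hph); exact: weyl_mul].
- move=> c f g [hf f0] [hg g0]; split; first exact: hardy2_lin.
  by move=> k hk; rewrite hdot_linl// ?f0 ?g0 ?mulr0 ?addr0//; exact: weyl_mul.
- by move=> c x y z [hx _] [hy _] [hz _]; exact: hdot_linl.
- by move=> x y [hx _] [hy _]; exact: hdotC.
- by move=> x [hx _]; exact: hnorm2_ge0.
Qed.

Lemma kernel_orth j g : hardy2 g ->
  hardy_dot (hkernel (Num.conj (lam j))) (fun z => B z * g z) = 0.
Proof.
move=> hg; have hw := weyl_mul hg; have uj := node_upper j.
by rewrite (dotC hph hw (hardy2_kernel uj)) hdot_kernel// weyl_node mul0r cj0.
Qed.

Lemma model_map_in x : model_space B (F x).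
Proof.
split; first exact: (model_map_rough x).1.
move=> g hg; have hw := weyl_mul hg.
have sp m p : spn V m p -> hardy_dot (F p) (fun z => B z * g z) = 0.
  move=> [c ->]; elim: m => [|m IH].
    rewrite big_ord0 model_map0; exact: (dot0l hph hw).
  rewrite big_ord_recr/= addrC model_map_lin hdot_linl//; try exact: (model_map_rough _).1.
  by rewrite IH addr0 model_map_defect kernel_orth// mulr0.
apply/eqP; rewrite -normc_eq0 -sqrf_eq0 eq_le sqr_ge0 andbT.
apply/ler_addgt0Pr => e e0; rewrite add0r.
set G := fun z => B z * g z in hw sp *.
have G1 : 0 < hnorm2 G + 1 by rewrite ltr_wpDl// hnorm2_ge0.
have [p hp] := approx_seq x (divr_gt0 e0 G1).
have [[m mp] xp] := hp 0%N; rewrite divr1 in xp.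
have -> : hardy_dot (F x) G = hardy_dot (F (x - p 0%N)) G.
  rewrite model_mapB (dotBl hph (model_map_rough x).1 (model_map_rough (p 0%N)).1 hw).
  by rewrite (sp m _ mp) subr0.
apply: le_trans (cauchy_schwarz hph (model_map_rough (x - p 0%N)).1 hw) _.
rewrite -[n2 _ (F _)]/(hnorm2 (F _)) model_map_isometry.
apply: (@le_trans _ _ (e / (hnorm2 G + 1) * (hnorm2 G + 1))).
  by apply: ler_pM; rewrite ?N_ge0 ?lerDl// (n2_ge0 hph).
by rewrite divfK// gt_eqF.
Qed.

(** The Hardy kernel splits as k_z = conj (B z) B k_z + F v_(conj z). The value of f at z is its
    pairing with k_z; the first part lies in B H^2 and the second in the image of F. *)
Lemma model_orth_eq0 f : model_space B f -> (forall x, hardy_dot f (F x) = 0) -> f = 0.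
Proof.
move=> [hf f0] fx; apply/funext => z.
have [uz|uz] := pselect (upper z); last by case: hf => h _ _; rewrite h.
rewrite -(hdot_kernel hf uz).
pose x := (v (Num.conj z)).1; have hk := hardy2_kernel uz.
have hw := weyl_mul hk.
have -> : hkernel z = Num.conj (B z) *: (fun u => B u * hkernel z u) + F x.
  apply/funext => u; rewrite [RHS](_ : _ = Num.conj (B z) * (B u * hkernel z u) + F x u)//.
  rewrite /hkernel /model_map; case: ifP => uu; last by rewrite !mulr0 addr0.
  rewrite (defect_gram triplet vP)// (weylE ip_norm Tsym triplet vP uz).
  rewrite (weylE ip_norm Tsym triplet vP (z := u))//.
  by ring.
rewrite (dotDr hph)//; last 2 first.
- exact: (phZ hph).
- exact: (model_map_rough x).1.
by rewrite (dotZr hph)// f0// fx mulr0 addr0.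
Qed.

(** The image is complete because F is isometric, so f projects onto it, and the remainder vanishes
    by [model_orth_eq0]. *)
Lemma model_map_surj f : model_space B f -> exists x, F x = f.
Proof.
move=> Sf; have mph := model_prehilbert.
have [p [x _ <-] fp] : exists2 p, [set g | exists2 x, setT x & F x = g] p &
    forall k, [set g | exists2 x, setT x & F x = g] k -> hardy_dot (f - p) k = 0.
  apply: (projection mph) => //.
  - by move=> _ [x _ <-]; exact: model_map_in.
  - by move=> c _ _ [x _ <-] [y _ <-]; exists (c *: x + y); rewrite ?model_map_lin.
  - by exists 0 => //; exact: model_map0.
  move=> u uK cu; have /choice[x xu] : forall n, exists x, F x = u n.
    by move=> n; have [x _ hx] := uK n; exists x.
  have Fd a b : n2 (@hardy_dot R) (F a - F b) = N (a - b).
    by rewrite -model_mapB -[LHS]/(hnorm2 _) model_map_isometry.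
  have [|y _ xy] := ip_complete ip_norm (u := x) (fun=> I).
    move=> e e0; have [M HM] := cu e e0; exists M => n m Mn Mm.
    by rewrite -Fd !xu; exact: HM.
  exists (F y); first by exists y.
  move=> e e0; have [M HM] := xy e e0; exists M => n Mn.
  by rewrite -xu Fd; exact: HM.
exists x; apply/eqP; rewrite eq_sym -subr_eq0; apply/eqP; apply: model_orth_eq0.
  by apply: (phB mph) => //; exact: model_map_in.
by move=> y; apply: fp; exists y.
Qed.

End FunctionalModel.

(** * Blaschke products and the Riesz basis criterion *)

Section InfiniteProduct.
Variable R : realType.
Local Notation C := R[i].

Lemma cvg_of_summable_steps (u : nat -> C) (a : nat -> R) (K : R) :
  (forall n, normc (u n.+1 - u n) <= a n) -> (forall n, \sum_(k < n) a k <= K) ->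
  exists l : C, (u n : C^o) @[n --> \oo] --> (l : C^o).
Proof.
move=> ua aK.
have a0 n : 0 <= a n by apply: le_trans (ua n); exact: normc_ge0.
have key (p : C -> R) : (forall x y, p (x - y) = p x - p y) -> (forall x, `|p x| <= normc x) ->
    exists l : R, p (u n) @[n --> \oo] --> l.
  move=> pB pn; pose d n := p (u n.+1) - p (u n).
  have cn : cvgn (series (fun n => `|d n|)).
    apply: nondecreasing_is_cvgn.
      by apply/nondecreasing_seqP => n; rewrite seriesSr lerDl.
    exists K => _ [n _ <-]; apply: le_trans (aK n).
    rewrite seriesEord/=; apply: ler_sum => i _.
    by rewrite /d -pB; apply: le_trans (pn _) (ua i).
  have /cvg_ex[l hl] : cvgn (series d) by apply: normed_cvg.
  exists (l + p (u 0%N)).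
  have -> : (fun n => p (u n)) = (fun n => series d n + p (u 0%N)).
    by apply/funext => n; rewrite seriesEnat/= telescope_sumr// subrK.
  by apply: cvgD => //; exact: cvg_cst.
have [x hx] := key (@complex.Re R) (@reB _) (@normc_re _).
have [y hy] := key (@complex.Im R) (@imB _) (@normc_im _).
exists (x +i* y); apply/cvgcP => e e0; have e2 : 0 < e / 2 by rewrite divr_gt0.
move/cvgrPdist_le: hx => /(_ _ e2) hx; move/cvgrPdist_le: hy => /(_ _ e2) hy.
near=> n; apply: le_trans (normc_le_reim _) _; rewrite reB imB/=.
have h1 : `|x - re (u n)| <= e / 2 by near: n.
have h2 : `|y - im (u n)| <= e / 2 by near: n.
by rewrite distrC [X in _ + X]distrC; lra.
Unshelve. all: by end_near.
Qed.

(* From [1 + (1 - x) <= 1 / x]. *)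
Lemma sum_le_inv_prod (P : pred nat) (x : nat -> R) n :
  (forall k, 0 <= x k <= 1) ->
  (1 + \sum_(k < n | P k) (1 - x k)) * \prod_(k < n | P k) x k <= 1 /\
  0 <= \prod_(k < n | P k) x k <= 1.
Proof.
move=> hx; elim: n => [|n [IH /andP[p0 p1]]]; first by rewrite !big_ord0 addr0 mul1r !lexx ler01.
have -> : \sum_(k < n.+1 | P k) (1 - x k) =
    \sum_(k < n | P k) (1 - x k) + (if P n then 1 - x n else 0).
  by rewrite big_mkcond big_ord_recr/= -big_mkcond.
have -> : \prod_(k < n.+1 | P k) x k = \prod_(k < n | P k) x k * (if P n then x n else 1).
  by rewrite big_mkcond big_ord_recr/= -big_mkcond.
case: ifP => _; last by rewrite addr0 mulr1 p0 p1.
move: p0 p1 IH; move: (\prod_(k < n | P k) x k) (\sum_(k < n | P k) (1 - x k)) => p s p0 p1 IH.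
have /andP[x0 x1] := hx n; split; last by rewrite mulr_ge0// mulr_ile1.
have h1 := ler_wpM2r x0 IH.
have h2 : (1 - x n) * (p * x n) <= 1 - x n by rewrite ler_piMr ?subr_ge0// mulr_ile1.
have -> : (1 + (s + (1 - x n))) * (p * x n) = (1 + s) * p * x n + (1 - x n) * (p * x n) by ring.
by apply: le_trans (lerD h1 h2) _; rewrite mul1r addrC subrK.
Qed.

Variable lam : nat -> C.
Hypothesis lam_neg : forall j, im (lam j) < 0.
Local Notation w := (fun j => Num.conj (lam j)).

Lemma lam_neq0 j : lam j != 0.
Proof. by apply: contraTneq (lam_neg j) => ->; rewrite ltxx. Qed.

Lemma upper_conj j : upper (w j).
Proof. by rewrite /upper imJ oppr_gt0. Qed.

Definition Bfactor (k : nat) (z : C) : C :=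
  lam k / Num.conj (lam k) * ((z - Num.conj (lam k)) / (z - lam k)).

Lemma Bfactor_blaschke k z : Bfactor k z = lam k / Num.conj (lam k) * blaschke (w k) z.
Proof. by rewrite /Bfactor /blaschke conjK. Qed.

Lemma normc_phase j : normc (lam j / Num.conj (lam j)) = 1.
Proof. by rewrite normcM_eq normcV_eq normc_conj mulfV// normc_eq0 lam_neq0. Qed.

Lemma normc_Bfactor k z : normc (Bfactor k z) = normc (blaschke (w k) z).
Proof. by rewrite Bfactor_blaschke normcM_eq normc_phase mul1r. Qed.

Definition Bpart (l n : nat) (z : C) : C := \prod_(0 <= k < n | k != l) Bfactor k z.

Lemma normc_Bpart l n z : normc (Bpart l n z) = \prod_(0 <= k < n | k != l) normc (blaschke (w k) z).
Proof. by rewrite normc_prod; apply: eq_bigr => k _; exact: normc_Bfactor. Qed.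

Lemma B_prodE l z : B_prod lam l z =
  lam l / Num.conj (lam l) * lim ((Bpart l n z : C^o) @[n --> \oo]).
Proof. by []. Qed.

Lemma normc_Bpart_le1 l n z : upper z -> normc (Bpart l n z) <= 1.
Proof.
move=> uz; rewrite normc_Bpart; apply: prod_le1 => k _.
by rewrite normc_ge0 blaschke_le1//; exact: upper_conj.
Qed.

Lemma BpartS l n z : Bpart l n.+1 z = Bpart l n z * (if n != l then Bfactor n z else 1).
Proof. by rewrite /Bpart big_mkcond big_nat_recr//= -big_mkcond. Qed.

Lemma Bpart_decr l m n z : upper z -> (m <= n)%N ->
  normc (Bpart l n z) <= normc (Bpart l m z).
Proof.
move=> uz; elim: n => [|n IH]; first by rewrite leqn0 => /eqP ->.
rewrite leq_eqVlt => /predU1P[->//|]; rewrite ltnS => /IH; apply: le_trans.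
rewrite BpartS normcM_eq ler_piMr ?normc_ge0//.
by case: ifP => _; rewrite ?normc_1// normc_Bfactor blaschke_le1//; exact: upper_conj.
Qed.

(** The left side is 2 |z| |Im lam_k| / (|lam_k| |z - lam_k|), while 1 - |blaschke|^2 is 4 Im z |Im
    lam_k| / |z - lam_k|^2. Their ratio is bounded because |z - lam_k| <= (|z| / c + 1) |lam_k|;
    this is where the eigenvalues must stay away from 0. *)
Lemma Bfactor_sub1 (c : R) k z : 0 < c -> c <= normc (lam k) -> upper z ->
  normc (Bfactor k z - 1) <=
  normc z * (normc z / c + 1) / (2 * im z) * (1 - normc (blaschke (w k) z) ^+ 2).
Proof.
move=> c0 ck uz; have uk := upper_conj k; have uz' : 0 < im z by [].
have lk := lam_neq0 k; have lk' : Num.conj (lam k) != 0 by rewrite -normc_eq0 normc_conj normc_eq0.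
have zk := upper_sub_conj uz uk; rewrite conjK in zk.
have -> : Bfactor k z - 1 = z * (lam k - Num.conj (lam k)) / (Num.conj (lam k) * (z - lam k)).
  by rewrite /Bfactor; field; rewrite lk' zk.
rewrite normc_blaschke2// conjK imJ subKr.
have -> : lam k - Num.conj (lam k) = 2 * 'i * (im (lam k))%:C.
  by apply: complex_ext; rewrite !(reB, imB, reM, imM, reJ, imJ)/=; ring.
rewrite !normcM_eq normcV_eq normcM_eq normc_conj normc_i normc_real ltr0_norm//.
have -> : normc (2 : C) = 2 by have := normc_real (2 : R); rewrite ger0_norm// => <-; congr normc; apply: complex_ext; rewrite ?reD ?imD/= ?addr0.
have zl : normc (z - lam k) <= (normc z / c + 1) * normc (lam k).
  apply: le_trans (normcB_le _ _) _; rewrite mulrDl mul1r lerD2r -mulrA ler_peMr ?normc_ge0//.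
  by rewrite mulrC ler_pdivlMr// mul1r.
have a0 : 0 < normc (lam k) by rewrite normc_gt0.
have b0 : 0 < normc (z - lam k) by rewrite normc_gt0.
have y0 : 0 < - im (lam k) by rewrite oppr_gt0.
move: zl a0 b0 y0; move: (normc (lam k)) (normc (z - lam k)) (- im (lam k)) => a b y.
have := normc_ge0 z; move: (normc z) (normc z / c + 1) => Z Q Z0 zl a0 b0 y0.
have -> : Z * Q / (2 * im z) * (4 * im z * y / b ^+ 2) = Z * (2 * y) * (Q / b ^+ 2).
  by field; rewrite !gt_eqF.
rewrite mulr1 ler_wpM2l ?mulr_ge0 ?(ltW y0)//.
rewrite ler_pdivlMr ?exprn_gt0// mulrC ler_pdivrMr ?mulr_gt0//.
rewrite expr2; nra.
Qed.

(** A lower bound d on the finite products bounds the sum of the terms 1 - |blaschke|^2 by d^-2,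
    through [sum_le_inv_prod]; [Bfactor_sub1] transfers summability to the complex factors. *)
Lemma Bpart_cvg (c d : R) l : 0 < c -> (forall k, c <= normc (lam k)) -> 0 < d ->
  (forall n, (l < n)%N -> d <= normc (Bpart l n (w l))) ->
  exists L : C, (Bpart l n (w l) : C^o) @[n --> \oo] --> (L : C^o).
Proof.
move=> c0 cl d0 hd; have uz := upper_conj l; set z := w l in uz hd *.
pose x k := normc (blaschke (w k) z) ^+ 2.
have x01 k : 0 <= x k <= 1.
  rewrite sqr_ge0 expr_le1 ?normc_ge0// blaschke_le1//; exact: upper_conj.
pose Q := normc z * (normc z / c + 1) / (2 * im z).
have Q0 : 0 <= Q.
  by rewrite !mulr_ge0 ?addr_ge0 ?mulr_ge0 ?normc_ge0 ?invr_ge0 ?mulr_ge0// ?ltW.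
have hd' n : d <= normc (Bpart l n z).
  have [ln|nl] := leqP n l; last exact: hd.
  by apply: le_trans (hd l.+1 (ltnSn l)) _; apply: Bpart_decr => //; exact: leqW.
apply: (@cvg_of_summable_steps _ (fun k => Q * (if k != l then 1 - x k else 0)) (Q * (d ^+ 2)^-1)).
  move=> n; rewrite BpartS -[X in _ - X]mulr1 -mulrBr normcM_eq.
  case: ifP => nl; last by rewrite subrr normc_0 !mulr0.
  apply: le_trans (Bfactor_sub1 c0 (cl n) uz).
  by rewrite ler_piMl ?normc_ge0// normc_Bpart_le1.
move=> n; rewrite -mulr_sumr ler_wpM2l// -big_mkcond/=.
have [h /andP[p0 p1]] := sum_le_inv_prod (fun k => k != l) n x01.
have pd : d ^+ 2 <= \prod_(k < n | k != l :> nat) x k.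
  rewrite prodrXl ler_pXn2r ?nnegrE ?(ltW d0)//; last by apply: prodr_ge0 => k _; exact: normc_ge0.
  by have := hd' n; rewrite normc_Bpart big_mkord.
have d2 : 0 < d ^+ 2 by rewrite exprn_gt0.
rewrite -[leRHS]mul1r ler_pdivlMr//.
set s := \sum_(_ < _ | _) _ in h *.
have s0 : 0 <= s by apply: sumr_ge0 => k _; rewrite subr_ge0; have /andP[] := x01 k.
apply: le_trans (ler_wpM2l s0 pd) _; apply: le_trans h.
by rewrite ler_wpM2r// lerDr.
Qed.

Lemma B_prod_ge (c d : R) l : 0 < c -> (forall k, c <= normc (lam k)) -> 0 < d ->
  (forall n, (l < n)%N -> d <= normc (Bpart l n (w l))) ->
  d <= normc (B_prod lam l (w l)).
Proof.
move=> c0 cl d0 hd; have [L hL] := Bpart_cvg c0 cl d0 hd.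
rewrite B_prodE normcM_eq normc_phase mul1r.
have E : lim ((Bpart l n (w l) : C^o) @[n --> \oo]) = L by apply: (cvg_lim (@norm_hausdorff _ _) hL).
rewrite E.
apply/ler_addgt0Pr => e e0; move/cvgcP: hL => /(_ e e0)[m _ Hm].
pose n := maxn m l.+1; have h1 := Hm n (leq_maxl _ _); have h2 := hd n (leq_maxr _ _).
apply: le_trans h2 _; have := normcD_le L (Bpart l n (w l) - L).
rewrite addrC subrK => h3; move: h1 h3 => /=; lra.
Qed.

(* The junk value [0] of the limit of a divergent product is excluded by [0 < d]. *)
Lemma Bpart_ge (d : R) l : 0 < d -> d <= normc (B_prod lam l (w l)) ->
  forall n, d <= normc (Bpart l n (w l)).
Proof.
move=> d0; have uz := upper_conj l.
rewrite B_prodE normcM_eq normc_phase mul1r => hd n.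
have [/cvg_ex[L hL]|nc] := pselect (cvgn (fun n => Bpart l n (w l) : C^o)); last first.
  by move: hd; rewrite (dvgP nc) [normc _]normc_0 leNgt d0.
have E : lim ((Bpart l n (w l) : C^o) @[n --> \oo]) = L by apply: (cvg_lim (@norm_hausdorff _ _) hL).
rewrite E in hd; apply: le_trans hd _.
apply/ler_addgt0Pr => e e0; move/cvgcP: hL => /(_ e e0)[m _ Hm].
have h1 := Hm (maxn m n) (leq_maxl _ _).
have h2 := Bpart_decr l uz (leq_maxr m n).
have := normcB_le (Bpart l (maxn m n) (w l)) (Bpart l (maxn m n) (w l) - L).
rewrite opprB addrC subrK => h3; move: h1 h2 h3 => /=; lra.
Qed.

End InfiniteProduct.

Section BoundedMaps.
Variables (R : realType) (V : lmodType R[i]) (dot : V -> V -> R[i]).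
Hypothesis ph : prehilbert setT dot.
Hypothesis definite : forall x, n2 dot x = 0 -> x = 0.

Lemma bounded_eq_id (a : nat -> V) (P : V -> V) (M : R) :
  (forall c x y, P (c *: x + y) = c *: P x + P y) ->
  (forall x, n2 dot (P x) <= M * n2 dot x) ->
  (forall x (e : R), 0 < e -> exists n, exists2 p, spn a n p & n2 dot (x - p) <= e) ->
  (forall j, P (a j) = a j) -> forall x, P x = x.
Proof.
move=> PL PM da Pa x.
have P0 : P 0 = 0.
  have := PL 1 0 0; rewrite !scale1r addr0 => h.
  by apply: (addrI (P 0)); rewrite addr0 -h.
have Ps n p : spn a n p -> P p = p.
  move=> [c ->]; elim: n => [|n IH]; first by rewrite big_ord0.
  by rewrite big_ord_recr/= addrC PL IH Pa.
have M0 : 0 <= `|M| by [].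
apply/eqP; rewrite -subr_eq0; apply/eqP; apply: definite.
apply/eqP; rewrite eq_le (n2_ge0 ph)// andbT; apply/ler_addgt0Pr => e e0; rewrite add0r.
have k0 : 0 < 2 * `|M| + 2 by rewrite ltr_wpDl// mulr_ge0.
have [n [p sp xp]] := da x _ (divr_gt0 e0 k0).
have E : P x - x = P (x - p) - (x - p).
  have -> : P (x - p) = P x - p by rewrite addrC -scaleN1r PL (Ps n p sp) scaleN1r addrC.
  by rewrite opprB addrA subrK.
rewrite E; apply: le_trans (n2D_le ph (x := P (x - p)) (y := - (x - p)) I I) _.
rewrite (n2N ph)//.
have h1 : n2 dot (P (x - p)) <= `|M| * n2 dot (x - p).
  by apply: le_trans (PM _) _; rewrite ler_wpM2r ?ler_norm// (n2_ge0 ph).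
have h2 := ler_wpM2l (ltW k0) xp.
rewrite [X in _ <= X]mulrC divfK ?gt_eqF// in h2; lra.
Qed.

End BoundedMaps.

(** * Separation and the Riesz basis property *)

Section RieszCriterion.
Variables (R : realType) (H : completeNormedModType R[i]).
Variables (ip : {dot H for Num.conj}) (T : partial_op H) (Gp Gm : H * H -> R[i]^o).
Variables (lam : nat -> R[i]) (v : R[i] -> H * H).
Local Notation C := R[i].
Local Notation N := (n2 ip).
Hypothesis ip_norm : norm_from_dot ip.
Hypothesis Tsym : symmetric_op ip T.
Hypothesis Treg : regular_op T.
Hypothesis triplet : boundary_triplet ip T Gp Gm.
Hypothesis Tcomplete : complete_rel (T_infty ip T Gp).
Hypothesis lam_inj : injective lam.
Hypothesis lamE : forall z, eigenvalue_of (T_infty ip T Gp) z <-> exists j, lam j = z.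
Hypothesis lam_simple : forall j, simple_eigenvalue (T_infty ip T Gp) (lam j).
Hypothesis vP : forall z, im z < 0 -> W_space ip T z (v z) /\ Gm (v z) = 1.
Let ph := ip_prehilbert ip_norm.
Let hph := @hardy_prehilbert R.
Local Notation B := (weyl ip T Gp Gm).
Local Notation F := (model_map ip v).
Local Notation w := (fun j => Num.conj (lam j)).
Local Notation f := (fun j => model_eigenvector (lam j)).
Let mph := model_prehilbert ip_norm Tsym triplet vP.

Definition separated (d : R) : Prop := forall n j, (j < n)%N ->
  d <= \prod_(0 <= k < n | k != j) normc (blaschke (w k) (w j)).

Let uw j : upper (w j) := node_upper ip_norm Treg triplet lamE vP j.

Lemma eigenvectorE j : model_eigenvector (Num.conj (w j)) = f j.
Proof. by rewrite conjK. Qed.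

(** The preimage of f_j under the model map, with the scalar from [model_eigenvector_kernel]. *)
Definition eigenvec (j : nat) : H :=
  (- 'i * (Num.sqrt (2 * im (w j)))%:C) *: (v (lam j)).1.

Lemma model_map_eigenvec j : F (eigenvec j) = f j.
Proof.
have := model_map_lin ip v (- 'i * (Num.sqrt (2 * im (w j)))%:C) (v (lam j)).1 0.
rewrite addr0 model_map0 addr0 => ->.
by rewrite (model_map_defect ip_norm Treg triplet lamE vP) -model_eigenvector_kernel// eigenvectorE.
Qed.

Lemma eigenvec_in j : model_space B (f j).
Proof.
rewrite /= -model_map_eigenvec.
exact: (model_map_in ip_norm Tsym Treg triplet Tcomplete lamE lam_simple vP).
Qed.

Lemma riesz_separated : riesz_complete lam ip T Gp Gm -> exists2 d, 0 < d & separated d.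
Proof.
move=> [e [A [A' [[eS eon _] _ [A'S A'L [M A'M]] inv fA]]]].
(* The constant of a bounded operator comes without a sign, hence the absolute value; |M| <= (|M| +
   1)^2 then replaces a square root. *)
have M1 : 0 < `|M| + 1 by rewrite ltr_wpDl.
exists (`|M| + 1)^-1; first by rewrite invr_gt0.
move=> n j jn.
have winj : injective w by move=> a b /(congr1 (fun z => Num.conj z)); rewrite !conjK => /lam_inj.
have [c [cj cn]] := dual_combination uw winj jn.
set P := \prod_(_ <= _ < _ | _) _ in cj *.
rewrite (eq_bigr (fun m : 'I_n => c m *: f m)) in cn; last by move=> m _; rewrite eigenvectorE.
set q := \sum_(m < n) _ in cn.
have Sq : model_space B q by apply: (ph_sum mph) => m _; apply: (phZ mph); exact: eigenvec_in.
have A'q : A' q = \sum_(m < n) c m *: e m.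
  rewrite /q; elim: n {jn P cj q cn Sq} => [|n IH].
    rewrite !big_ord0; have := A'L 1 0 0 (ph0 mph) (ph0 mph); rewrite !scale1r addr0 => h.
    by apply: (addrI (A' 0)); rewrite addr0 -h.
  rewrite !big_ord_recr/= addrC A'L; [|exact: eigenvec_in|]; last first.
    by apply: (ph_sum mph) => m _; apply: (phZ mph); exact: eigenvec_in.
  by rewrite IH fA (inv _ (eS n)).1 addrC.
have h1 : normc (c j) ^+ 2 <= n2 (@hardy_dot R) (A' q).
  rewrite A'q (n2_orthonormal mph)//.
  by rewrite (bigD1 (Ordinal jn))//= lerDl sumr_ge0// => m _; rewrite sqr_ge0.
have h2 : n2 (@hardy_dot R) (A' q) <= `|M|.
  have := A'M q Sq; rewrite (dot_n2 mph (A'S _ Sq)) (dot_n2 mph Sq) -(rmorphM (real_complex R)) lecR => h.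
  apply: le_trans h _; apply: le_trans (ler_wpM2r (n2_ge0 mph Sq) (ler_norm M)) _.
  by rewrite ler_piMr.
have c1 : normc (c j) <= `|M| + 1.
  rewrite -(@ler_pXn2r _ 2) ?nnegrE ?normc_ge0 ?(ltW M1)//.
  apply: le_trans (le_trans h1 h2) _; have := normr_ge0 M; nra.
have c0 : 0 < normc (c j).
  rewrite lt0r normc_ge0 andbT; apply/eqP => h; move: cj; rewrite h mul0r => /eqP.
  by rewrite eq_sym oner_eq0.
have -> : P = (normc (c j))^-1 by rewrite -[P](mulKf (lt0r_neq0 c0)) cj mulr1.
by rewrite lef_pV2.
Qed.

(** The work is done in H: orthonormalizing the preimages h_j of the eigenvectors gives e_j, the two
    Riesz bounds make e_j -> h_j and its inverse bounded, and the model map carries everything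
    over. *)
Lemma separated_riesz (d : R) : 0 < d -> separated d -> riesz_complete lam ip T Gp Gm.
Proof.
move=> d0 sep; pose K := (6 / d ^+ 3) ^+ 2; have K0 : 0 <= K by exact: sqr_ge0.
have FL := model_map_lin ip v.
have Fn := model_map_isometry ip_norm Tsym Treg triplet Tcomplete lamE lam_simple vP.
have Fd := model_map_dot ip_norm Tsym Treg triplet Tcomplete lamE lam_simple vP.
have Fin := model_map_in ip_norm Tsym Treg triplet Tcomplete lamE lam_simple vP.
have Fsum n (c : nat -> C) (x : nat -> H) : F (\sum_(i < n) c i *: x i) = \sum_(i < n) c i *: F (x i).
  elim: n => [|n IH]; first by rewrite !big_ord0 model_map0.
  by rewrite !big_ord_recr/= addrC FL IH addrC.
pose h := eigenvec.
have hsum n (c : nat -> C) : N (\sum_(i < n) c i *: h i) =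
    hnorm2 (\sum_(i < n) c i *: model_eigenvector (Num.conj (w i))).
  by rewrite -Fn Fsum; congr hnorm2; apply: eq_bigr => i _; rewrite model_map_eigenvec eigenvectorE.
have low n (c : nat -> C) : \sum_(i < n) normc (c i) ^+ 2 <= K * N (\sum_(i < n) c i *: h i).
  by rewrite hsum; exact: (riesz_lower uw d0 sep n c).
have upp n (c : nat -> C) : N (\sum_(i < n) c i *: h i) <= K * \sum_(i < n) normc (c i) ^+ 2.
  by rewrite hsum; exact: (riesz_upper uw d0 sep n c).
(* The coefficient of h n in this combination is 1, so by the lower bound its norm cannot vanish. *)
have hfree n x : spn h n x -> 0 < N (h n - x).
  move=> [c ->]; rewrite lt0r N_ge0// andbT; apply/eqP => h0.
  have := low n.+1 (fun i => if (i < n)%N then - c i else 1).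
  rewrite !big_ord_recr/= ltnn normc_1 expr1n scale1r.
  have -> : \sum_(i < n) (if (i < n)%N then - c i else 1) *: h i = - \sum_(i < n) c i *: h i.
    by rewrite -sumrN; apply: eq_bigr => i _; rewrite ltn_ord scaleNr.
  rewrite [- _ + _]addrC h0 mulr0 leNgt => /negP; apply.
  by rewrite ltr_wpDl// sumr_ge0// => i _; rewrite sqr_ge0.
have hdense x (e : R) : 0 < e -> exists n, exists2 p, spn h n p & N (x - p) <= e.
  move=> e0; have [n [p [c ->] xp]] := defect_dense ip_norm Treg triplet vP Tcomplete lamE lam_simple x e0.
  exists n, (\sum_(i < n) c i *: (v (lam i)).1) => //.
  have s0 i : - 'i * (Num.sqrt (2 * im (w i)))%:C != 0.
    rewrite mulf_neq0 ?oppr_eq0 ?ic_neq0// -normc_eq0 normc_real normr_eq0 gt_eqF// sqrtr_gt0 mulr_gt0//.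
    exact: uw.
  exists (fun i => c i / (- 'i * (Num.sqrt (2 * im (w i)))%:C)); apply: eq_bigr => i _.
  by rewrite scalerA divfK.
have [e [_ eon espn]] := gram_schmidt ph (fun _ => I) hfree.
have edense x (s : R) : 0 < s -> exists n, exists2 p, spn e n p & N (x - p) <= s.
  by move=> s0; have [n [p hp xp]] := hdense x s s0; exists n, p => //; exact: espn.
have esum n (c : nat -> C) : N (\sum_(i < n) c i *: e i) = \sum_(i < n) normc (c i) ^+ 2.
  by rewrite (n2_orthonormal ph).
have dfn x : setT x -> N x = 0 -> x = 0 by move=> _; exact: ip_definite.
have cpl := ip_complete ip_norm.
(* L sends e to h and is bounded by the upper Riesz bound; L' sends h to e and is bounded by the
   lower one. Both use that the squared norm of a combination of the e_i is the sum of squares. *)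
have [L [_ LL LM Le]] := @bounded_extension _ _ setT ip ph e h K K0 (fun=> I) (fun=> I) dfn cpl
  (fun x _ => @edense x) (fun n c => eq_ind_r (fun t => _ <= K * t) (upp n c) (esum n c)).
have [L' [_ LL' LM' Le']] := @bounded_extension _ _ setT ip ph h e K K0 (fun=> I) (fun=> I) dfn cpl
  (fun x _ => @hdense x) (fun n c => eq_ind_r (fun t => t <= _) (low n c) (esum n c)).
have LK x : L' (L x) = x.
  apply: (bounded_eq_id ph (fun x => dfn x I) (a := e) (P := fun x => L' (L x)) (M := K * K)) => //.
  - by move=> c a b; rewrite LL// LL'.
  - by move=> a; rewrite -(mulrA K K); apply: (le_trans (LM' _ I)); apply: (ler_wpM2l K0); exact: LM.
  - by move=> j; rewrite Le Le'.
have LK' x : L (L' x) = x.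
  apply: (bounded_eq_id ph (fun x => dfn x I) (a := h) (P := fun x => L (L' x)) (M := K * K)) => //.
  - by move=> c a b; rewrite LL'// LL.
  - by move=> a; rewrite -(mulrA K K); apply: (le_trans (LM _ I)); apply: (ler_wpM2l K0); exact: LM'.
  - by move=> j; rewrite Le' Le.
(* G inverts F on the model space, so that L and L' become operators there. *)
have /choice[G HG] : forall g, exists x, model_space B g -> F x = g.
  move=> g; have [Sg|nS] := pselect (model_space B g); last by exists 0.
  have [x hx] := model_map_surj ip_norm Tsym Treg triplet Tcomplete lamE lam_simple vP Sg.
  by exists x.
have Finj x y : F x = F y -> x = y.
  move=> E; apply/eqP; rewrite -subr_eq0; apply/eqP; apply: (dfn _ I).
  by rewrite -Fn model_mapB E subrr; exact: (n2_0 hph).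
have GF x : G (F x) = x by apply: Finj; apply: HG; exact: Fin.
have GL c g g' : model_space B g -> model_space B g' -> G (c *: g + g') = c *: G g + G g'.
  move=> Sg Sg'; apply: Finj.
  by rewrite FL (HG _ Sg) (HG _ Sg') (HG _ (phL mph c Sg Sg')).
have Gd g g' : model_space B g -> model_space B g' -> hardy_dot g g' = ip (G g) (G g').
  by move=> Sg Sg'; rewrite -Fd !HG.
exists (fun j => F (e j)), (fun g => F (L (G g))), (fun g => F (L' (G g))); split.
- split=> [j|j k|g Sg s s0]; [exact: Fin|by rewrite Fd|].
  have s2 : 0 < s / 2 by rewrite divr_gt0.
  have [n [p sp xp]] := edense (G g) _ s2.
  exists (F p).
    apply/lspan_spn; exists n; have [c ->] := sp.
    by exists c; exact: Fsum.
  have -> : g - F p = F (G g - p) by rewrite model_mapB HG.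
  rewrite Fd (dot_n2 ph)// ltcR; apply: le_lt_trans xp _.
  by rewrite ltr_pdivrMr// ltr_pMr// ltr1n.
- split=> [g Sg|c g g' Sg Sg'|]; [exact: Fin|by rewrite GL// LL// FL|].
  exists K => g Sg; rewrite Fd (dot_n2 ph)// Gd// (dot_n2 ph)//.
  by rewrite -(rmorphM (real_complex R)) lecR; exact: LM.
- split=> [g Sg|c g g' Sg Sg'|]; [exact: Fin|by rewrite GL// LL'// FL|].
  exists K => g Sg; rewrite Fd (dot_n2 ph)// Gd// (dot_n2 ph)//.
  by rewrite -(rmorphM (real_complex R)) lecR; exact: LM'.
- by move=> g Sg; rewrite !GF LK LK' HG.
- by move=> j; rewrite GF Le model_map_eigenvec.
Qed.

(** The Riesz property bounds finite products only; with [eigenvalue_bound] this makes every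
    infinite product converge, to a limit that keeps the bound. Conversely, the infimum itself
    serves as the separation constant. *)
Lemma riesz_criterion : riesz_complete lam ip T Gp Gm <->
  0 < inf (range (fun j => normc (B_prod lam j (Num.conj (lam j))))).
Proof.
have lneg j := (lam_lower ip_norm Treg triplet lamE vP j).1.
split=> [/riesz_separated[d d0 sep]|i0].
  have [c c0 hc] := eigenvalue_bound ip_norm Treg triplet.
  have cl k : c <= normc (lam k) by apply: hc; apply/lamE; exists k.
  apply: (lt_le_trans d0); apply: lb_le_inf; first by exists (normc (B_prod lam 0 (w 0%N))); exists 0%N.
  move=> _ [j _ <-]; apply: (B_prod_ge lneg c0 cl d0) => n jn.
  by rewrite normc_Bpart//; exact: sep.
apply: (separated_riesz i0) => n j jn; rewrite -normc_Bpart//.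
apply: Bpart_ge => //; apply: ge_inf; last by exists j.
by exists 0 => _ [k _ <-]; exact: normc_ge0.
Qed.

End RieszCriterion.

Unset Implicit Arguments.

Theorem theorem6p12 (R : realType) (H : completeNormedModType R[i])
    (ip : {dot H for Num.conj}) (T : partial_op H)
    (Gp Gm : H * H -> R[i]^o) (lam : nat -> R[i])
    (ip_norm : norm_from_dot ip)
    (H_separable : separable H)
    (H_infinite : infinite_dimensional H)
    (T_entire : entire_class1 ip T)
    (triplet : boundary_triplet ip T Gp Gm)
    (T_infty_complete : complete_rel (T_infty ip T Gp))
    (lam_inj : injective lam)
    (lam_eigen : forall z, eigenvalue_of (T_infty ip T Gp) z <->
                           exists j, lam j = z)
    (lam_simple : forall j, simple_eigenvalue (T_infty ip T Gp) (lam j)) :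
  riesz_complete lam ip T Gp Gm <->
  0 < inf (range (fun j => normc (B_prod lam j (Num.conj (lam j))))).
Proof.
have [_ Tsym _ Treg _] := T_entire.
have /choice[v vP] := defect_minus ip_norm Tsym triplet.
exact: (riesz_criterion ip_norm Tsym Treg triplet T_infty_complete lam_inj
  lam_eigen lam_simple vP).
Qed.
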